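(* There is an algorithm that, given two FDDS $A$ and $B$, computes a connected FDDS $X$ such that $AX=B$ if one exists (and reports that none exists otherwise), in time $O(m^9)$, where $m$ is the size of its inputs (number of states).
   Context: A finite discrete-time dynamical system (FDDS) is a pair $(S,f)$ with $S$ a finite set and $f:S\to S$, identified with its transition digraph (arcs $s\to f(s)$) and considered up to isomorphism. An FDDS is connected if its transition digraph is weakly connected (equivalently, it has exactly one cycle). The product $AB$ of FDDS $(S,f)$ and $(S',g)$ is the FDDS $(S\times S', (s,s')\mapsto (f(s),g(s')))$, i.e. the direct product of the transition digraphs. Equality means isomorphism. *)

(* Defs.v *)
From mathcomp Require Import all_boot.

Set Implicit Arguments.
Unset Strict Implicit.
Unset Printing Implicit Defensive.

Record fdds := FDDS { state :> finType; next : state -> state }.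

Definition fdds_iso (A B : fdds) : Prop :=
  exists h : A -> B, bijective h /\ forall x : A, h (next x) = next (h x).

Definition fdds_mul (A B : fdds) : fdds :=
  @FDDS (A * B)%type (fun s : A * B => (next s.1, next s.2)).

Definition fdds_arc (A : fdds) : rel A := [rel x y | next x == y].

(* Weak connectivity of the transition digraph.  The empty system is not
   connected: a connected system has exactly one cycle. *)
Definition fdds_connected (A : fdds) : Prop :=
  0 < #|A| /\
  forall x y : A,
    connect [rel u v | fdds_arc u v || fdds_arc v u] x y.

(* [t] is the transition table of [A] for some numbering [e] of the states of
   [A] by 0, ..., #|A| - 1.  A table determines its system up to isomorphism,
   and one system has in general several tables. *)
Definition is_table (t : seq nat) (A : fdds) : Prop :=
  size t = #|A| /\
  exists e : A -> nat,
    [/\ injective e,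
        forall x, e x < #|A|
      & forall x, nth 0 t (e x) = e (next x)].

(* Algorithms are structured programs for the unit-cost random access machine
   of Cook and Reckhow: unbounded natural numbers, and addition and truncated
   subtraction as the only arithmetic operations.  There is no multiplication,
   since at unit cost on unbounded numbers it would make the model
   unreasonably powerful.  A program uses finitely many scalar variables and
   finitely many indirectly addressed arrays, all named by numbers. *)
Inductive expr :=
  | Cst of nat
  | Var of nat
  | Get of nat & expr
  | Add of expr & expr
  | Sub of expr & expr.

Inductive prog :=
  | Skip
  | Assign of nat & expr
  | Put of nat & expr & expr
  | Seq of prog & prog
  | If of expr & prog & prog
  | While of expr & prog.

Record store := Store { var : nat -> nat; arr : nat -> nat -> nat }.

Definition set_var (s : store) (x v : nat) : store :=
  Store (fun y => if y == x then v else var s y) (arr s).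

Definition set_arr (s : store) (a i v : nat) : store :=
  Store (var s)
        (fun b j => if (b == a) && (j == i) then v else arr s b j).

Fixpoint eval (s : store) (e : expr) : nat :=
  match e with
  | Cst c => c
  | Var x => var s x
  | Get a e1 => arr s a (eval s e1)
  | Add e1 e2 => eval s e1 + eval s e2
  | Sub e1 e2 => eval s e1 - eval s e2
  end.

(* Time to evaluate an expression: one unit per node. *)
Fixpoint cost (e : expr) : nat :=
  match e with
  | Cst _ | Var _ => 1
  | Get _ e1 => (cost e1).+1
  | Add e1 e2 | Sub e1 e2 => (cost e1 + cost e2).+1
  end.

(* [exec p s s' t]: started in [s], [p] halts in [s'] after [t] time units.
   Guards are true when nonzero; every test and every write costs one unit on
   top of the evaluation of its expressions. *)
Inductive exec : prog -> store -> store -> nat -> Prop :=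
  | ExecSkip s : exec Skip s s 1
  | ExecAssign s x e :
      exec (Assign x e) s (set_var s x (eval s e)) (cost e).+1
  | ExecPut s a e1 e2 :
      exec (Put a e1 e2) s (set_arr s a (eval s e1) (eval s e2))
        (cost e1 + cost e2).+1
  | ExecSeq p1 p2 s s1 s2 t1 t2 :
      exec p1 s s1 t1 -> exec p2 s1 s2 t2 ->
      exec (Seq p1 p2) s s2 (t1 + t2)
  | ExecIfTrue e p1 p2 s s1 t1 :
      eval s e != 0 -> exec p1 s s1 t1 ->
      exec (If e p1 p2) s s1 ((cost e).+1 + t1)
  | ExecIfFalse e p1 p2 s s1 t1 :
      eval s e = 0 -> exec p2 s s1 t1 ->
      exec (If e p1 p2) s s1 ((cost e).+1 + t1)
  | ExecWhileTrue e p s s1 s2 t1 t2 :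
      eval s e != 0 -> exec p s s1 t1 -> exec (While e p) s1 s2 t2 ->
      exec (While e p) s s2 ((cost e).+1 + t1 + t2)
  | ExecWhileFalse e p s :
      eval s e = 0 -> exec (While e p) s s (cost e).+1.

Lemma exec_det p s s1 t1 s2 t2 :
  exec p s s1 t1 -> exec p s s2 t2 -> s1 = s2 /\ t1 = t2.
Proof.
move=> E1; elim: E1 s2 t2 => {p s s1 t1}.
- by move=> s s2 t2 E; inversion E.
- by move=> s x e s2 t2 E; inversion E.
- by move=> s a e1 e2 s2 t2 E; inversion E.
- move=> p1 p2 s s1 s2 t1 t2 _ IH1 _ IH2 s3 t3 E; inversion E; subst.
  have [? ?] := IH1 _ _ ltac:(eassumption); subst.
  by have [-> ->] := IH2 _ _ ltac:(eassumption).
- move=> e p1 p2 s s1 t1 /eqP e0 _ IH s3 t3 E; inversion E; subst => //.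
  by have [-> ->] := IH _ _ ltac:(eassumption).
- move=> e p1 p2 s s1 t1 e0 _ IH s3 t3 E; inversion E; subst.
    by match goal with H : is_true (eval _ _ != 0) |- _ => move/eqP: H end.
  by have [-> ->] := IH _ _ ltac:(eassumption).
- move=> e p s s1 s2 t1 t2 /eqP e0 _ IH1 _ IH2 s3 t3 E; inversion E; subst => //.
  have [? ?] := IH1 _ _ ltac:(eassumption); subst.
  by have [-> ->] := IH2 _ _ ltac:(eassumption).
- move=> e p s e0 s3 t3 E; inversion E; subst => //.
  by match goal with H : is_true (eval _ _ != 0) |- _ => move/eqP: H end.
Qed.

(* Two tables as input: their sizes in variables 0 and 1, their entries in
   arrays 0 and 1, and 0 everywhere else. *)
Definition input (ta tb : seq nat) : store :=
  Store (nth 0 [:: size ta; size tb])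
        (fun a => nth 0 (nth [::] [:: ta; tb] a)).

(* An optional table as output: variable 0 is zero for [None]; otherwise the
   table is made of the first [var s 1] entries of array 0. *)
Definition output (s : store) : option (seq nat) :=
  if var s 0 == 0 then None else Some (mkseq (arr s 0) (var s 1)).

Definition connected_quotient (A B X : fdds) : Prop :=
  fdds_connected X /\ fdds_iso (fdds_mul A X) B.

Definition correct_answer (A B : fdds) (o : option (seq nat)) : Prop :=
  match o with
  | Some t => exists2 X : fdds, is_table t X & connected_quotient A B X
  | None => ~ exists X : fdds, connected_quotient A B X
  end.

Definition bigO (T g : nat -> nat) : Prop :=
  exists C N : nat, forall m : nat, N <= m -> T m <= C * g m.

(* Main.v *)
(* For a state y, the tree of its predecessors is described by its weights:
   the weight for the empty sequence is 1, and prolonging a sequence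
   multiplies a power of the weight of y by the sum over the predecessors u
   of y of a power of the weight of u. Weights are multiplicative on
   products and positive on cyclic states, so equality of all weights is an
   equivalence that can be cancelled by a cyclic factor. Ranking the states
   level by level by large powers realises this equivalence by numbers with
   polynomially many bits, and two systems are isomorphic exactly when all
   iterates have equally many fixed points in every class.

   If phi is an isomorphism from A X to B, the predecessors of phi(a, x)
   that lie above one cyclic predecessor a' of a can be found without
   knowing phi: take them greedily, in decreasing order of the classes of
   their products with a', as long as the products of the chosen states with
   the predecessors of a are, in each class, no more numerous than those of
   a' with the predecessors of phi(a, x). So once a cyclic state of X and
   its period p have been guessed, through a state w of B, the states phi(a,
   x) with a on one backward orbit of A and x the successive predecessors of
   the cyclic state form a copy of X, cut open at the cycle, inside B. Each
   guess gives one candidate, which is checked by counting fixed points;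
   there are polynomially many guesses.

   The program is written in a language whose loops are bounded by m = |A| +
   |B| + 2 or by m^2, so that nesting depth bounds the exponent of the
   running time. *)

Require Import Defs.
From mathcomp Require Import all_boot zify.
Import Defs.

Set Implicit Arguments.
Unset Strict Implicit.
Unset Printing Implicit Defensive.
Arguments next {f} _.

(** * Sums over finite sets *)

(** Weights multiply along products and hence can be cancelled, but they grow too fast to be
    computed; ranks are computable but not multiplicative. The link is that every level of ranks
    orders the states exactly as one suitably chosen weight does, so programs use ranks and proofs
    use weights. The greedy choice needs this order and not only the equivalence. Among the
    predecessors of the cyclic state a', take one, a'', of largest weight, positive because a' has a
    cyclic predecessor. When a state is chosen in excess, its product with a'' lies in a class that
    no product with a smaller state reaches, while the larger states have already been chosen in the
    right numbers; the excess shows in that class. A candidate is not shown isomorphic to the X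
    behind the guess. Its cycle only has to be equivalent, state by state, to the cycle of X, since
    all fixed points of iterates lie there. A wrong guess may produce any table at all, so each
    candidate is also tested for having a root that all its states reach. *)

Lemma sum_gt0P (T : finType) (P : pred T) (F : T -> nat) :
  reflect (exists2 i, P i & 0 < F i) (0 < \sum_(i | P i) F i).
Proof.
apply: (iffP idP) => [|[i Pi Fi]]; last by rewrite (bigD1 i) //= ltn_addr.
rewrite lt0n sum_nat_eq0 => /forallPn[i]; rewrite negb_imply -lt0n => /andP[Pi Fi].
by exists i.
Qed.

(** A key-preserving injection of [P] into [Q], removed one pair at a time: the count for the key of
    [u] is positive, so some [v] carries the same key. *)
Lemma sum_key_le (T T' : finType) (P : pred T) (Q : pred T') (k : T -> nat)
    (k' : T' -> nat) (f : T -> nat) (f' : T' -> nat) :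
  (forall c, \sum_(u | P u) (k u == c) <= \sum_(v | Q v) (k' v == c)) ->
  (forall u v, P u -> Q v -> k u = k' v -> f u <= f' v) ->
  \sum_(u | P u) f u <= \sum_(v | Q v) f' v.
Proof.
have [n] := ubnP #|P|; elim: n => // n IH in P Q * => leP le ff.
have [u Pu|P0] := pickP P; last by rewrite big_pred0.
have : 0 < \sum_(v | Q v) (k' v == k u).
  by apply: leq_trans (le _); rewrite (bigD1 u) //= eqxx.
case/sum_gt0P => v Qv; rewrite lt0b => /eqP kvu.
rewrite (bigD1 u) //= [leqRHS](bigD1 v) //=; apply: leq_add; first exact: ff.
apply: IH.
- move: leP; rewrite (cardD1 u) [u \in P]Pu add1n ltnS; apply: leq_trans.
  by rewrite ltnS; apply/subset_leq_card/subsetP => w /andP[Pw wu]; apply/andP.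
- move=> c; move: (le c); rewrite (bigD1 u) //= [leqRHS](bigD1 v) //= kvu.
  by rewrite leq_add2l.
- by move=> u1 v1 /andP[Pu1 _] /andP[Qv1 _]; apply: ff.
Qed.

Lemma sum_key (T T' : finType) (P : pred T) (Q : pred T') (k : T -> nat)
    (k' : T' -> nat) (f : T -> nat) (f' : T' -> nat) :
  (forall c, \sum_(u | P u) (k u == c) = \sum_(v | Q v) (k' v == c)) ->
  (forall u v, P u -> Q v -> k u = k' v -> f u = f' v) ->
  \sum_(u | P u) f u = \sum_(v | Q v) f' v.
Proof.
move=> cc ff; apply/eqP; rewrite eqn_leq; apply/andP; split.
  by apply: (sum_key_le (k := k) (k' := k')) => [c|u v Pu Qv e]; rewrite ?cc // (ff u v).
by apply: (sum_key_le (k := k') (k' := k)) => [c|u v Pu Qv e]; rewrite ?cc // (ff v u).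
Qed.

(* Sums of at most [#|T|] rapid weights compare lexicographically, from the
   largest weight down. *)
Definition rapid (T : finType) (w : T -> nat) : Prop :=
  forall x y, w x < w y -> #|T| * w x < w y.

Lemma sum_le_max (T : finType) (w : T -> nat) (V : {set T}) (m : nat) :
  (forall v, v \in V -> w v <= m) -> \sum_(v in V) w v <= #|T| * m.
Proof.
move=> le; apply: leq_trans (_ : \sum_(v in V) m <= _); first exact: leq_sum.
by rewrite sum_nat_const leq_mul2r max_card orbT.
Qed.

(** The larger maximum outweighs the whole other sum, and equal maxima cancel, so the comparison
    uses only the order of the weights and which of them vanish. This lets ranks be exchanged for
    other rapid weights ordered alike. *)
Lemma rapid_sum_le (T : finType) (w w' : T -> nat) (U V : {set T}) :
  rapid w -> rapid w' -> (forall x y, (w x < w y) = (w' x < w' y)) ->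
  (forall x, (w x == 0) = (w' x == 0)) ->
  \sum_(u in U) w u <= \sum_(v in V) w v ->
  \sum_(u in U) w' u <= \sum_(v in V) w' v.
Proof.
move=> rw rw' ord zero; have [n] := ubnP #|U|.
elim: n U V => // n IH U V leU le.
have [->|[u0 u0U]] := set_0Vmem U; first by rewrite big_set0.
have [V0|[v0 v0V]] := set_0Vmem V.
  move: le; rewrite V0 !big_set0 !leqn0 !sum_nat_eq0 => /forallP all0.
  by apply/forallP => u; rewrite -zero.
have [u uU umax] : exists2 u, u \in U & forall x, x \in U -> w x <= w u.
  by case: (arg_maxnP w u0U) => u uU um; exists u.
have [v vV vmax] : exists2 u, u \in V & forall x, x \in V -> w x <= w u.
  by case: (arg_maxnP w v0V) => u' uU' um; exists u'.
have wle x y : (w x <= w y) = (w' x <= w' y) by rewrite leqNgt [RHS]leqNgt ord.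
case: (ltngtP (w u) (w v)) => [uv|vu|uv].
- apply: leq_trans (_ : w' v <= _); last by rewrite (bigD1 v) //= leq_addr.
  apply: leq_trans (sum_le_max (m := w' u) _) (ltnW (rw' u v _)) => [x xU|].
    by rewrite -wle umax.
  by rewrite -ord.
- have : w u <= \sum_(v in V) w v.
    by apply: leq_trans le; rewrite (bigD1 u) //= leq_addr.
  rewrite leqNgt; case/negP.
  by apply: leq_ltn_trans (sum_le_max vmax) (rw v u vu).
- have uv' : w' u = w' v by apply/eqP; rewrite eqn_leq -!wle uv leqnn.
  rewrite (big_setD1 u) //= [leqRHS](big_setD1 v) //= uv' leq_add2l.
  apply: IH.
    by move: leU; rewrite (cardsD1 u) uU.
  by move: le; rewrite (big_setD1 u) //= [leqRHS](big_setD1 v) //= uv leq_add2l.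
Qed.

(** Equal sums of rapid weights force the same nonzero weights with the same multiplicities, and the
    sum of [f] depends on nothing else. *)
Lemma rapid_sum_fun (T : finType) (w f : T -> nat) (U V : {set T}) :
  rapid w -> (forall x y, w x = w y -> f x = f y) -> (forall x, w x = 0 -> f x = 0) ->
  \sum_(u in U) w u = \sum_(v in V) w v ->
  \sum_(u in U) f u = \sum_(v in V) f v.
Proof.
move=> rw fw f0; have [n] := ubnP #|U|.
elim: n U V => // n IH U V leU e.
have zero (S : {set T}) : \sum_(u in S) w u = 0 -> \sum_(u in S) f u = 0.
  move=> /eqP; rewrite sum_nat_eq0 => /forall_inP all0.
  by apply: big1 => u uS; apply/f0/eqP/all0.
have [U0|[u0 u0U]] := set_0Vmem U.
  by rewrite zero 1?zero // -?e U0 big_set0.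
have [V0|[v0 v0V]] := set_0Vmem V.
  by rewrite zero 1?zero // ?e V0 big_set0.
have [u uU umax] : exists2 u, u \in U & forall x, x \in U -> w x <= w u.
  by case: (arg_maxnP w u0U) => u uU um; exists u.
have [v vV vmax] : exists2 u, u \in V & forall x, x \in V -> w x <= w u.
  by case: (arg_maxnP w v0V) => u' uU' um; exists u'.
case: (ltngtP (w u) (w v)) => [uv|vu|uv].
- have : w v <= \sum_(v in U) w v by rewrite e (bigD1 v) //= leq_addr.
  rewrite leqNgt; case/negP.
  by apply: leq_ltn_trans (sum_le_max umax) (rw u v uv).
- have : w u <= \sum_(v in V) w v by rewrite -e (bigD1 u) //= leq_addr.
  rewrite leqNgt; case/negP.
  by apply: leq_ltn_trans (sum_le_max vmax) (rw v u vu).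
- rewrite (big_setD1 u) //= [RHS](big_setD1 v) //= (fw u v uv); congr addn.
  apply: IH; first by move: leU; rewrite (cardsD1 u) uU.
  by move: e; rewrite (big_setD1 u) //= [RHS](big_setD1 v) //= uv => /addnI.
Qed.

(** The two leading terms of the binomial expansion. *)
Lemma bernoulli u n : u ^ n.+1 + n.+1 * u ^ n <= u.+1 ^ n.+1.
Proof.
elim: n => [|n IH]; first by rewrite !expn1 expn0 addn1.
rewrite [leqRHS]expnS; apply: leq_trans (leq_mul (leqnn _) IH).
rewrite (expnS u n.+1) (expnS u n); move: (u ^ n) => p.
have -> : u.+1 * (u * p + n.+1 * p) = u * (u * p) + n.+1 * (u * p) + (u * p + n.+1 * p).
  by rewrite mulSn addnC mulnDr (mulnCA u n.+1).
by rewrite (mulSn n.+1 (u * p)); lia.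
Qed.

(** A high power spreads consecutive integers: [u.+1 ^ e.+1] exceeds [u ^ e.+1] by at least
    [e.+1 * u ^ e], and [e] is chosen to be at least [l * u] for every value [u] of [w]. *)
Lemma rapid_exp (T : finType) (w : T -> nat) (l : nat) :
  exists e, forall x y, w x < w y -> l * w x ^ e.+1 < w y ^ e.+1.
Proof.
pose e := l * \max_x w x; exists e => x y lt.
have le : l * w x <= e by exact: leq_mul (leqnn l) (leq_bigmax x).
have [->|wx] := posnP (w x); first by rewrite exp0n // muln0 expn_gt0; lia.
apply: leq_trans (_ : (w x).+1 ^ e.+1 <= _); last by rewrite leq_exp2r.
apply: leq_trans (bernoulli _ _); rewrite expnS mulnA.
have : 0 < w x ^ e by rewrite expn_gt0 wx.
move: (w x ^ e) => p p0.
apply: leq_trans (leq_addl _ _); rewrite mulSn -add1n; apply: leq_add => //.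
by rewrite leq_mul2r le orbT.
Qed.

(** * Multiplicative weights of the trees of predecessors *)

Definition cyclic (Y : fdds) (y : Y) : Prop := exists k, iter k.+1 next y = y.

(** The pairs store exponents minus one: positive exponents keep zero weights zero. The exponents
    are left free so that large ones can make a weight refine the shorter weight, by the power of
    the own weight of [y], and separate sums over predecessors. *)
Fixpoint wt (Y : fdds) (es : seq (nat * nat)) (y : Y) : nat :=
  if es is (e, e') :: es' then
    wt es' y ^ e'.+1 * \sum_(u : Y | next u == y) wt es' u ^ e.+1
  else 1.

Definition eqv (Y Z : fdds) (y : Y) (z : Z) : Prop := forall es, wt es y = wt es z.

(** The predecessors of a pair are the pairs of predecessors, so the inner sum factors. *)
Lemma wt_mul (A X : fdds) es (a : A) (x : X) :
  wt es ((a, x) : fdds_mul A X) = wt es a * wt es x.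
Proof.
elim: es a x => //= -[e e'] es IH a x; rewrite IH expnMn mulnACA; congr (_ * _).
rewrite big_distrlr pair_big /=; apply: eq_big => [[u v]|[u v] _] /=.
  by rewrite xpair_eqE.
by rewrite IH expnMn.
Qed.

Lemma wt_next (Y : fdds) es (u : Y) : 0 < wt es u -> 0 < wt es (next u).
Proof.
elim: es u => //= -[e e'] es IH u; rewrite !muln_gt0 !expn_gt0 !orbF.
case/andP => wu _; rewrite IH //=.
by apply/sum_gt0P; exists u => //; rewrite expn_gt0 wu.
Qed.

(** Weights look only backwards, so it is enough that the image be closed under predecessors. *)
Lemma wt_emb (Y Z : fdds) (h : Y -> Z) es (y : Y) :
  injective h -> (forall y, h (next y) = next (h y)) ->
  (forall y z, next z = h y -> exists y', z = h y') ->
  wt es (h y) = wt es y.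
Proof.
move=> hi hn hp; elim: es y => //= -[e e'] es IH y; rewrite IH; congr (_ * _).
rewrite (eq_bigl (mem (h @: [set u | next u == y]))) => [|z].
  rewrite big_imset /=; last by move=> u v _ _ /hi.
  by apply: eq_big => u; rewrite ?inE // => _; rewrite IH.
apply/eqP/imsetP => [e0|[u + ->]]; last by rewrite inE -hn => /eqP ->.
by have [u zu] := hp _ _ e0; exists u => //; rewrite inE -(inj_eq hi) hn -zu e0.
Qed.

Lemma cyclic_pred (Y : fdds) (y : Y) : cyclic y ->
  exists2 u : Y, next u = y & cyclic u.
Proof.
case=> k e; exists (iter k next y); first by rewrite -iterS.
by exists k; rewrite -iterD addnC iterD e.
Qed.

Lemma cyclic_next (Y : fdds) (y : Y) : cyclic y -> cyclic (next y).
Proof. by case=> k e; exists k; rewrite -iterSr iterS e. Qed.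

Lemma cyclic_iter (Y : fdds) (y : Y) n : cyclic y -> cyclic (iter n next y).
Proof. by move=> cy; elim: n => //= n; apply: cyclic_next. Qed.

Lemma iter_mul (T : Type) (f : T -> T) k n x : iter k f x = x -> iter (n * k) f x = x.
Proof. by move=> e; elim: n => // n IH; rewrite mulSn iterD IH e. Qed.

(** After a common multiple of both periods each state is back at itself, and that iterate depends
    only on the common successor. *)
Lemma cyclic_inj (Y : fdds) (u v : Y) : cyclic u -> cyclic v -> next u = next v -> u = v.
Proof.
case=> k eu [l ev] e.
have := iter_mul l.+1 eu; have := iter_mul k.+1 ev.
by rewrite mulnC mulSn addSn !iterSr e => -> <-.
Qed.

Lemma iter_cyclic_inj (Y : fdds) k (u v : Y) :
  cyclic u -> cyclic v -> iter k next u = iter k next v -> u = v.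
Proof.
elim: k => // k IH cu cv /cyclic_inj e; apply: IH => //.
by apply: e; apply: cyclic_iter.
Qed.

Lemma wt_cyclic (Y : fdds) es (y : Y) : cyclic y -> 0 < wt es y.
Proof.
elim: es y => //= -[e e'] es IH y cy; rewrite muln_gt0 expn_gt0 IH //=.
have [u <- cu] := cyclic_pred cy.
by apply/sum_gt0P; exists u => //; rewrite expn_gt0 IH.
Qed.

Lemma wt_iter (Y : fdds) es (y : Y) : 0 < wt es y ->
  exists u : Y, iter (size es) next u = y.
Proof.
elim: es y => [y _|[e e'] es IH y] /=; first by exists y.
rewrite muln_gt0 => /andP[_ /sum_gt0P[u /eqP <-]].
by rewrite expn_gt0 orbF => /IH[v <-]; exists v.
Qed.

Lemma iter_collision (Y : fdds) (u : Y) : exists i j,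
  [/\ i < j, j <= #|Y| & iter i next u = iter j next u].
Proof.
have : ~~ injectiveb (fun i : 'I_#|Y|.+1 => iter i next u).
  by apply/injectiveP => /leq_card; rewrite card_ord ltnn.
case/injectivePn => i [j ij eij].
case: (ltngtP i j) => [lt|lt|/val_inj e]; last by rewrite e eqxx in ij.
  by exists i, j; split; rewrite // -ltnS.
by exists j, i; split; rewrite // -ltnS.
Qed.

Lemma iter_period (Y : fdds) n (u : Y) : #|Y| <= n ->
  exists2 k, k < #|Y| & iter k.+1 next (iter n next u) = iter n next u.
Proof.
move=> le; have [i [j [lt jY eij]]] := iter_collision u.
exists (j - i).-1; first by lia.
have per : iter (j - i) next (iter j next u) = iter j next u.
  by rewrite -[in LHS]eij -iterD subnK // ltnW.
rewrite prednK ?subn_gt0 // -(subnK (leq_trans jY le)) (iterD (n - j)).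
by rewrite -iterD addnC iterD per.
Qed.

Lemma iter_cyclic (Y : fdds) n (u : Y) : #|Y| <= n -> cyclic (iter n next u).
Proof. by move=> /(iter_period u)[k _ e]; exists k. Qed.

(** A positive weight of length [#|Y|] provides an ancestor [#|Y|] steps back, and every state so
    far along an orbit is cyclic. *)
Lemma wt_gt0_cyclic (Y : fdds) (y : Y) : (forall es, 0 < wt es y) -> cyclic y.
Proof.
move=> /(_ (nseq #|Y| (0, 0)))/wt_iter[u <-].
by rewrite size_nseq; apply: iter_cyclic.
Qed.

Lemma eqv_cyclic (Y Z : fdds) (y : Y) (z : Z) : eqv y z -> cyclic y -> cyclic z.
Proof. by move=> e cy; apply: wt_gt0_cyclic => es; rewrite -e wt_cyclic. Qed.

(** * Ranking the states of a system *)

Definition lexlt (w g w' g' : nat) : bool := (w < w') || ((w == w') && (g < g')).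

Definition predsum (Y : fdds) (w : Y -> nat) (y : Y) : nat :=
  \sum_(u : Y | next u == y) w u.

(** The exponent counts the states lexicographically below, so that equal pairs get equal weights; a
    base above [#|Y|] makes the weights rapid. Weight 0 is reserved for states none of whose
    predecessors has a nonzero weight. *)
Definition wstep (Y : fdds) (w : Y -> nat) (y : Y) : nat :=
  if predsum w y == 0 then 0
  else #|Y|.+1 ^ \sum_(z : Y) lexlt (w z) (predsum w z) (w y) (predsum w y).

Definition W (Y : fdds) (n : nat) : Y -> nat := iter n (@wstep Y) (fun=> 1).

Lemma W_S (Y : fdds) n (y : Y) : W n.+1 y = wstep (W n) y.
Proof. by []. Qed.

(** Counting the elements below is strictly monotone for a strict weak order; the last premise is
    negative transitivity. *)
Lemma rank_lt (T : finType) (r : rel T) (x y : T) :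
  irreflexive r -> transitive r -> (forall x y z, r z y -> ~~ r x y -> r z x) ->
  (\sum_z (r z x : nat) < \sum_z (r z y : nat)) = r x y.
Proof.
move=> irr tr neg; case rxy: (r x y).
  rewrite (bigD1 x) //= [ltnRHS](bigD1 x) //= irr rxy add0n add1n ltnS.
  by apply: leq_sum => z _; case rzx: (r z x) => //; rewrite (tr _ _ _ rzx rxy).
apply/negbTE; rewrite -leqNgt; apply: leq_sum => z _.
by case rzy: (r z y) => //; rewrite (neg x y z rzy) ?rxy.
Qed.

Lemma wstep_lt (Y : fdds) (w : Y -> nat) (y z : Y) :
  (wstep w y < wstep w z) =
  (predsum w z != 0) && ((predsum w y == 0) ||
    lexlt (w y) (predsum w y) (w z) (predsum w z)).
Proof.
rewrite /wstep; have [//|_] := eqVneq (predsum w z) 0.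
have [|_] /= := eqVneq (predsum w y) 0; first by rewrite expn_gt0.
have [Y0|Y1] := posnP #|Y|.
  by have := card0_eq Y0 y; rewrite inE.
rewrite ltn_exp2l //.
rewrite (@rank_lt _ [rel a b | lexlt (w a) (predsum w a) (w b) (predsum w b)]) //=.
- by move=> x; rewrite /= /lexlt; lia.
- by move=> a b c; rewrite /= /lexlt; lia.
- by move=> a b c; rewrite /= /lexlt; lia.
Qed.

Lemma wstep_rapid (Y : fdds) (w : Y -> nat) : rapid (wstep w).
Proof.
move=> y z; rewrite /wstep; case: ifP => _; case: ifP => _; rewrite ?muln0 //.
have [Y0|Y1] := posnP #|Y|; first by have := card0_eq Y0 y; rewrite inE.
rewrite ltn_exp2l // => lt; apply: leq_trans (_ : #|Y|.+1 ^ _.+1 <= _); last first.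
  by rewrite leq_exp2l; first exact: lt.
by rewrite expnS ltn_pmul2r ?expn_gt0.
Qed.

Lemma W_rapid (Y : fdds) n : rapid (@W Y n).
Proof. by case: n => [|n]; [move=> y z|apply: wstep_rapid]. Qed.

(** The bridge between ranks and weights: facts about the order of ranks become facts about numbers
    that multiply along products. *)
Lemma W_wt (Y : fdds) n : exists es, forall y z : Y,
  (W n y < W n z) = (wt es y < wt es z) /\ (W n y == 0) = (wt es y == 0).
Proof.
elim: n => [|n [es IH]]; first by exists [::].
have IHlt (y z : Y) : (W n y < W n z) = (wt es y < wt es z) by case: (IH y z).
have IH0 (y : Y) : (W n y == 0) = (wt es y == 0) by case: (IH y y).
have IHeq (y z : Y) : (W n y == W n z) = (wt es y == wt es z).
  have := IHlt y z; have := IHlt z y.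
  by case: (ltngtP (W n y)); case: (ltngtP (wt es y)).
(* [e] makes the powers rapid for [#|Y|] summands, so that sums over predecessors compare as those
   of [W n] do. *)
have [e re] := rapid_exp (fun y : Y => wt es y) #|Y|.
pose h (y : Y) := \sum_(u : Y | next u == y) wt es u ^ e.+1.
(* [e'] lets any difference in the own weight outweigh the sum over predecessors, so that the
   product is ordered lexicographically, as in [wstep]. *)
have [e' re'] := rapid_exp (fun y : Y => wt es y) (\max_y h y).
have lte (y z : Y) : (wt es y ^ e.+1 < wt es z ^ e.+1) = (wt es y < wt es z).
  by rewrite ltn_exp2r.
have Gle (y z : Y) : (predsum (W n) y <= predsum (W n) z) = (h y <= h z).
  rewrite /predsum /h; pose S (y : Y) := [set u | next u == y].
  have E (w : Y -> nat) x : \sum_(u : Y | next u == x) w u = \sum_(u in S x) w u.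
    by apply: eq_bigl => u; rewrite inE.
  have rwe : rapid (fun y : Y => wt es y ^ e.+1) by move=> a b; rewrite lte; apply: re.
  rewrite !E; apply/idP/idP; apply: rapid_sum_le => //.
  + exact: W_rapid.
  + by move=> a b; rewrite lte IHlt.
  + by move=> a; rewrite expn_eq0 andbT IH0.
  + exact: W_rapid.
  + by move=> a b; rewrite lte IHlt.
  + by move=> a; rewrite expn_eq0 andbT IH0.
have G0 (y : Y) : (predsum (W n) y == 0) = (h y == 0).
  rewrite /predsum /h !sum_nat_eq0; apply: eq_forallb => u.
  by rewrite expn_eq0 andbT IH0.
have Glt (y z : Y) : (predsum (W n) y < predsum (W n) z) = (h y < h z).
  by rewrite !ltnNge Gle.
have hw (y : Y) : h y != 0 -> 0 < wt es y.
  rewrite -lt0n => /sum_gt0P[u /eqP <-]; rewrite expn_gt0 orbF; exact: wt_next.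
exists ((e, e') :: es) => y z; split; last first.
  rewrite W_S /wstep /= -/(h y) muln_eq0 expn_eq0 andbT -G0.
  case: ifP => [_|]; first by rewrite orbT.
  by move/negbT; rewrite G0 => /hw; rewrite lt0n expn_eq0 => /negPf->.
rewrite W_S wstep_lt /= -/(h y) -/(h z) !G0 /lexlt IHlt IHeq Glt.
have [->|hz] := eqVneq (h z) 0; first by rewrite muln0.
have wz := hw z hz.
have [->|hy] /= := eqVneq (h y) 0; first by rewrite muln0 muln_gt0 expn_gt0 wz lt0n hz.
have wy := hw y hy.
have big (a b : Y) : 0 < h b -> wt es a < wt es b ->
    wt es a ^ e'.+1 * h a < wt es b ^ e'.+1 * h b.
  move=> hb lt; apply: leq_trans (_ : wt es b ^ e'.+1 <= _); last by rewrite leq_pmulr.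
  by apply: leq_ltn_trans (re' a b lt); rewrite mulnC; exact: leq_mul (leq_bigmax a) (leqnn _).
case: (ltngtP (wt es y) (wt es z)) => [lt|gt|->] /=.
- by rewrite big // lt0n.
- by apply/esym/negbTE; rewrite -leqNgt ltnW // big // lt0n.
- by rewrite ltn_pmul2l // expn_gt0 wz.
Qed.

Lemma wt_W (Y : fdds) n (y z : Y) : eqv y z -> W n y = W n z.
Proof.
move=> e; have [es h] := W_wt Y n; have := (h z y).1; have := (h y z).1.
by rewrite e ltnn; case: ltngtP.
Qed.

Lemma W_S0 (Y : fdds) n (y : Y) : (W n.+1 y == 0) = (predsum (W n) y == 0).
Proof.
rewrite W_S /wstep; case: ifP => // _.
by rewrite expn_eq0.
Qed.

Lemma W_S_neq0 (Y : fdds) n (y : Y) : W n.+1 y != 0 -> W n y != 0.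
Proof.
rewrite W_S0 -lt0n => /sum_gt0P[u /eqP <-].
have [es h] := W_wt Y n; rewrite !lt0n (h u u).2 (h (next u) u).2 -!lt0n.
exact: wt_next.
Qed.

(** Nonzero values of [wstep] separate lexicographically different pairs, so the old weight can be
    read off. *)
Lemma W_S_inj (Y : fdds) n (y z : Y) : W n.+1 y = W n.+1 z -> W n.+1 y != 0 ->
  W n y = W n z.
Proof.
move=> e n0; have n0' : W n.+1 z != 0 by rewrite -e.
have := wstep_lt (W n) y z; have := wstep_lt (W n) z y.
rewrite -!W_S e ltnn -!W_S0 (negPf n0) (negPf n0') /lexlt /=.
by case: ltngtP.
Qed.

Lemma W_S_predsum (Y : fdds) n (y z : Y) : W n.+1 y = W n.+1 z ->
  predsum (W n) y = predsum (W n) z.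
Proof.
move=> e; case n0: (W n.+1 y == 0).
  have n0' : W n.+1 z == 0 by rewrite -e.
  by move: n0 n0'; rewrite !W_S0 => /eqP -> /eqP.
have e' := W_S_inj e (negbT n0); have n0' : (W n.+1 z == 0) = false by rewrite -e.
have := wstep_lt (W n) y z; have := wstep_lt (W n) z y.
rewrite -!W_S e ltnn -!W_S0 n0 n0' /lexlt /= e' eqxx ltnn /=.
by case: ltngtP.
Qed.

Lemma W_inj_le (Y : fdds) n d (y z : Y) : d <= n -> W n y = W n z -> W n y != 0 ->
  W d y = W d z.
Proof.
move=> /subnK <-; elim: (n - d) => // k IH; rewrite addSn => e n0.
by apply: IH; [apply: W_S_inj e n0|apply: W_S_neq0].
Qed.

(* Orders the states by depth (capped by the number of levels), and the states
   of equal depth by their last nonzero weight. *)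
Definition Wmax (Y : fdds) : nat := #|Y|.+1 ^ #|Y|.+1.

Fixpoint cls_upto (Y : fdds) (n : nat) (y : Y) : nat :=
  if n is n'.+1 then
    if W n' y == 0 then cls_upto n' y else n' * Wmax Y + W n' y
  else 0.

Lemma cls_uptoS (Y : fdds) n (y : Y) :
  cls_upto n.+1 y = if W n y == 0 then cls_upto n y else n * Wmax Y + W n y.
Proof. by []. Qed.

(** Levels up to [#|Y|] suffice because the partition is stable by then, see [cls_upto_stable]. *)
Definition cls (Y : fdds) : Y -> nat := cls_upto #|Y|.+1.

Lemma W_max (Y : fdds) n (y : Y) : W n y < Wmax Y.
Proof.
have [Y0|Y1] := posnP #|Y|; first by have := card0_eq Y0 y; rewrite inE.
case: n => [|n].
  by rewrite /Wmax [ltnLHS](_ : _ = #|Y|.+1 ^ 0) // ltn_exp2l.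
rewrite W_S /wstep /Wmax; case: ifP => _; first by rewrite expn_gt0.
rewrite ltn_exp2l // ltnS -sum1_card leq_sum // => z _.
by case: lexlt.
Qed.

(** [d] is the last nonzero level; it exists because level 0 is constantly 1. *)
Lemma cls_uptoE (Y : fdds) n (y : Y) : exists d, [/\ d <= n, W d y != 0,
  forall k, d < k -> k <= n -> W k y = 0 & cls_upto n.+1 y = d * Wmax Y + W d y].
Proof.
elim: n => [|n [d [dn d0 dk dE]]]; first by exists 0; split=> // -[].
rewrite cls_uptoS; have [e|ne] := eqVneq (W n.+1 y) 0.
  exists d; split=> //; first exact: leqW.
  by move=> k dk'; rewrite leq_eqVlt => /predU1P[->|]; [|apply: dk].
by exists n.+1; split=> // k; lia.
Qed.

(** [d] is the last nonzero level of [z]. A state of smaller class has weight 0 there already, or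
    has the same last level and a smaller weight on it. *)
Lemma cls_upto_lt (Y : fdds) n (z : Y) : exists2 d, d <= n &
  forall y : Y, cls_upto n.+1 y < cls_upto n.+1 z -> W d y < W d z.
Proof.
have [d [dn d0 dk ->]] := cls_uptoE n z; exists d => // y.
have [d' [dn' d0' dk' ->]] := cls_uptoE n y.
case: (ltngtP d d') => [lt|gt|-> //]; last by rewrite ltn_add2l.
  by have := W_max d z; move: lt (Wmax Y); nia.
by move=> _; rewrite (dk' d) // lt0n.
Qed.

(** The last nonzero weight determines the earlier ones and the later ones vanish; [Wmax] keeps the
    ranges of different levels apart. *)
Lemma cls_upto_eq (Y : fdds) n (y z : Y) :
  cls_upto n.+1 y = cls_upto n.+1 z <-> forall k, k <= n -> W k y = W k z.
Proof.
split=> [|h]; last first.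
  elim: n h => [|n IH] h; first by [].
  have e : cls_upto n.+1 y = cls_upto n.+1 z by apply: IH => k kn; apply: h; apply: leqW.
  by rewrite cls_uptoS [RHS]cls_uptoS (h n.+1) // e.
have [d [dn d0 dk ->]] := cls_uptoE n z.
have [d' [dn' d0' dk' ->]] := cls_uptoE n y.
have := W_max d z; have := W_max d' y => m' m e.
have dd : d = d' by move: m m' e; move: (W d z) (W d' y) (Wmax Y) => a b c; nia.
subst d'; move: e => /addnI e k kn; case: (leqP k d) => kd; last by rewrite dk ?dk'.
exact: W_inj_le kd e d0'.
Qed.

Lemma cls_upto_W (Y : fdds) n k (y z : Y) : k <= n ->
  cls_upto n.+1 y = cls_upto n.+1 z -> W k y = W k z.
Proof. by move=> kn /cls_upto_eq; apply. Qed.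

Lemma predsum_fun (Y : fdds) n (f : Y -> nat) (y z : Y) :
  (forall u v : Y, W n u = W n v -> f u = f v) -> (forall u : Y, W n u = 0 -> f u = 0) ->
  W n.+1 y = W n.+1 z -> predsum f y = predsum f z.
Proof.
move=> ff f0 /W_S_predsum e.
have E (w : Y -> nat) x : predsum w x = \sum_(u in [set u | next u == x]) w u.
  by apply: eq_bigl => u; rewrite inE.
by move: e; rewrite !E; apply: rapid_sum_fun => //; apply: W_rapid.
Qed.

(** If [c] has a nonzero weight at the last level, this weight alone defines its class and
    [predsum_fun] applies. Otherwise the class is a coarser one, counted by induction, minus its
    states of nonzero weight. *)
Lemma predsum_cls_upto (Y : fdds) n (y z : Y) : cls_upto n.+2 y = cls_upto n.+2 z ->
  forall c : Y, predsum (fun u => cls_upto n.+1 u == cls_upto n.+1 c : nat) y =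
    predsum (fun u => cls_upto n.+1 u == cls_upto n.+1 c : nat) z.
Proof.
move/cls_upto_eq; elim: n => [|n IH] e c.
  by apply: (@predsum_fun _ 0) => //; apply: e.
have [c0|c1] := eqVneq (W n.+1 c) 0; last first.
  have E (u : Y) : (cls_upto n.+2 u == cls_upto n.+2 c) = (W n.+1 u == W n.+1 c).
    apply/eqP/eqP => [e1|eu]; first exact: cls_upto_W (leqnn _) e1.
    apply/cls_upto_eq => k kn.
    by apply: (W_inj_le kn eu); rewrite eu.
  apply: (@predsum_fun _ n.+1) => [u v euv|u u0|]; last exact: e.
    by rewrite !E euv.
  by rewrite E u0 eq_sym (negPf c1).
pose g (u : Y) : nat := cls_upto n.+1 u == cls_upto n.+1 c.
pose f (u : Y) : nat := (cls_upto n.+1 u == cls_upto n.+1 c) && (W n.+1 u != 0).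
have E (u : Y) : g u = (cls_upto n.+2 u == cls_upto n.+2 c : nat) + f u.
  rewrite /g /f (cls_uptoS n.+1 u) (cls_uptoS n.+1 c) c0 eqxx.
  have [u0|u1] := eqVneq (W n.+1 u) 0; first by rewrite andbF addn0.
  rewrite andbT; suff -> : (n.+1 * Wmax Y + W n.+1 u == cls_upto n.+1 c) = false by [].
  have [d [dn _ _ ->]] := cls_uptoE n c; apply/negbTE; have := W_max d c.
  by move: (W d c) (Wmax Y) => a b; nia.
have eg : predsum g y = predsum g z by apply: IH => k kn; apply: e; apply: leqW.
have ef : predsum f y = predsum f z.
  apply: (@predsum_fun _ n.+1) => [u v euv|u u0|]; [|by rewrite /f u0 eqxx andbF|exact: e].
  rewrite /f euv; have [//|v0] := eqVneq (W n.+1 v) 0; rewrite ?andbF ?andbT //.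
  suff -> : cls_upto n.+1 u = cls_upto n.+1 v by [].
  by apply/cls_upto_eq => k kn; apply: (W_inj_le (leqW kn) euv); rewrite euv.
have S x : predsum g x =
    predsum (fun u => cls_upto n.+2 u == cls_upto n.+2 c : nat) x + predsum f x.
  by rewrite /predsum -big_split; apply: eq_bigr => u _; rewrite E.
by move: eg; rewrite !S ef => /addIn.
Qed.

(* The sets of first representatives of the classes grow strictly until the
   partition is stable. *)
Lemma cls_upto_stable (Y : fdds) : exists2 n, n <= #|Y| &
  forall u v : Y, cls_upto n.+1 u = cls_upto n.+1 v -> cls_upto n.+2 u = cls_upto n.+2 v.
Proof.
pose R n (u v : Y) := cls_upto n.+1 u == cls_upto n.+1 v.
have Rsub n u v : R n.+1 u v -> R n u v.
  by move=> /eqP/cls_upto_eq e; apply/eqP/cls_upto_eq => k kn; apply/e/leqW.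
pose D n := [set u | [forall v, R n u v ==> (enum_rank u <= enum_rank v)]].
have Dsub n : D n \subset D n.+1.
  apply/subsetP => u; rewrite !inE => /forallP Du; apply/forallP => v; apply/implyP => /Rsub.
  by move: (Du v) => /implyP.
have Dlt n : ~~ [forall u, forall v, R n u v ==> R n.+1 u v] -> D n \proper D n.+1.
  case/forallPn => u /forallPn[v]; rewrite negb_imply => /andP[ruv nruv].
  rewrite properEneq Dsub andbT; apply: contraNN nruv => /eqP DD.
  have rep x : exists2 w, R n.+1 x w & w \in D n.+1.
    have rxx : R n.+1 x x by apply: eqxx.
    case: (arg_minnP (fun w => enum_rank w : nat) rxx) => w rxw wmin; exists w => //.
    rewrite inE; apply/forallP => z; apply/implyP => /eqP rwz; apply: wmin.
    by rewrite /R -rwz.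
  have [u' /eqP ru Du] := rep u; have [v' /eqP rv Dv] := rep v.
  have ruv' : R n u' v'.
    have /Rsub/eqP e1 : R n.+1 u u' by apply/eqP.
    have /Rsub/eqP e2 : R n.+1 v v' by apply/eqP.
    by rewrite /R -e1 -e2.
  move: Du Dv; rewrite -DD !inE => /forallP/(_ v') + /forallP/(_ u').
  rewrite ruv' [R n v' u']eq_sym [_ == _]ruv' /= => le1 le2.
  have e : u' = v' by apply/enum_rank_inj/val_inj/eqP; rewrite eqn_leq le1.
  by rewrite /R ru rv e.
have [y0 _|Y0] := pickP (predT : pred Y).
  have [n nY st] : exists2 n, n <= #|Y| & [forall u, forall v, R n u v ==> R n.+1 u v].
    case: (boolP [exists n : 'I_#|Y|.+1, [forall u, forall v, R n u v ==> R n.+1 u v]]).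
      by case/existsP => n st; exists n; rewrite // -ltnS.
    move=> /existsPn all.
    have le n : n <= #|Y|.+1 -> n <= #|D n|.
      elim: n => // n IH lt; apply: leq_ltn_trans (IH (ltnW lt)) (proper_card _).
      exact/Dlt/(all (Ordinal lt)).
    by have := leq_trans (le _ (leqnn _)) (max_card (mem (D #|Y|.+1))); rewrite ltnn.
  by exists n => // u v /eqP ruv; apply/eqP; move: st => /forallP/(_ u)/forallP/(_ v)/implyP; apply.
by exists 0 => // u; have := Y0 u.
Qed.

(** In a stable partition, states of one class have equally many predecessors in each class, hence
    equal sums over predecessors and equal weights at the next level, and this repeats at all later
    levels. *)
Lemma cls_stable (Y : fdds) (u v : Y) : cls u = cls v -> forall n, W n u = W n v.
Proof.
have [n0 n0Y st] := cls_upto_stable Y.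
have stn n : n0 <= n -> forall u v : Y, cls_upto n.+1 u = cls_upto n.+1 v ->
    cls_upto n.+2 u = cls_upto n.+2 v.
  move=> /subnK <-; elim: (n - n0) => // k; rewrite addSn; move: (k + n0) => m IH {}u {}v e.
  apply/cls_upto_eq => i; rewrite leq_eqVlt => /predU1P[->|]; last by move: i; apply/cls_upto_eq.
  have P := predsum_cls_upto e.
  have S : predsum (W m.+1) u = predsum (W m.+1) v.
    apply: (sum_key (k := cls_upto m.+1) (k' := cls_upto m.+1)) => [c|a b _ _ ab].
      case: (pickP (fun w : Y => cls_upto m.+1 w == c)) => [w /eqP <-|no]; first exact: P.
      by rewrite !big1 // => w _; rewrite no.
    by apply: cls_upto_W (IH _ _ ab).
  have Wm : W m.+1 u = W m.+1 v by apply: cls_upto_W e.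
  by rewrite W_S /wstep S Wm.
move=> e n; have [le|lt] := leqP n #|Y|.
  exact: cls_upto_W le e.
have : cls_upto (n - #|Y| + #|Y|).+1 u = cls_upto (n - #|Y| + #|Y|).+1 v.
  elim: (n - #|Y|) => // k; rewrite addSn; apply: stn.
  by apply: leq_trans n0Y (leq_addl _ _).
by rewrite subnK 1?ltnW //; apply: cls_upto_W.
Qed.

Lemma predsum_cls (Y : fdds) (u v : Y) c : cls u = cls v ->
  predsum (fun w => cls w == c : nat) u = predsum (fun w => cls w == c : nat) v.
Proof.
move=> e; case: (pickP (fun w : Y => cls w == c)) => [w /eqP <-|no]; last first.
  by rewrite /predsum !big1 // => w _; rewrite no.
by apply: predsum_cls_upto; apply/cls_upto_eq => k _; apply: cls_stable.
Qed.

(** Finitely many ranks decide equality of all weights: classes count predecessors by class, and by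
    induction the class of a predecessor fixes its shorter weights. *)
Lemma cls_eqv (Y : fdds) (u v : Y) : cls u = cls v <-> eqv u v.
Proof.
split=> [|e]; last by apply/cls_upto_eq => k _; apply: wt_W.
move=> e es; elim: es u v e => //= -[e e'] es IH u v euv; rewrite (IH u v) //; congr (_ * _).
apply: (sum_key (k := @cls Y) (k' := @cls Y)) => [c|a b _ _ /IH -> //].
exact: predsum_cls.
Qed.

(** One weight separates [z] from all smaller classes at once. The greedy choice relies on it, since
    it multiplies states by others and only weights are compatible with products. *)
Lemma cls_lt (Y : fdds) (z : Y) : exists es, forall y : Y,
  cls y < cls z -> wt es y < wt es z.
Proof.
have [d _ h] := cls_upto_lt #|Y| z; have [es e] := W_wt Y d.
by exists es => y /h; rewrite (e y z).1.
Qed.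

(** * Comparing the states of two systems *)

(** Classes are numbers relative to one system; states of two systems become comparable once both
    are ranked inside the disjoint sum, where each keeps its weights. *)
Definition fdds_add (Y Z : fdds) : fdds :=
  @FDDS (Y + Z)%type (fun s : Y + Z =>
    match s with inl y => inl (next y) | inr z => inr (next z) end).

Lemma wt_inl (Y Z : fdds) es (y : Y) : wt es (inl y : fdds_add Y Z) = wt es y.
Proof.
apply: (@wt_emb Y (fdds_add Y Z) inl) => // [u v [] //|u [v|v] // [e]].
by exists v.
Qed.

Lemma wt_inr (Y Z : fdds) es (z : Z) : wt es (inr z : fdds_add Y Z) = wt es z.
Proof.
apply: (@wt_emb Z (fdds_add Y Z) inr) => // [u v [] //|u [v|v] // [e]].
by exists v.
Qed.

Definition clsl (Y Z : fdds) (y : Y) : nat := cls (inl y : fdds_add Y Z).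
Definition clsr (Y Z : fdds) (z : Z) : nat := cls (inr z : fdds_add Y Z).

Lemma clslr (Y Z : fdds) (y : Y) (z : Z) : clsl Z y = clsr Y z <-> eqv y z.
Proof.
by rewrite /clsl /clsr cls_eqv; split=> e es; have := e es; rewrite wt_inl wt_inr.
Qed.

Lemma clsl_eqv (Y Z : fdds) (y y' : Y) : clsl Z y = clsl Z y' <-> eqv y y'.
Proof. by rewrite /clsl cls_eqv; split=> e es; have := e es; rewrite !wt_inl. Qed.

Lemma predsum_inl (Y Z : fdds) (f : fdds_add Y Z -> nat) (y : Y) :
  predsum f (inl y) = predsum (fun u => f (inl u)) y.
Proof.
rewrite /predsum (reindex_omap inl (fun s => if s is inl u then Some u else None)) /=.
  by apply: eq_bigl => u; rewrite eqxx andbT.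
by case.
Qed.

Lemma predsum_inr (Y Z : fdds) (f : fdds_add Y Z -> nat) (z : Z) :
  predsum f (inr z) = predsum (fun u => f (inr u)) z.
Proof.
rewrite /predsum (reindex_omap inr (fun s => if s is inr u then Some u else None)) /=.
  by apply: eq_bigl => u; rewrite eqxx andbT.
by case.
Qed.

Lemma predsum_clslr (Y Z : fdds) (y : Y) (z : Z) c : eqv y z ->
  predsum (fun u => clsl Z u == c : nat) y = predsum (fun w => clsr Y w == c : nat) z.
Proof. by move=> /clslr/(predsum_cls c); rewrite predsum_inl predsum_inr. Qed.

Lemma predsum_eqv (Y Z : fdds) (f : Y -> nat) (g : Z -> nat) (y : Y) (z : Z) :
  eqv y z -> (forall u w, eqv u w -> f u = g w) -> predsum f y = predsum g z.
Proof.
move=> e fg; apply: (sum_key (k := @clsl Y Z) (k' := @clsr Y Z)) => [c|u w _ _ /clslr/fg //].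
exact: predsum_clslr.
Qed.

Lemma eqv_sym (Y Z : fdds) (y : Y) (z : Z) : eqv y z -> eqv z y.
Proof. by move=> e es. Qed.

Lemma eqv_trans (X Y Z : fdds) (x : X) (y : Y) (z : Z) : eqv x y -> eqv y z -> eqv x z.
Proof. by move=> e1 e2 es; rewrite e1. Qed.

Lemma eqv_mul (A B X Y : fdds) (a : A) (b : B) (x : X) (y : Y) : eqv a b -> eqv x y ->
  eqv ((a, x) : fdds_mul A X) ((b, y) : fdds_mul B Y).
Proof. by move=> e1 e2 es; rewrite !wt_mul e1 e2. Qed.

Lemma eqv_mulI (A X Y : fdds) (a : A) (x : X) (y : Y) : cyclic a ->
  eqv ((a, x) : fdds_mul A X) ((a, y) : fdds_mul A Y) -> eqv x y.
Proof.
move=> ca e es; have := e es; rewrite !wt_mul => /eqP.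
by rewrite eqn_pmul2l ?wt_cyclic // => /eqP.
Qed.

(** [y] is counted among the predecessors of [next y] in its class, so [z] has a predecessor in that
    class too. *)
Lemma cyclic_pred_eqv (Y Z : fdds) (y : Y) (z : Z) : cyclic y -> eqv (next y) z ->
  exists2 w : Z, next w = z & eqv y w.
Proof.
move=> cy e; have := predsum_clslr (clsl Z y) e.
rewrite {1}/predsum (bigD1 y) //= eqxx add1n => h.
have /sum_gt0P[w /eqP nw] : 0 < predsum (fun w => clsr Y w == clsl Z y : nat) z by rewrite -h.
by rewrite lt0b => /eqP/esym/clslr; exists w.
Qed.

(** * Isomorphism by counting fixed points of iterates *)

(** A partial isomorphism between subsets closed under [next] that pairs equivalent states; the
    first clause is functionality and injectivity at once. *)
Definition pmatch (Y Z : fdds) (g : {set Y * Z}) : Prop :=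
  [/\ forall p q, p \in g -> q \in g -> (p.1 == q.1) = (p.2 == q.2),
      forall p, p \in g -> (next p.1, next p.2) \in g
    & forall p, p \in g -> eqv p.1 p.2].

Definition tr (Y Z : finType) (g : {set Y * Z}) : {set Z * Y} :=
  [set (p.2, p.1) | p in g].

Lemma in_tr (Y Z : finType) (g : {set Y * Z}) z y : ((z, y) \in tr g) = ((y, z) \in g).
Proof.
by apply/imsetP/idP => [[[a b] ab /= [-> ->]]|yz] //; exists (y, z).
Qed.

Lemma pmatch_tr (Y Z : fdds) (g : {set Y * Z}) : pmatch g -> pmatch (Y := Z) (Z := Y) (tr g).
Proof.
case=> i c e; split=> [[z y] [z' y']|[z y]|[z y]] /=; rewrite !in_tr.
- by move=> p q; have /= -> := i _ _ p q.
- exact: c.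
- by move=> /e/eqv_sym.
Qed.

Lemma card_tr (Y Z : finType) (g : {set Y * Z}) : #|tr g| = #|g|.
Proof. by rewrite card_imset // => -[a b] [a' b'] [-> ->]. Qed.

Definition dom (Y Z : finType) (g : {set Y * Z}) : {set Y} := [set p.1 | p in g].

Lemma domP (Y Z : finType) (g : {set Y * Z}) y :
  reflect (exists z, (y, z) \in g) (y \in dom g).
Proof.
apply: (iffP imsetP) => [[[a b] ab /= ->]|[z yz]]; first by exists b.
by exists (y, z).
Qed.

(** The matching restricts to a bijection between the covered parts of [U] and [V], so an uncovered
    state of [U] leaves one in [V]. *)
Lemma pmatch_card (Y Z : fdds) (g : {set Y * Z}) (U : {set Y}) (V : {set Z}) y :
  pmatch g -> (forall p, p \in g -> (p.1 \in U) = (p.2 \in V)) -> #|U| = #|V| ->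
  y \in U -> y \notin dom g -> exists2 z, z \in V & z \notin dom (tr g).
Proof.
move=> [gi _ _] UV cUV yU yg.
have [z /andP[zV zg]|no] := pickP (fun z => (z \in V) && (z \notin dom (tr g))).
  by exists z.
pose g0 := [set p in g | p.1 \in U].
have c1 : #|g0| = #|[set p.1 | p in g0]|.
  rewrite card_in_imset // => -[a b] [a' b']; rewrite !inE => /andP[p _] /andP[q _] /= e.
  by have /= := gi _ _ p q; rewrite e eqxx => /esym/eqP ->.
have c2 : #|g0| = #|[set p.2 | p in g0]|.
  rewrite card_in_imset // => -[a b] [a' b']; rewrite !inE => /andP[p _] /andP[q _] /= e.
  by have /= := gi _ _ p q; rewrite e eqxx => /eqP ->.
have lt : #|g0| < #|U|.
  rewrite c1; apply/proper_card/properP; split.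
    by apply/subsetP => _ /imsetP[p + ->]; rewrite inE => /andP[].
  exists y => //; apply: contra yg => /imsetP[p + ->]; rewrite inE => /andP[pg _].
  by apply/imsetP; exists p.
have le : #|V| <= #|g0|.
  rewrite c2; apply/subset_leq_card/subsetP => z zV.
  have /domP[y'] : z \in dom (tr g) by have := no z; rewrite zV => /negbFE.
  rewrite in_tr => p; apply/imsetP; exists (y', z) => //.
  by rewrite inE p (UV _ p).
by have := leq_trans lt (leq_trans (eq_leq cUV) le); rewrite ltnn.
Qed.

(** [next y] and its partner have equally many predecessors in the class of [y], so one predecessor
    of the partner is still free for [y]. *)
Lemma pmatch_ext_pred (Y Z : fdds) (g : {set Y * Z}) (y : Y) :
  pmatch g -> y \notin dom g -> next y \in dom g ->
  exists2 g' : {set Y * Z}, pmatch g' & g \proper g'.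
Proof.
move=> pg yg /domP[z0 yz0]; have [gi gc ge] := pg.
pose U := [set u | (next u == next y) && (clsl Z u == clsl Z y)].
pose V := [set w | (next w == z0) && (clsr Y w == clsl Z y)].
have [||||z] := @pmatch_card Y Z g U V y pg.
- move=> p pin; rewrite !inE; have /clslr -> := ge _ pin; congr (_ && _).
  exact: gi (gc _ pin) yz0.
- have := predsum_clslr (clsl Z y) (ge _ yz0); rewrite /predsum -!sum1_card /=.
  rewrite -!big_mkcondr /= => e.
  rewrite (eq_bigl (fun u => (next u == next y) && (clsl Z u == clsl Z y))) => [|u]; last by rewrite inE.
  rewrite [RHS](eq_bigl (fun w => (next w == z0) && (clsr Y w == clsl Z y))) => [|u]; last by rewrite inE.
  by [].
- by rewrite inE !eqxx.
- by [].
rewrite inE => /andP[/eqP nz /eqP/esym/clslr yz] zg.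
have yf z' : (y, z') \notin g by apply: contra yg => ?; apply/domP; exists z'.
have zf y' : (y', z) \notin g by apply: contra zg => ?; apply/domP; exists y'; rewrite in_tr.
exists ((y, z) |: g); last by rewrite properUr // sub1set yf.
split=> [p q|p|p]; rewrite !inE.
- move=> /predU1P[->|pin] /predU1P[->|qin] /=; rewrite ?eqxx //.
  + apply/eqP/eqP => e; first by have := yf q.2; rewrite e -surjective_pairing qin.
    by have := zf q.1; rewrite e -surjective_pairing qin.
  + apply/eqP/eqP => e; first by have := yf p.2; rewrite -e -surjective_pairing pin.
    by have := zf p.1; rewrite -e -surjective_pairing pin.
  + exact: gi.
- by move=> /predU1P[->|/gc ->]; rewrite ?orbT //= nz yz0 orbT.
- by move=> /predU1P[->|/ge].
Qed.

(** [next y] lies [l] steps before [y] on its cycle. Lifting these steps back from [z] gives a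
    cyclic state equivalent to [next y], and [next z] is the only cyclic state [l] steps before
    [z]. *)
Lemma eqv_next (Y Z : fdds) l (y : Y) (z : Z) :
  iter l.+1 next y = y -> iter l.+1 next z = z -> eqv y z -> eqv (next y) (next z).
Proof.
move=> fy fz e; have cy : cyclic (next y) by apply: cyclic_next; exists l.
have lift k (u : Y) (w : Z) : cyclic u -> eqv (iter k next u) w ->
    exists2 v, iter k next v = w & eqv u v.
  move=> cu; elim: k w => [|k IH] w /= ew; first by exists w.
  have [v <- /IH[v' <- ev']] := cyclic_pred_eqv (cyclic_iter k cu) ew.
  by exists v'.
have [w ew eyw] := lift l (next y) z cy ltac:(by rewrite -iterSr fy).
suff -> : next z = w by [].
apply: (iter_cyclic_inj (k := l)); first by apply: cyclic_next; exists l.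
  exact: eqv_cyclic eyw cy.
by rewrite ew -iterSr fz.
Qed.

(** Counting the fixed points of the [l]-th iterate in the class of [y] yields an uncovered partner
    [z]. By minimality of [l] both orbits have exactly [l] states, so they can be paired in step,
    and [eqv_next] carries the equivalence along. *)
Lemma pmatch_ext_cycle (Y Z : fdds) (g : {set Y * Z}) l (y : Y) :
  (forall (f : Y -> nat) (f' : Z -> nat), (forall u w, eqv u w -> f u = f' w) ->
    \sum_(u | iter l next u == u) f u = \sum_(w | iter l next w == w) f' w) ->
  pmatch g -> 0 < l -> iter l next y = y -> y \notin dom g ->
  (forall k (u : Y), 0 < k -> k < l -> u \notin dom g -> iter k next u != u) ->
  (forall k (w : Z), 0 < k -> k < l -> w \notin dom (tr g) -> iter k next w != w) ->
  exists2 g' : {set Y * Z}, pmatch g' & g \proper g'.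
Proof.
move=> cnt pg l0 fy yg miny minz; have [gi gc ge] := pg.
have gk k p : p \in g -> (iter k next p.1, iter k next p.2) \in g.
  by move=> pin; elim: k => [|k IH] /=; rewrite -?surjective_pairing //; apply: gc IH.
pose U := [set u : Y | (iter l next u == u) && (clsl Z u == clsl Z y)].
pose V := [set w : Z | (iter l next w == w) && (clsr Y w == clsl Z y)].
have [||||z] := @pmatch_card Y Z g U V y pg.
- move=> p pin; rewrite !inE; have /clslr -> := ge _ pin; congr (_ && _).
  exact: gi (gk l _ pin) pin.
- have := cnt (fun u => clsl Z u == clsl Z y : nat) (fun w => clsr Y w == clsl Z y : nat).
  rewrite -!sum1_card -!big_mkcondr /= => e.
  rewrite (eq_bigl (fun u => (iter l next u == u) && (clsl Z u == clsl Z y))) => [|u]; last by rewrite inE.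
  rewrite [RHS](eq_bigl (fun w => (iter l next w == w) && (clsr Y w == clsl Z y))) => [|u]; last by rewrite inE.
  by apply: e => u w /clslr ->.
- by rewrite inE fy !eqxx.
- by [].
rewrite inE => /andP[/eqP fz /eqP/esym/clslr yz] zg.
have per (T : fdds) (x : T) k : iter l next x = x -> iter k next x = iter (k %% l) next x.
  by move=> fx; rewrite {1}(divn_eq k l) addnC iterD iter_mul.
have fk (T : fdds) (x : T) k : iter l next x = x -> iter l next (iter k next x) = iter k next x.
  by move=> fx; rewrite -iterD addnC iterD fx.
have back (T : fdds) (x : T) k : iter l next x = x -> exists j, iter j next (iter k next x) = x.
  move=> fx; exists (l - k %% l); rewrite (per _ x k fx) -iterD subnK // ltnW // ltn_pmod //.
have yk k : iter k next y \notin dom g.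
  apply: contra yg => /domP[z' h]; have [j e] := back _ y k fy.
  by apply/domP; exists (iter j next z'); have := gk j _ h; rewrite /= e.
have zk k : iter k next z \notin dom (tr g).
  apply: contra zg => /domP[y']; rewrite in_tr => h; have [j e] := back _ z k fz.
  by apply/domP; exists (iter j next y'); rewrite in_tr; have := gk j _ h; rewrite /= e.
have inj (T : fdds) (x : T) (D : {set T}) : iter l next x = x ->
    (forall k, iter k next x \notin D) ->
    (forall k (u : T), 0 < k -> k < l -> u \notin D -> iter k next u != u) ->
    forall i j, i < l -> j < l -> (iter i next x == iter j next x) = (i == j).
  move=> fx xD minx i j; wlog ij : i j / i <= j => [wl|il jl].
    by case: (leqP i j) => [|/ltnW] h il jl; [|rewrite eq_sym [RHS]eq_sym]; apply: wl.
  apply/eqP/eqP => [e|-> //]; move: ij; rewrite leq_eqVlt => /predU1P[//|ij].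
  have /negP[] := minx (j - i) _ ltac:(lia) ltac:(lia) (xD i).
  by rewrite -iterD subnK ?(ltnW ij) // e.
pose c := [set (iter i next y, iter i next z) | i : 'I_l].
have cP k : (iter k next y, iter k next z) \in c.
  apply/imsetP; exists (Ordinal (ltn_pmod k l0)) => //=.
  by rewrite -!per.
exists (c :|: g); last first.
  rewrite properEneq subsetUr andbT; apply: contraNneq yg => ->.
  by apply/domP; exists z; rewrite inE (cP 0).
have cg p q : p \in c -> q \in g -> (p.1 == q.1) = (p.2 == q.2).
  case/imsetP => i _ -> qin /=; rewrite -[LHS]negbK -[RHS]negbK; congr (~~ _).
  transitivity true; last apply/esym.
    by apply: contraNneq (yk i) => ->; apply/domP; exists q.2; rewrite -surjective_pairing.
  apply: contraNneq (zk i) => ->; apply/domP; exists q.1.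
  by rewrite in_tr -surjective_pairing.
split=> [p q|p|p]; rewrite !inE.
- move=> /orP[pc|pin] /orP[qc|qin].
  + case/imsetP: pc => i _ ->; case/imsetP: qc => j _ -> /=.
    by rewrite (inj _ _ (dom g)) // (inj _ _ (dom (tr g))).
  + exact: cg.
  + by rewrite eq_sym [RHS]eq_sym; apply: cg.
  + exact: gi.
- by move=> /orP[/imsetP[i _ ->]|/gc ->]; rewrite ?orbT // (cP i.+1).
- move=> /orP[/imsetP[i _ ->]|/ge //] /=.
  elim: (i : nat) => // k IH; rewrite !iterS; apply: (eqv_next (l := l.-1)) IH.
    by rewrite prednK // fk.
  by rewrite prednK // fk.
Qed.

(** A matching that is not total can be enlarged. When no uncovered state has a covered successor,
    the uncovered states are closed under [next] and contain a cycle; a shortest such cycle on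
    either side gets a partner. *)
Lemma iso_of_counts (Y Z : fdds) :
  (forall l (f : Y -> nat) (f' : Z -> nat), 0 < l -> l <= #|Y| + #|Z| ->
    (forall u w, eqv u w -> f u = f' w) ->
    \sum_(u | iter l next u == u) f u = \sum_(w | iter l next w == w) f' w) ->
  fdds_iso Y Z.
Proof.
move=> cnt.
have ext (g : {set Y * Z}) : pmatch g -> (dom g != setT) || (dom (tr g) != setT) ->
    exists2 g' : {set Y * Z}, pmatch g' & g \proper g'.
  move=> pg nT.
  have trext : (exists2 g' : {set Z * Y}, pmatch g' & tr g \proper g') ->
      exists2 g' : {set Y * Z}, pmatch g' & g \proper g'.
    case=> g' pg' sub; exists (tr g'); first exact: pmatch_tr.
    rewrite properEcard card_tr -(card_tr g) (proper_card sub) andbT.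
    apply/subsetP => -[a b] ab; rewrite in_tr.
    by apply: (subsetP (proper_sub sub)); rewrite in_tr.
  have trtr : tr (tr g) = g by apply/setP => -[a b]; rewrite !in_tr.
  case: (pickP (fun y => (y \notin dom g) && (next y \in dom g))) => [y /andP[y1 y2]|noy].
    exact: pmatch_ext_pred y1 y2.
  case: (pickP (fun z => (z \notin dom (tr g)) && (next z \in dom (tr g)))) => [z /andP[z1 z2]|noz].
    exact/trext/(pmatch_ext_pred (pmatch_tr pg) z1 z2).
  have iterN (T : fdds) (D : {set T}) x n : (forall x, (x \notin D) && (next x \in D) = false) ->
      x \notin D -> iter n next x \notin D.
    by move=> no xD; elim: n => //= n IH; have := no (iter n next x); rewrite IH /= => ->.
  (* Periods of uncovered states on both sides together: the least one is minimal for [Y] and for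
     [Z], as [pmatch_ext_cycle] demands. *)
  pose P l := (0 < l) && ([exists y, (y \notin dom g) && (iter l next y == y)] ||
     [exists z, (z \notin dom (tr g)) && (iter l next z == z)]).
  have [l0 lB Pl0] : exists2 l, l <= #|Y| + #|Z| & P l.
    case/orP: nT; rewrite -subTset => /subsetPn[x _ xD].
      have [k kY e] := iter_period x (leqnn #|Y|); exists k.+1; first by rewrite ltn_addr.
      apply/andP; split=> //; apply/orP; left; apply/existsP.
      by exists (iter #|Y| next x); rewrite e eqxx iterN.
    have [k kY e] := iter_period x (leqnn #|Z|); exists k.+1; first by rewrite ltn_addl.
    apply/andP; split=> //; apply/orP; right; apply/existsP.
    by exists (iter #|Z| next x); rewrite e eqxx iterN.
  have exP : exists l, P l by exists l0.
  case: (ex_minnP exP) => l /andP[lpos Pl] lmin; have lB' := leq_trans (lmin _ Pl0) lB.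
  have min1 k (u : Y) : 0 < k -> k < l -> u \notin dom g -> iter k next u != u.
    move=> k0 kl ug; apply/eqP => e; suff /lmin : P k by rewrite leqNgt kl.
    by rewrite /P k0 /=; apply/orP; left; apply/existsP; exists u; rewrite ug e eqxx.
  have min2 k (u : Z) : 0 < k -> k < l -> u \notin dom (tr g) -> iter k next u != u.
    move=> k0 kl ug; apply/eqP => e; suff /lmin : P k by rewrite leqNgt kl.
    by rewrite /P k0 /=; apply/orP; right; apply/existsP; exists u; rewrite ug e eqxx.
  case/orP: Pl => /existsP[x /andP[xD /eqP fx]].
    by apply: (pmatch_ext_cycle (l := l) (y := x)) => // f f'; apply: cnt.
  apply: trext; apply: (pmatch_ext_cycle (l := l) (y := x)) => //.
  - move=> f f' ff; apply/esym; apply: cnt => // u w /eqv_sym/ff //.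
  - exact: pmatch_tr.
  - by rewrite trtr.
have [g [gi gc ge] /norP[]] : exists2 g : {set Y * Z}, pmatch g &
    ~~ ((dom g != setT) || (dom (tr g) != setT)).
  have [n] := ubnP (#|{: Y * Z}| - #|set0 : {set Y * Z}|).
  have : pmatch (set0 : {set Y * Z}) by split=> [p q|p|p]; rewrite inE.
  move: set0; elim: n => // n IH g pg lt.
  case: (boolP ((dom g != setT) || (dom (tr g) != setT))) => [/(ext g pg)[g' pg' sub]|no].
    apply: (IH g' pg'); have m : #|g'| <= #|{: Y * Z}| by apply: max_card.
    by apply: leq_trans (ltn_sub2l _ (proper_card sub)) lt; apply: leq_trans (proper_card sub) m.
  by exists g.
rewrite !negbK => /eqP dT /eqP rT.
have /fin_all_exists[h hg] : forall y, exists z, (y, z) \in g by move=> y; apply/domP; rewrite dT inE.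
have /fin_all_exists[k kg] : forall z, exists y, (y, z) \in g.
  move=> z; have /domP[y] : z \in dom (tr g) by rewrite rT inE.
  by rewrite in_tr; exists y.
exists h; split=> [|y].
  exists k => x; apply/eqP.
    by have /= -> := gi _ _ (kg (h x)) (hg x).
  by have /= <- := gi _ _ (hg (k x)) (kg x).
by apply/eqP; have /= <- := gi _ _ (hg (next y)) (gc _ (hg y)).
Qed.

(** * Greedy division of the predecessors of a state *)

(** The summand [B] is ranked along so that keys come out of the program that ranks the product of
    [A] with a candidate next to [B], with [B] in place of the candidate. *)
Definition key (A B : fdds) (a : A) (b : B) : nat := clsl B ((a, b) : fdds_mul A B).

Definition fits (A B : fdds) (a : A) (D : {set B}) (b : B) : bool :=
  [forall y : A * B,
    \sum_(a2 | next a2 == next a) \sum_(c | (next c == b) && (c \in D))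
       (key a2 c == key y.1 y.2)
    <= \sum_(c | next c == b) (key a c == key y.1 y.2)].

(** The test for [z] concerns only states with the same successor as [z], so one pass over all of
    [B] makes the choices above every [b]. *)
Definition gstep (A B : fdds) (a : A) (D : {set B}) (z : B) : {set B} :=
  if fits a (z |: D) (next z) then z |: D else D.

Definition greedy (A B : fdds) (a : A) (l : seq B) : {set B} :=
  foldl (gstep a) set0 l.

Lemma keyE (A B : fdds) (a : A) (c d : B) : cyclic a -> (key a c = key a d) <-> eqv c d.
Proof.
move=> ca; rewrite /key clsl_eqv; split=> [/eqv_mulI|e]; first exact.
exact: eqv_mul.
Qed.

Lemma mem_greedy (A B : fdds) (a : A) (l : seq B) u : u \in greedy a l -> u \in l.
Proof.
elim/last_ind: l => [|l v IH]; first by rewrite inE.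
rewrite /greedy foldl_rcons /gstep -/(greedy a l) mem_rcons inE.
case: ifP => _; last by move=> /IH ->; rewrite orbT.
by rewrite in_setU1 => /orP[-> //|/IH ->]; rewrite orbT.
Qed.

Section Greedy.
Variables (A B X : fdds) (phi : A * X -> B).
Hypothesis phiE : forall p, eqv (phi p) (p : fdds_mul A X).
Variables (a : A) (b : B) (x : X) (l : seq B).
Hypotheses (ca : cyclic a) (bx : eqv b ((next a, x) : fdds_mul A X)).
Hypotheses (lu : uniq l) (lall : forall u, u \in l).
Hypothesis lsort : pairwise (fun u v => key a v <= key a u) l.

Let tot c := \sum_(u | next u == b) (key a u == c).
Let goal c := \sum_(x' | next x' == x) (key a (phi (a, x')) == c).

(** A predecessor of [b] behaves like [(a2, x')]; multiplied by [a] it is equivalent to [a2] times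
    [(a, x')], by exchanging the factors [a] and [a2]. *)
Lemma greedy_tot c : tot c =
  \sum_(a2 | next a2 == next a) \sum_(x' | next x' == x) (key a2 (phi (a, x')) == c).
Proof.
transitivity (predsum (fun p : fdds_mul A X => key a (phi p) == c : nat) (next a, x)).
  apply: predsum_eqv bx _ => u p up; congr (nat_of_bool (_ == c)); apply/keyE => //.
  exact: eqv_trans up (eqv_sym (phiE p)).
rewrite pair_big /=; apply: eq_big => [[u v]|[u v] _] /=; first by rewrite xpair_eqE.
congr (nat_of_bool (_ == c)); apply/clsl_eqv => es.
by rewrite !wt_mul !phiE !wt_mul mulnCA.
Qed.

Lemma goal_le_tot c : goal c <= tot c.
Proof. by rewrite greedy_tot (bigD1 a) //= leq_addr. Qed.

(** In each key, states are accepted as they come until the quota [goal] is reached. *)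
Lemma greedy_inv l1 l2 c : l = l1 ++ l2 ->
  \sum_(u | next u == b) ((u \in greedy a l1) && (key a u == c)) =
  minn (\sum_(u | next u == b) ((u \in l1) && (key a u == c))) (goal c).
Proof.
elim/last_ind: l1 l2 c => [|l1 z IH] l2 c ll.
  by rewrite !big1 ?min0n // => u _; rewrite ?inE.
rewrite cat_rcons in ll; have {}IH := IH _ _ ll.
have subD u := @mem_greedy A B a l1 u.
have zl1 : z \notin l1.
  by move: lu; rewrite ll cat_uniq /= => /and3P[_ /norP[]].
have zD : z \notin greedy a l1 by apply: contra zl1; apply: subD.
rewrite /greedy foldl_rcons -/(greedy a l1) /gstep.
set D := greedy a l1 in IH subD zD *.
have [nz|nz] := eqVneq (next z) b; last first.
  transitivity (\sum_(u | next u == b) ((u \in D) && (key a u == c))).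
    apply: eq_bigr => u /eqP nu; case: ifP => // _; rewrite !inE.
    by case: (u =P z) nu nz => [-> ->|//]; rewrite eqxx.
  rewrite IH; congr minn; apply: eq_bigr => u /eqP nu; rewrite mem_rcons inE.
  by case: (u =P z) nu nz => [-> ->|//]; rewrite eqxx.
pose n1 c := \sum_(u | next u == b) ((u \in l1) && (key a u == c)).
have addz (S : pred B) c' : z \notin S ->
    \sum_(u | next u == b) (((u == z) || (u \in S)) && (key a u == c')) =
    (key a z == c') + \sum_(u | next u == b) ((u \in S) && (key a u == c')).
  move=> zS; rewrite (bigD1 z) ?nz //= [in RHS](bigD1 z) ?nz //= eqxx (negPf zS) add0n.
  by congr addn; apply: eq_bigr => u /andP[_ /negPf->].
have n1E : \sum_(u | next u == b) ((u \in rcons l1 z) && (key a u == c)) =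
    (key a z == c) + n1 c.
  by rewrite /n1 -(addz (mem l1)) //; apply: eq_bigr => u _; rewrite mem_rcons inE.
have DE c' : \sum_(u | next u == b) ((u \in z |: D) && (key a u == c')) =
    (key a z == c') + minn (n1 c') (goal c').
  by rewrite /n1 -(IH c') -(addz (mem D)) //; apply: eq_bigr => u _; rewrite !inE.
(* The test must succeed exactly while the key of [z] is below its quota. *)
suff fitsE : fits a (z |: D) (next z) = (n1 (key a z) < goal (key a z)).
  rewrite n1E fitsE; case: ltnP => [lt|ge].
    rewrite DE; case: eqP => [<-|_]; rewrite ?add0n // !add1n.
    by rewrite !(minn_idPl _) // ltnW.
  rewrite IH -/(n1 c); case: eqP => [<-|_]; rewrite ?add0n // add1n.
  by rewrite !(minn_idPr _) // ltnW.
rewrite nz; case: ltnP => [lt|ge].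
  (* Within the quotas the chosen states inject, key by key, into the states [phi (a, x')], so their
     products with each [a2] are no more numerous. *)
  apply/forallP => y; rewrite -/(tot _) greedy_tot; apply: leq_sum => a2 _.
  apply: (sum_key_le (k := key a) (k' := fun x' => key a (phi (a, x')))).
    move=> c'; rewrite -/(goal c'); apply: leq_trans (_ : (key a z == c') + minn (n1 c') (goal c') <= _).
      rewrite -DE big_mkcondr; apply: leq_sum => u _.
      by case: (u \in _).
    by case: eqP => [<-|_]; rewrite ?add0n ?geq_minr // add1n (minn_idPl (ltnW lt)).
  move=> u v _ _ /keyE uv; rewrite (_ : key a2 u = key a2 (phi (a, v))) //.
  by apply/clsl_eqv/eqv_mul => //; apply: uv.
(* With the quota exhausted, the violated class is that of [(ah, z)]: [es] separates [z] from the
   states of smaller key, and [ah] maximises this weight among the predecessors of [next a]. *)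
apply/negbTE; apply/forallPn.
have [es esE] : exists es, forall c, key a c < key a z ->
    wt es ((a, c) : fdds_mul A B) < wt es ((a, z) : fdds_mul A B).
  have [es h] := cls_lt (inl (a, z) : fdds_add (fdds_mul A B) B).
  by exists es => c1 /h; rewrite !wt_inl.
have na : [pred a2 | next a2 == next a] a by rewrite /=.
case: (arg_maxnP (fun a2 => wt es a2) na) => ah /eqP nah ahmax.
exists (ah, z); rewrite -ltnNge -/(tot _) greedy_tot exchange_big /=.
pose g (c : B) := \sum_(a2 | next a2 == next a) (key a2 c == key ah z).
rewrite -/(tot _) [ltnRHS]exchange_big /=.
apply: leq_ltn_trans (_ : \sum_(u | (next u == b) && (u \in D)) g u < _); last first.
  rewrite [ltnRHS](bigD1 z) ?nz ?inE ?eqxx //= -[ltnLHS]add0n -addSn.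
  apply: leq_add.
    by apply/sum_gt0P; exists ah; rewrite ?nah ?eqxx.
  rewrite leq_eqVlt; apply/orP; left; apply/eqP; apply: eq_bigl => u; rewrite !inE.
  by case: (u =P z) => [->|_]; rewrite ?(negPf zD) ?andbF ?andbT.
(* States of smaller key cannot reach the class of [(ah, z)], as their weight times the largest one
   stays below. For the remaining keys the list order guarantees that the quotas are filled already,
   so [z] comes in excess. *)
rewrite (bigID (fun x' => key a z <= key a (phi (a, x')))) /= [X in _ + X]big1 ?addn0; last first.
  move=> x' /andP[_]; rewrite -ltnNge => /esE; rewrite !wt_mul => lt.
  have wa := wt_cyclic es ca; rewrite ltn_pmul2l // in lt.
  apply: big1 => a2 na2; apply/eqP; rewrite eqb0; apply/eqP => /clsl_eqv/(_ es).
  rewrite !wt_mul => e; have le := ahmax _ na2; have le' := ahmax _ na.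
  have := leq_mul le (leqnn (wt es (phi (a, x')))).
  by rewrite e leq_mul2l leqNgt lt orbF -leqn0 leqNgt (leq_trans wa le').
apply: (sum_key_le (k := fun x' => key a (phi (a, x'))) (k' := key a)) => [c'|u v _ _ /keyE uv].
  have [lt|le] := ltnP c' (key a z).
    rewrite big1 // => x' /andP[_ le]; apply/eqP; rewrite eqb0.
    by apply: contraTneq le => ->; rewrite -ltnNge.
  apply: leq_trans (_ : goal c' <= _).
    by rewrite big_mkcondr; apply: leq_sum => x' _; case: ifP.
  apply: leq_trans (_ : minn (n1 c') (goal c') <= _); last first.
    rewrite -IH [leqRHS]big_mkcondr; apply: leq_sum => u _.
    by case: (u \in _).
  rewrite leq_min leqnn andbT; move: le; rewrite leq_eqVlt => /predU1P[<- //|lt].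
  apply: leq_trans (goal_le_tot _) _; apply: leq_sum => u _.
  case: eqP => [e|_]; rewrite ?andbT ?andbF // lt0b.
  have := lall u; rewrite ll mem_cat inE => /or3P[-> //|/eqP uz|ul2].
    by move: lt; rewrite -e uz ltnn.
  move: lsort; rewrite ll pairwise_cat => /and3P[_ _ /= /andP[/allP/(_ _ ul2)]].
  by rewrite e leqNgt lt.
apply: eq_leq; apply: eq_bigr => a2 _; congr (nat_of_bool (_ == _)).
by apply/clsl_eqv/eqv_mul => //; apply: uv.
Qed.

Theorem greedy_spec c :
  \sum_(u | next u == b) ((u \in greedy a l) && (key a u == c)) =
  \sum_(x' | next x' == x) (key a (phi (a, x')) == c).
Proof.
rewrite (@greedy_inv l [::]) ?cats0 //; apply/minn_idPr.
apply: leq_trans (goal_le_tot c) _; apply: eq_leq; apply: eq_bigr => u _.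
by rewrite lall.
Qed.

End Greedy.

(** * Rebuilding the quotient inside [B] *)

Section Depth.
Variables (A B : fdds) (al : nat -> A) (v : nat -> B) (In : A -> {set B}) (p : nat).

(** Labels are depths plus one, and 0 marks states outside the candidate. The state [v p] is refused
    one level above label [p]: it would repeat the root after one turn, and here the cycle is cut
    open. *)
Definition dstep (d : B -> nat) (b : B) : nat :=
  if b == v 0 then 1
  else if [&& 0 < d (next b), b \in In (al (d (next b)))
           & ~~ ((d (next b) == p) && (b == v p))]
  then (d (next b)).+1 else 0.

Definition depth (n : nat) : B -> nat := iter n dstep (fun=> 0).

Lemma depthS n b : depth n.+1 b = dstep (depth n) b. Proof. by []. Qed.

Lemma depth_hit n b h : depth n b = h.+1 ->
  [/\ h < n, iter h next b = v 0 & forall i, i < h -> iter i next b != v 0].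
Proof.
elim: n b h => // n IH b h; rewrite depthS /dstep.
case: eqP => [-> [<-]|/eqP bv]; first by split.
case: ifP => // /and3P[d0 _ _] [dh].
case: h dh d0 => [|h] dh; first by rewrite dh.
have [hn hv hi] := IH _ _ dh; move=> _; split; rewrite ?ltnS ?iterSr //.
by case=> // i; rewrite ltnS iterSr; apply: hi.
Qed.

Lemma depth_any n m b h : depth n b = h.+1 -> h < m -> depth m b = h.+1.
Proof.
elim: h n m b => [|h IH] [|n] [|m] // b; rewrite !depthS /dstep.
  case: eqP => // _; case: ifP => // /and3P[d0 _ _] [d0'].
  by rewrite d0' in d0.
case: eqP => // _; case: ifP => // c [dh] hm.
by rewrite (IH _ m _ dh) // -dh c.
Qed.

(** A positive label counts the steps to the first visit of [v 0], and a first visit happens before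
    the orbit repeats, hence in fewer than [#|B|] steps. *)
Lemma depth_fix n b : #|B| <= n -> depth n b = dstep (depth n) b.
Proof.
move=> Bn; rewrite -depthS; case e: (depth n.+1 b) => [|h]; last first.
  have [hn hv hi] := depth_hit e; move: hn; rewrite ltnS leq_eqVlt => /predU1P[hn|hn].
    have [i [j [ij jB eij]]] := iter_collision b; rewrite hn in hv hi.
    have /negP[] := hi (n - j + i) ltac:(lia).
    by rewrite iterD eij -iterD subnK ?hv // (leq_trans jB).
  exact: depth_any e hn.
case e': (depth n b) => [//|h]; rewrite (depth_any e') // in e.
by have [/leqW] := depth_hit e'.
Qed.

End Depth.

(** With a single cycle of length [p], the fixed points of an iterate are that whole cycle or
    nothing. *)
Lemma sum_fix_root (Z : fdds) (r : Z) p l (F : Z -> nat) :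
  0 < p -> iter p next r = r -> (forall k, 0 < k -> k < p -> iter k next r != r) ->
  (forall z, exists k, iter k next z = r) -> 0 < l ->
  \sum_(z | iter l next z == z) F z =
  if p %| l then \sum_(i < p) F (iter i next r) else 0.
Proof.
move=> p0 rp rmin reach l0.
have mod k : iter k next r = iter (k %% p) next r.
  by rewrite {1}(divn_eq k p) addnC iterD iter_mul.
have fixE k : (iter k next r == r) = (p %| k).
  rewrite mod /dvdn; case: (posnP (k %% p)) => [-> //=|k0]; rewrite ?eqxx //.
  by rewrite (negPf (rmin _ k0 _)) ?ltn_pmod // (gtn_eqF k0).
have back z : iter l next z = z -> exists i, z = iter i next r.
  move=> lz; have [k zk] := reach z; exists (k * l - k).
  by rewrite -zk -iterD subnK ?iter_mul // leq_pmulr.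
have cancel i k : iter k next (iter i next r) = iter i next r -> p %| k.
  move=> e; rewrite -fixE; apply/eqP; apply: (iter_cyclic_inj (k := i)).
  - by apply: cyclic_iter; exists p.-1; rewrite prednK.
  - by exists p.-1; rewrite prednK.
  - by rewrite -iterD addnC iterD.
case: ifP => pl; last first.
  apply: big_pred0 => z; apply/eqP => lz; have [i zi] := back z lz.
  by move: pl; rewrite (cancel i l) // -zi.
rewrite -(big_imset (h := fun i : 'I_p => iter i next r) (A := predT)) /=; last first.
  move=> i j _ _; wlog ij : i j / i <= j.
    by move=> w e; case: (leqP i j) => [|/ltnW] h; [|apply/esym]; apply: w.
  move=> e; apply/val_inj/eqP; rewrite eqn_leq ij /=.
  have := @cancel i (j - i); rewrite -iterD subnK // -e => /(_ erefl).
  case: (posnP (j - i)) => [/eqP //|d0]; rewrite gtnNdvd //.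
  by apply: leq_ltn_trans (ltn_ord j); rewrite leq_subr.
apply: eq_bigl => z; apply/eqP/imsetP => [lz|[i _ ->]].
  have [i zi] := back z lz; exists (Ordinal (ltn_pmod i p0)) => //=.
  by rewrite -mod.
by rewrite -iterD addnC iterD -/(iter l next r); congr iter; apply/eqP; rewrite fixE.
Qed.

Lemma sum_at (T : finType) (P : pred T) (c : T) (F : T -> nat) :
  \sum_(b | P b && (b == c)) F b = P c * F c.
Proof.
case: (boolP (P c)) => [Pc|nPc].
  rewrite mul1n (eq_bigl (pred1 c)) ?big_pred1_eq // => b /=.
  by case: eqP => [->|]; rewrite ?Pc ?andbF.
rewrite mul0n big_pred0 // => b; case: eqP => [->|]; rewrite ?andbF //.
by rewrite (negPf nPc).
Qed.

(** * The candidate obtained from a right guess *)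

Section Candidate.
Variables (A B X : fdds) (phi : A * X -> B).
Hypothesis phi_bij : bijective phi.
Hypothesis phi_next : forall q, phi (next q.1, next q.2) = next (phi q).
Variables (a0 : A) (x0 : X) (T M p : nat).
Hypotheses (MB : #|B| <= M) (TA : M + #|A| <= T) (TX : M + #|X| <= T).
(** Orbits are indexed backwards: index [h.+1] is a predecessor of index [h]. The bounds on [T]
    leave at least [#|A|] and [#|X|] steps before level [M], so the levels up to [M] are cyclic. *)
Let al h : A := iter (T - h) next a0.
Let xx h : X := iter (T - h) next x0.
Let v h : B := phi (al h, xx h).
Hypotheses (p0 : 0 < p) (pM : p <= M) (pper : iter p next (xx 0) = xx 0).
Hypothesis pmin : forall k, 0 < k -> k < p -> iter k next (xx 0) != xx 0.
Variable In : A -> {set B}.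
Hypothesis InE : forall a b x c, cyclic a -> eqv b ((next a, x) : fdds_mul A X) ->
  \sum_(u | next u == b) ((u \in In a) && (key a u == c)) =
  \sum_(x' | next x' == x) (key a (phi (a, x')) == c).
Let d : B -> nat := depth al v In p M.
(** The cut cycle is closed again: since [xx p] is [xx 0], the successor of the root is the state at
    level [p.-1], whereas [next (v 0)] may lie over another state of [A]. *)
Let nxt b := if b == v 0 then v p.-1 else next b.

Lemma phi_eqv q : eqv (phi q) (q : fdds_mul A X).
Proof.
move=> es; apply: (@wt_emb (fdds_mul A X) B phi) => [|u|u z zu].
- exact: bij_inj.
- exact: phi_next.
- by case: phi_bij => psi _ psiK; exists (psi z).
Qed.

Lemma al_next h : h < T -> next (al h.+1) = al h.
Proof. by move=> hT; rewrite /al -iterS subnSK. Qed.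

Lemma xx_next h : h < T -> next (xx h.+1) = xx h.
Proof. by move=> hT; rewrite /xx -iterS subnSK. Qed.

Lemma v_next h : h < T -> next (v h.+1) = v h.
Proof. by move=> hT; rewrite /v -phi_next /= al_next ?xx_next. Qed.

Lemma al_cyclic h : h <= M -> cyclic (al h).
Proof. by move=> hM; apply: iter_cyclic; lia. Qed.

Lemma xx_cyclic h : h <= M -> cyclic (xx h).
Proof. by move=> hM; apply: iter_cyclic; lia. Qed.

Lemma v_cyclic h : h <= M -> cyclic (v h).
Proof.
move=> hM; apply: wt_gt0_cyclic => es.
rewrite phi_eqv wt_mul muln_gt0; apply/andP.
by split; apply: wt_cyclic; [apply: al_cyclic|apply: xx_cyclic].
Qed.

Lemma MT : M <= T. Proof. lia. Qed.

Lemma iter_v k h : h <= k -> k <= M -> iter h next (v k) = v (k - h).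
Proof.
elim: h => [|h IH] hk kM; first by rewrite subn0.
rewrite iterS IH ?(ltnW hk) // -(subnSK hk) v_next //; have := MT; lia.
Qed.

Lemma iter_xx k h : h <= k -> k <= M -> iter h next (xx k) = xx (k - h).
Proof.
elim: h => [|h IH] hk kM; first by rewrite subn0.
rewrite iterS IH ?(ltnW hk) // -(subnSK hk) xx_next //; have := MT; lia.
Qed.

Lemma xx_p : xx p = xx 0.
Proof.
apply: (iter_cyclic_inj (k := p)); [exact: xx_cyclic..|].
by rewrite iter_xx // subnn pper.
Qed.

Lemma iter_phi k q : iter k next (phi q) = phi (iter k next q.1, iter k next q.2).
Proof. by elim: k => [|k IH] /=; rewrite -?surjective_pairing // IH -phi_next. Qed.

Lemma v_neq h : 0 < h -> h < p -> v h != v 0.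
Proof.
move=> h0 hp; apply: contraTneq (pmin h0 hp) => e; rewrite negbK.
have [_ e'] : (al h, xx h) = (al 0, xx 0) by apply: (bij_inj phi_bij).
by rewrite -{1}e' iter_xx ?subnn // (leq_trans (ltnW hp)).
Qed.

(** Some chosen state has the key of [v h.+1], hence is equivalent to it and cyclic, and the cyclic
    predecessor of [v h] is unique. *)
Lemma v_In h : h < M -> v h.+1 \in In (al h.+1).
Proof.
move=> hM; have hT : h < T := leq_trans hM MT.
have ca := al_cyclic hM.
have e : eqv (v h) ((next (al h.+1), xx h) : fdds_mul A X).
  by rewrite al_next //; apply: phi_eqv.
have := InE (key (al h.+1) (v h.+1)) ca e; rewrite [RHS](bigD1 (xx h.+1)) ?xx_next //=.
rewrite eqxx add1n => s.
have /sum_gt0P[u /eqP nu] : 0 < \sum_(u | next u == v h)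
    ((u \in In (al h.+1)) && (key (al h.+1) u == key (al h.+1) (v h.+1))) by rewrite s.
rewrite lt0b => /andP[uIn /eqP/keyE -/(_ ca)/eqv_sym/eqv_cyclic uv].
suff <- : u = v h.+1 by [].
by apply: cyclic_inj; rewrite ?v_next //; [apply: uv|]; apply: v_cyclic.
Qed.

Lemma dE b : d b = dstep al v In p d b.
Proof. exact: depth_fix. Qed.

Lemma d_v h : h < p -> d (v h) = h.+1.
Proof.
elim: h => [|h IH] hp; first by rewrite dE /dstep eqxx.
have hM : h < M by apply: leq_trans (ltnW hp) pM.
rewrite dE /dstep (negPf (v_neq _ hp)) // v_next ?(leq_trans hM MT) //.
by rewrite (IH (ltnW hp)) v_In // (ltn_eqF hp).
Qed.

Lemma d_next b : b != v 0 -> 0 < d b -> d b = (d (next b)).+1 /\ 0 < d (next b).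
Proof. by move=> /negPf bv; rewrite dE /dstep bv; case: ifP => // /and3P[]. Qed.

Lemma d_chain b h i : d b = h.+1 -> i <= h -> d (iter i next b) = h.+1 - i.
Proof.
move=> db; have [_ _ hi] := depth_hit db.
elim: i => [|i IH] ih; first by rewrite subn0.
have {}IH := IH (ltnW ih).
have [] := d_next (hi _ ih); rewrite ?IH; first by lia.
by rewrite iterS; lia.
Qed.

(** The cycle of [v 0] in [B] may be longer than [p]. If the label of its successor exceeded [p],
    the chain down to [v 0] would pass through [v p] with label [p.+1], which [dstep] refuses. So
    [v 0] sits above a labelled state only in the role of [v p]. *)
Lemma d_root s h : next (v 0) = s -> d s = h.+1 -> h.+1 = p /\ v p = v 0.
Proof.
move=> vs ds; have [hM hv hi] := depth_hit ds.
have hv' : iter h.+1 next (v 0) = v 0 by rewrite iterSr vs.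
have ph : p <= h.+1.
  rewrite leqNgt; apply/negP => hp; have /negP[] := pmin (ltn0Sn h) hp.
  move: hv'; rewrite iter_phi => /(bij_inj phi_bij)[_ e].
  by rewrite iterS e eqxx.
have vp u : cyclic u -> iter p next u = v 0 -> u = v p.
  move=> cu e; apply: (iter_cyclic_inj (k := p)) => //; first exact: v_cyclic.
    by rewrite iter_v // subnn.
case: (ltngtP p h.+1) ph => // [ph|ph] _; last first.
  by split=> //; apply/esym/vp; [apply: v_cyclic|rewrite ph].
have du := d_chain ds (leq_subr p h).
have eu : iter (h - p) next s = v p.
  apply: vp; first by rewrite -vs; apply/cyclic_iter/cyclic_next/v_cyclic.
  by rewrite -iterD subnKC -1?ltnS.
move: du; rewrite eu dE /dstep; case: eqP => [_|_]; first by lia.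
have -> : next (v p) = v p.-1.
  by rewrite -{1}(prednK p0) v_next // (leq_trans _ MT) // prednK.
rewrite d_v ?prednK // !eqxx !andbF; lia.
Qed.

Lemma nxt_d b : 0 < d b -> 0 < d (nxt b).
Proof.
rewrite /nxt; case: eqP => [_ _|/eqP bv /(d_next bv)[] //].
by rewrite d_v // prednK.
Qed.

Variables (Y : fdds) (iota : Y -> B).
Hypothesis iota_inj : injective iota.
Hypothesis iota_im : forall b, 0 < d b <-> exists y, iota y = b.
Hypothesis iota_next : forall y, iota (next y) = nxt (iota y).

(** The predecessors of [y] are the chosen states above [iota y]; by [InE] they match, key by key,
    the states [phi (al h.+1, x')] with [x'] above [x], and the induction hypothesis applies one
    level up. Where the cycle closes, [v 0] stands for [v p]. *)
Lemma wt_candidate es y h x : d (iota y) = h.+1 ->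
  eqv (iota y) ((al h, x) : fdds_mul A X) -> wt es y = wt es x.
Proof.
elim: es y h x => //= -[e e'] es IH y h x dy eyx; rewrite (IH y h x) //; congr (_ * _).
have hM : h < M by case: (depth_hit dy).
set s := iota y in dy eyx.
(* [G] carries the weights of [Y] over to states of [B], where [InE] speaks. *)
pose G b := \sum_(z | iota z == b) wt es z ^ e.+1.
have GE z : G (iota z) = wt es z ^ e.+1.
  by rewrite /G (eq_bigl (pred1 z)) ?big_pred1_eq // => z'; rewrite (inj_eq iota_inj).
have GIH b k x' : d b = k.+1 -> eqv b ((al k, x') : fdds_mul A X) -> G b = wt es x' ^ e.+1.
  move=> db bx; have [z zb] : exists z, iota z = b by apply/iota_im; rewrite db.
  by rewrite -zb GE (IH z k x') ?zb.
transitivity (\sum_(b | (0 < d b) && (nxt b == s)) G b).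
  rewrite /G (exchange_big_dep (fun z => next z == y)) /=; last first.
    by move=> b z /andP[_ /eqP nb] /eqP zb; rewrite -(inj_eq iota_inj) iota_next zb nb.
  apply: eq_bigr => z /eqP nz; rewrite (eq_bigl (pred1 (iota z))) ?big_pred1_eq // => b.
  rewrite [RHS]/= [RHS]eq_sym; case: (iota z =P b) => [<-|_]; rewrite ?andbF // andbT.
  by rewrite -iota_next nz eqxx andbT; apply/iota_im; exists z.
(* [v p] among the chosen states and [v 0] among the predecessors for [nxt] are the only difference
   between the two index sets. *)
pose sp b := (h.+1 == p) && (b == v p).
have hT : h < T := leq_trans hM MT.
have ca := al_cyclic hM.
transitivity (\sum_(b | (next b == s) && (b \in In (al h.+1))) (if sp b then G (v 0) else G b)).
  rewrite (bigID (pred1 (v 0))) /= [RHS](bigID sp) /=; congr addn.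
    rewrite (sum_at (fun b => (0 < d b) && (nxt b == s))) d_v //.
    rewrite [RHS](eq_bigl (fun b => [&& h.+1 == p, next b == s & b \in In (al h.+1)] && (b == v p))) =>
      [|b]; last by rewrite /sp [RHS]andbC [in RHS]andbCA [LHS]andbC -andbA andbCA.
    rewrite sum_at /sp eqxx andbT /= /nxt eqxx.
    have nvp : next (v p) = v p.-1.
      by rewrite -{1}(prednK p0) v_next // (leq_trans _ MT) // prednK.
    rewrite nvp; case: (v p.-1 =P s) => [vs|_]; last by rewrite andbF.
    have hp : h.+1 = p by move: dy; rewrite -vs d_v ?prednK.
    have vin : v p \in In (al h.+1) by rewrite -hp v_In.
    by rewrite vin hp eqxx.
  rewrite [RHS](eq_bigr G) => [|b /andP[_ /negPf->] //]; apply: eq_bigl => b.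
  rewrite /nxt; have [bv|bv] := eqVneq b (v 0).
    rewrite andbF; apply/esym/negbTE; rewrite negb_and negbK -implybE.
    apply/implyP => /andP[/eqP nb _]; rewrite bv in nb *.
    by have [hp vp] := d_root nb dy; rewrite /sp hp eqxx vp eqxx.
  rewrite andbT; case: (next b =P s) => [nb|_]; rewrite ?andbF // andbT /=.
  by rewrite dE /dstep (negPf bv) nb dy /=; case: ifP.
apply: (sum_key (k := key (al h.+1)) (k' := fun x' => key (al h.+1) (phi (al h.+1, x')))).
  move=> c; rewrite -(InE (b := s)) ?al_next //.
  by rewrite big_mkcondr; apply: eq_bigr => b _; case: (b \in _).
move=> b x' /andP[/eqP nb bIn] /eqP nx' /keyE -/(_ ca) e1.
have bx' : eqv b ((al h.+1, x') : fdds_mul A X) := eqv_trans e1 (phi_eqv _).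
have gv0 : G (v 0) = wt es (xx 0) ^ e.+1 by apply: (GIH _ 0); rewrite ?d_v //; apply: phi_eqv.
case: ifP => [/andP[/eqP hp /eqP bp]|nsp].
  rewrite gv0 -xx_p; congr (_ ^ _); rewrite hp bp in bx'.
  have := eqv_trans (eqv_sym (phi_eqv (al p, xx p))) bx' => /eqv_mulI; apply.
  exact: al_cyclic.
apply: (GIH _ h.+1) bx'.
have [bv|bv] := eqVneq b (v 0).
  by rewrite bv in nb; have [hp vp] := d_root nb dy; rewrite /sp hp bv vp !eqxx in nsp.
by rewrite dE /dstep (negPf bv) nb dy bIn -/(sp b) nsp.
Qed.

Variable (r : Y).
Hypothesis iota_r : iota r = v 0.
Hypothesis X_reach : forall x : X, exists k, iter k next x = xx 0.

Lemma candidate_root : eqv r (xx 0).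
Proof.
move=> es; apply: (@wt_candidate es r 0); rewrite iota_r; last exact: phi_eqv.
by rewrite d_v.
Qed.

Lemma iota_iter i : 0 < i -> i <= p -> iota (iter i next r) = v (p - i).
Proof.
elim: i => // -[|i] IH _ ip; first by rewrite /= iota_next /nxt iota_r eqxx subn1.
have v1 : 0 < p - i.+1 by lia.
have v2 : p - i.+1 < p by lia.
rewrite iterS iota_next IH ?(ltnW ip) // /nxt (negPf (v_neq v1 v2)).
by rewrite -(subnSK ip) v_next //; have := MT; lia.
Qed.

Lemma candidate_period : iter p next r = r.
Proof. by apply: iota_inj; rewrite iota_iter // subnn iota_r. Qed.

Lemma candidate_min k : 0 < k -> k < p -> iter k next r != r.
Proof.
move=> k0 kp; rewrite -(inj_eq iota_inj) iota_iter ?(ltnW kp) // iota_r.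
by apply: v_neq; lia.
Qed.

Lemma candidate_reach y : exists k, iter k next y = r.
Proof.
have [n] := ubnP (d (iota y)); elim: n y => // n IH y.
have [yr|yr] := eqVneq (iota y) (v 0) => lt.
  by exists 0; apply: iota_inj; rewrite yr.
have dy : 0 < d (iota y) by apply/iota_im; exists y.
have [dn _] := d_next yr dy; have [|k e] := IH (next y).
  by rewrite iota_next /nxt (negPf yr); lia.
by exists k.+1; rewrite iterSr.
Qed.

(** Fixed points of an iterate on a product are pairs of fixed points. [X] and [Y] both have one
    cycle of length [p], and these cycles are equivalent in step, starting from the root. *)
Theorem candidate_counts l (f : A * Y -> nat) (f' : B -> nat) : 0 < l ->
  (forall u w, eqv (u : fdds_mul A Y) w -> f u = f' w) ->
  \sum_(u | iter l (@next (fdds_mul A Y)) u == u) f u = \sum_(w | iter l next w == w) f' w.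
Proof.
move=> l0 ff.
have iter_pair (Z : fdds) (q : fdds_mul A Z) :
    iter l next q = (iter l next q.1, iter l next q.2).
  by elim: (l) => [|k IH] /=; rewrite -?surjective_pairing // IH.
have pairE (Z : fdds) (F : A * Z -> nat) : \sum_(q | iter l (@next (fdds_mul A Z)) q == q) F q =
    \sum_(a : A | iter l next a == a) \sum_(z : Z | iter l next z == z) F (a, z).
  rewrite pair_big; apply: eq_big => [[a z]|[a z] //].
  by rewrite iter_pair xpair_eqE.
rewrite pairE.
transitivity (\sum_(q | iter l (@next (fdds_mul A X)) q == q) f' (phi q)); last first.
  have [psi phiK psiK] := phi_bij.
  rewrite [RHS](reindex phi); last by exists psi => q _; [apply: phiK|apply: psiK].
  by apply: eq_bigl => q; rewrite iter_phi (bij_eq phi_bij) iter_pair.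
rewrite pairE; apply: eq_bigr => a _.
rewrite (sum_fix_root (r := r) (p := p)) //;
  [|exact: candidate_period|exact: candidate_min|exact: candidate_reach].
rewrite (sum_fix_root (r := xx 0) (p := p)) //; case: ifP => // _.
apply: eq_bigr => i _; apply: ff; apply: eqv_trans (eqv_sym (phi_eqv _)).
apply: eqv_mul => //; elim: (i : nat) => [|k IH]; first exact: candidate_root.
rewrite !iterS; apply: (eqv_next (l := p.-1)) IH; rewrite prednK // -iterD addnC iterD.
  by rewrite candidate_period.
by rewrite pper.
Qed.

End Candidate.

(** * Programs with bounded loops *)

(** Bounded sums and conditionals are expressions, so that counting formulas are programs as they
    stand; compilation turns the sums into loops. *)
Inductive pexpr :=
  | ECst of nat
  | EVar of nat
  | EGet of nat & pexpr
  | EAdd of pexpr & pexpr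
  | ESub of pexpr & pexpr
  | EIf of pexpr & pexpr & pexpr
  | ESum of bool & nat & pexpr & pexpr.

Inductive cmd :=
  | CSkip
  | CSet of nat & pexpr
  | CPut of nat & pexpr & pexpr
  | CFill of bool & nat & nat & pexpr & pexpr
  | CSeq of cmd & cmd
  | CIf of pexpr & cmd & cmd
  | CFor of bool & nat & pexpr & cmd.

(* The flag [w] of a loop selects the variable, holding m or m^2, that bounds
   the number of its iterations whatever its explicit limit. *)
Definition bvar (w : bool) : nat := if w then 3 else 2.
Arguments bvar : simpl never.

Fixpoint ev (s : store) (e : pexpr) : nat :=
  match e with
  | ECst c => c
  | EVar x => var s x
  | EGet a e1 => arr s a (ev s e1)
  | EAdd e1 e2 => ev s e1 + ev s e2
  | ESub e1 e2 => ev s e1 - ev s e2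
  | EIf e0 e1 e2 => if ev s e0 != 0 then ev s e1 else ev s e2
  | ESum w x l e1 =>
      \sum_(i < minn (ev s l) (var s (bvar w))) ev (set_var s x i) e1
  end.

Definition fill (s : store) (a n : nat) (f : nat -> nat) : store :=
  Store (var s)
    (fun b j => if (b == a) && (j < n) then f j else arr s b j).

Fixpoint den (c : cmd) (s : store) : store :=
  match c with
  | CSkip => s
  | CSet x e => set_var s x (ev s e)
  | CPut a e1 e2 => set_arr s a (ev s e1) (ev s e2)
  | CFill w a x l e =>
      fill s a (minn (ev s l) (var s (bvar w))) (fun i => ev (set_var s x i) e)
  | CSeq c1 c2 => den c2 (den c1 s)
  | CIf e c1 c2 => if ev s e != 0 then den c1 s else den c2 s
  | CFor w x l c1 =>
      foldl (fun s' i => den c1 (set_var s' x i)) s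
        (iota 0 (minn (ev s l) (var s (bvar w))))
  end.

(* Named variables lie below [tbase]; the variables [tbase + d] are the stack
   on which compiled expressions leave their values. *)
Definition tbase : nat := 100.

Definition loop (x d : nat) (p : prog) : prog :=
  Seq (Assign x (Cst 0))
    (While (Sub (Var (tbase + d)) (Var x))
       (Seq p (Assign x (Add (Var x) (Cst 1))))).

(** With truncated subtraction, [n - (n - b)] is the minimum of [n] and [b]. *)
Definition clamp (w : bool) (d d' : nat) : prog :=
  Assign (tbase + d')
    (Sub (Var (tbase + d)) (Sub (Var (tbase + d)) (Var (bvar w)))).

Fixpoint compe (e : pexpr) (d : nat) : prog :=
  match e with
  | ECst c => Assign (tbase + d) (Cst c)
  | EVar x => Assign (tbase + d) (Var x)
  | EGet a e1 => Seq (compe e1 d) (Assign (tbase + d) (Get a (Var (tbase + d))))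
  | EAdd e1 e2 =>
      Seq (compe e1 d) (Seq (compe e2 d.+1)
        (Assign (tbase + d) (Add (Var (tbase + d)) (Var (tbase + d.+1)))))
  | ESub e1 e2 =>
      Seq (compe e1 d) (Seq (compe e2 d.+1)
        (Assign (tbase + d) (Sub (Var (tbase + d)) (Var (tbase + d.+1)))))
  | EIf e0 e1 e2 =>
      Seq (compe e0 d) (If (Var (tbase + d)) (compe e1 d) (compe e2 d))
  | ESum w x l e1 =>
      Seq (compe l d) (Seq (clamp w d d.+1) (Seq (Assign (tbase + d) (Cst 0))
        (loop x d.+1 (Seq (compe e1 d.+2)
          (Assign (tbase + d) (Add (Var (tbase + d)) (Var (tbase + d.+2))))))))
  end.

Fixpoint compc (c : cmd) (d : nat) : prog :=
  match c with
  | CSkip => Skip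
  | CSet x e => Seq (compe e d) (Assign x (Var (tbase + d)))
  | CPut a e1 e2 =>
      Seq (compe e1 d) (Seq (compe e2 d.+1)
        (Put a (Var (tbase + d)) (Var (tbase + d.+1))))
  | CFill w a x l e =>
      Seq (compe l d) (Seq (clamp w d d) (loop x d
        (Seq (compe e d.+1) (Put a (Var x) (Var (tbase + d.+1))))))
  | CSeq c1 c2 => Seq (compc c1 d) (compc c2 d)
  | CIf e c1 c2 => Seq (compe e d) (If (Var (tbase + d)) (compc c1 d) (compc c2 d))
  | CFor w x l c1 =>
      Seq (compe l d) (Seq (clamp w d d) (loop x d (compc c1 d.+1)))
  end.

(** A polynomial in the loop bound [m], counting every loop with the largest number of iterations
    that its flag allows. *)
Fixpoint timee (e : pexpr) (m : nat) : nat :=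
  match e with
  | ECst _ | EVar _ => 2
  | EGet _ e1 => timee e1 m + 3
  | EAdd e1 e2 | ESub e1 e2 => timee e1 m + timee e2 m + 4
  | EIf e0 e1 e2 => timee e0 m + timee e1 m + timee e2 m + 2
  | ESum w _ l e1 => timee l m + m ^ w.+1 * (timee e1 m + 12) + 14
  end.

Fixpoint timec (c : cmd) (m : nat) : nat :=
  match c with
  | CSkip => 1
  | CSet _ e => timee e m + 2
  | CPut _ e1 e2 => timee e1 m + timee e2 m + 3
  | CFill w _ _ l e => timee l m + m ^ w.+1 * (timee e m + 11) + 12
  | CSeq c1 c2 => timec c1 m + timec c2 m
  | CIf e c1 c2 => timee e m + timec c1 m + timec c2 m + 2
  | CFor w _ l c1 => timee l m + m ^ w.+1 * (timec c1 m + 8) + 12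
  end.

Fixpoint dege (e : pexpr) : nat :=
  match e with
  | ECst _ | EVar _ => 0
  | EGet _ e1 => dege e1
  | EAdd e1 e2 | ESub e1 e2 => maxn (dege e1) (dege e2)
  | EIf e0 e1 e2 => maxn (dege e0) (maxn (dege e1) (dege e2))
  | ESum w _ l e1 => maxn (dege l) (w.+1 + dege e1)
  end.

Fixpoint degc (c : cmd) : nat :=
  match c with
  | CSkip => 0
  | CSet _ e => dege e
  | CPut _ e1 e2 => maxn (dege e1) (dege e2)
  | CFill w _ _ l e => maxn (dege l) (w.+1 + dege e)
  | CSeq c1 c2 => maxn (degc c1) (degc c2)
  | CIf e c1 c2 => maxn (dege e) (maxn (degc c1) (degc c2))
  | CFor w _ l c1 => maxn (dege l) (w.+1 + degc c1)
  end.

Lemma leq_monomial c d d' m : 0 < m -> d <= d' -> c * m ^ d <= c * m ^ d'.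
Proof. by move=> m0 dd; rewrite leq_mul2l leq_pexp2l ?orbT. Qed.

(** The value at 1 is the sum of the coefficients of the polynomial. *)
Lemma timee_deg e m : 0 < m -> timee e m <= timee e 1 * m ^ dege e.
Proof.
move=> m0; have up := leq_monomial _ m0; have m1 d : 0 < m ^ d by rewrite expn_gt0 m0.
elim: e => /=.
- by move=> _; rewrite muln1.
- by move=> _; rewrite muln1.
- by move=> _ e IH; rewrite mulnDl leq_add // leq_pmulr.
- move=> e1 IH1 e2 IH2; rewrite !mulnDl !leq_add ?leq_pmulr //.
    by apply: leq_trans IH1 _; apply: up; rewrite leq_maxl.
  by apply: leq_trans IH2 _; apply: up; rewrite leq_maxr.
- move=> e1 IH1 e2 IH2; rewrite !mulnDl !leq_add ?leq_pmulr //.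
    by apply: leq_trans IH1 _; apply: up; rewrite leq_maxl.
  by apply: leq_trans IH2 _; apply: up; rewrite leq_maxr.
- move=> e0 IH0 e1 IH1 e2 IH2; rewrite !mulnDl !leq_add ?leq_pmulr //.
  + by apply: leq_trans IH0 _; apply: up; rewrite leq_maxl.
  + by apply: leq_trans IH1 _; apply: up; rewrite !leq_max leqnn orbT.
  + by apply: leq_trans IH2 _; apply: up; rewrite !leq_max leqnn !orbT.
- move=> w _ l IHl e IHe; rewrite !mulnDl !leq_add ?leq_pmulr //.
    by apply: leq_trans IHl _; apply: up; rewrite leq_maxl.
  rewrite exp1n mul1n; apply: leq_trans (up _ _ _ (leq_maxr _ _)).
  rewrite expnD mulnCA leq_mul2l mulnDl; apply/orP; right.
  by rewrite leq_add ?leq_pmulr.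
Qed.

Lemma timec_deg c m : 0 < m -> timec c m <= timec c 1 * m ^ degc c.
Proof.
move=> m0; have up := leq_monomial _ m0; have m1 d : 0 < m ^ d by rewrite expn_gt0 m0.
have E e := timee_deg e m0.
elim: c => /=.
- by rewrite muln1.
- by move=> _ e; rewrite mulnDl leq_add // leq_pmulr.
- move=> _ e1 e2; rewrite !mulnDl !leq_add ?leq_pmulr //.
    by apply: leq_trans (E _) _; apply: up; rewrite leq_maxl.
  by apply: leq_trans (E _) _; apply: up; rewrite leq_maxr.
- move=> w _ _ l e; rewrite !mulnDl !leq_add ?leq_pmulr //.
    by apply: leq_trans (E _) _; apply: up; rewrite leq_maxl.
  rewrite exp1n mul1n; apply: leq_trans (up _ _ _ (leq_maxr _ _)).
  rewrite expnD mulnCA leq_mul2l mulnDl; apply/orP; right.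
  by rewrite leq_add ?leq_pmulr.
- move=> c1 IH1 c2 IH2; rewrite !mulnDl !leq_add //.
    by apply: leq_trans IH1 _; apply: up; rewrite leq_maxl.
  by apply: leq_trans IH2 _; apply: up; rewrite leq_maxr.
- move=> e c1 IH1 c2 IH2; rewrite !mulnDl !leq_add ?leq_pmulr //.
  + by apply: leq_trans (E _) _; apply: up; rewrite leq_maxl.
  + by apply: leq_trans IH1 _; apply: up; rewrite !leq_max leqnn orbT.
  + by apply: leq_trans IH2 _; apply: up; rewrite !leq_max leqnn !orbT.
- move=> w _ l c IHc; rewrite !mulnDl !leq_add ?leq_pmulr //.
    by apply: leq_trans (E _) _; apply: up; rewrite leq_maxl.
  rewrite exp1n mul1n; apply: leq_trans (up _ _ _ (leq_maxr _ _)).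
  rewrite expnD mulnCA leq_mul2l mulnDl; apply/orP; right.
  by rewrite leq_add ?leq_pmulr.
Qed.

(** * Scoping and agreement of stores *)

Fixpoint wfe (vs : seq nat) (e : pexpr) : bool :=
  match e with
  | ECst _ => true
  | EVar x => x \in vs
  | EGet _ e1 => wfe vs e1
  | EAdd e1 e2 | ESub e1 e2 => wfe vs e1 && wfe vs e2
  | EIf e0 e1 e2 => [&& wfe vs e0, wfe vs e1 & wfe vs e2]
  | ESum _ x l e1 => [&& wfe vs l, x \notin vs, x < tbase & wfe (x :: vs) e1]
  end.

Fixpoint reads (e : pexpr) : seq nat :=
  match e with
  | ECst _ | EVar _ => [::]
  | EGet a e1 => a :: reads e1
  | EAdd e1 e2 | ESub e1 e2 => reads e1 ++ reads e2
  | EIf e0 e1 e2 => reads e0 ++ reads e1 ++ reads e2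
  | ESum _ _ l e1 => reads l ++ reads e1
  end.

(** [gs] lists the assignable variables, and loop variables must be fresh. A fill may not read the
    array that it writes: compiled code overwrites it gradually, whereas [den] reads the old
    contents throughout. *)
Fixpoint wfc (gs vs : seq nat) (c : cmd) : bool :=
  match c with
  | CSkip => true
  | CSet x e => (x \in gs) && wfe vs e
  | CPut _ e1 e2 => wfe vs e1 && wfe vs e2
  | CFill _ a x l e =>
      [&& wfe vs l, x \notin vs, x < tbase, wfe (x :: vs) e & a \notin reads e]
  | CSeq c1 c2 => wfc gs vs c1 && wfc gs vs c2
  | CIf e c1 c2 => [&& wfe vs e, wfc gs vs c1 & wfc gs vs c2]
  | CFor _ x l c1 => [&& wfe vs l, x \notin vs, x < tbase & wfc gs (x :: vs) c1]
  end.

(** Compiled code spoils the stack and the loop variables out of scope, so stores are compared on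
    the variables in scope only, but on all arrays. *)
Definition agree (vs : seq nat) (s s' : store) : Prop :=
  {in vs, var s =1 var s'} /\ forall a i, arr s a i = arr s' a i.

Definition scope (vs : seq nat) : Prop :=
  [/\ 2 \in vs, 3 \in vs & {in vs, forall x, x < tbase}].

Lemma scope_cons x vs : scope vs -> x < tbase -> scope (x :: vs).
Proof.
case=> h2 h3 h xt; split; rewrite ?inE ?h2 ?h3 ?orbT // => y.
by rewrite inE => /predU1P[->|/h].
Qed.

Lemma scope_bvar vs w : scope vs -> bvar w \in vs.
Proof. by case; case: w. Qed.

Lemma agree_set x v vs s s' : agree vs s s' ->
  agree (x :: vs) (set_var s x v) (set_var s' x v).
Proof.
case=> hv ha; split=> [y|//]; rewrite inE /=.
by case: eqP => //= _ /hv.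
Qed.

Lemma ev_agree_reads e vs s s' :
  wfe vs e -> scope vs -> {in vs, var s =1 var s'} ->
  {in reads e, forall a, arr s a =1 arr s' a} -> ev s e = ev s' e.
Proof.
elim: e vs s s' => //=.
- by move=> x vs s s' xv _ h _; apply: h.
- move=> a e IH vs s s' we sc h ha; rewrite (IH vs s s') //.
    by rewrite ha // inE eqxx.
  by move=> b bi; apply: ha; rewrite inE bi orbT.
- move=> e1 IH1 e2 IH2 vs s s' /andP[w1 w2] sc h ha.
  by rewrite (IH1 vs s s') // ?(IH2 vs s s') // => b bi; apply: ha;
    rewrite mem_cat bi ?orbT.
- move=> e1 IH1 e2 IH2 vs s s' /andP[w1 w2] sc h ha.
  by rewrite (IH1 vs s s') // ?(IH2 vs s s') // => b bi; apply: ha;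
    rewrite mem_cat bi ?orbT.
- move=> e0 IH0 e1 IH1 e2 IH2 vs s s' /and3P[w0 w1 w2] sc h ha.
  by rewrite (IH0 vs s s') ?(IH1 vs s s') ?(IH2 vs s s') // => b bi;
    apply: ha; rewrite !mem_cat bi ?orbT.
- move=> w x l IHl e IHe vs s s' /and4P[wl xv xt we] sc h ha.
  rewrite (IHl vs s s') // => [|b bi]; last by apply: ha; rewrite mem_cat bi.
  rewrite h ?scope_bvar //; apply: eq_bigr => i _.
  apply: IHe we _ _ _; first exact: scope_cons.
    by move=> y; rewrite inE /=; case: eqP => //= _ /h.
  by move=> b bi; apply: ha; rewrite mem_cat bi orbT.
Qed.

Lemma ev_agree e vs s s' : wfe vs e -> scope vs -> agree vs s s' -> ev s e = ev s' e.
Proof. by move=> we sc [hv ha]; apply: ev_agree_reads we sc hv _ => a _ i. Qed.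

Definition bounded (m : nat) (s : store) : Prop :=
  forall w, var s (bvar w) <= m ^ w.+1.

Lemma bounded_agree m vs s s' : scope vs -> agree vs s s' -> bounded m s -> bounded m s'.
Proof. by move=> sc [hv _] b w; rewrite -hv ?scope_bvar. Qed.

(** * Correctness and running time of compiled code *)

(** Each round costs 4 for the test and 4 for the increment on top of the body; the initialisation
    costs 2 and the last test 4. *)
Lemma exec_loop x d p n B (I : nat -> store -> Prop) s :
  x < tbase ->
  (forall i s1 s2, I i s1 -> {in predC1 x, var s1 =1 var s2} ->
     (forall a j, arr s1 a j = arr s2 a j) -> I i s2) ->
  (forall i s1, I i s1 -> var s1 (tbase + d) = n) ->
  (forall i s1, i < n -> I i s1 -> var s1 x = i ->
     exists s2 t, [/\ exec p s1 s2 t, I i.+1 s2, var s2 x = i & t <= B]) ->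
  I 0 s ->
  exists s' t, [/\ exec (loop x d p) s s' t, I n s' & t <= n * (B + 8) + 6].
Proof.
move=> xt Iext Id step I0.
have ext i s1 v : I i s1 -> I i (set_var s1 x v).
  by move=> /Iext; apply=> // y; rewrite inE /= => /negPf->.
suff W k i s1 : k + i = n -> I i s1 -> var s1 x = i ->
    exists s2 t, [/\ exec (While (Sub (Var (tbase + d)) (Var x))
        (Seq p (Assign x (Add (Var x) (Cst 1))))) s1 s2 t, I n s2 &
        t <= k * (B + 8) + 4].
  have [s2 [t [e2 In le]]] := W n 0 (set_var s x 0) (addn0 _) (ext _ _ _ I0)
    ltac:(by rewrite /= eqxx).
  exists s2, (2 + t); split=> //; last by lia.
  by apply: ExecSeq e2; apply: (ExecAssign s x (Cst 0)).
elim: k i s1 => [|k IHk] i s1 kin Ii xi.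
  exists s1, 4; split=> //; last by rewrite -kin in Ii *.
  by apply: (@ExecWhileFalse (Sub (Var (tbase + d)) (Var x))) => /=; rewrite (Id _ _ Ii) xi; lia.
have [s2 [t2 [e2 I2 x2 le2]]] := step i s1 ltac:(lia) Ii xi.
have [s3 [t3 [e3 I3 le3]]] :=
  IHk i.+1 (set_var s2 x (i + 1)) ltac:(lia) (ext _ _ _ I2) ltac:(by rewrite /= eqxx addn1).
exists s3, (4 + (t2 + 4) + t3); split=> //; last by lia.
apply: (@ExecWhileTrue (Sub (Var (tbase + d)) (Var x))) e3.
  by rewrite /= (Id _ _ Ii) xi; lia.
apply: ExecSeq e2 _; rewrite -x2.
exact: (ExecAssign s2 x (Add (Var x) (Cst 1))).
Qed.

(** Stack discipline: code at depth [d] leaves its value at [tbase + d] and preserves the entries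
    below, where enclosing expressions keep partial results. *)
Lemma compe_ok e d vs s m : wfe vs e -> scope vs -> bounded m s ->
  exists s' t, [/\ exec (compe e d) s s' t, var s' (tbase + d) = ev s e,
    agree vs s s', forall j, j < d -> var s' (tbase + j) = var s (tbase + j)
    & t <= timee e m].
Proof.
elim: e d vs s => /=.
- move=> c d vs s _ [_ _ sc] _; exists (set_var s (tbase + d) c), 2; split=> //.
  + exact: (ExecAssign s (tbase + d) (Cst c)).
  + by rewrite /= eqxx.
  + by split=> [x /sc xt|//] /=; case: eqP => // ?; lia.
  + by move=> j jd /=; case: eqP => // ?; lia.
- move=> y d vs s _ [_ _ sc] _; exists (set_var s (tbase + d) (var s y)), 2; split=> //.
  + exact: (ExecAssign s (tbase + d) (Var y)).
  + by rewrite /= eqxx.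
  + by split=> [x /sc xt|//] /=; case: eqP => // ?; lia.
  + by move=> j jd /=; case: eqP => // ?; lia.
- move=> a e IH d vs s we sc bd.
  have [s1 [t1 [e1 v1 [g1 h1] p1 l1]]] := IH d vs s we sc bd.
  have [_ _ sc'] := sc.
  exists (set_var s1 (tbase + d) (arr s1 a (var s1 (tbase + d)))), (t1 + 3); split=> //.
  + by apply: ExecSeq e1 (ExecAssign s1 (tbase + d) (Get a (Var (tbase + d)))).
  + by rewrite /= eqxx v1 h1.
  + split=> [x xv|//] /=; rewrite g1 //; case: eqP => // ?.
    by have := sc' _ xv; lia.
  + by move=> j jd /=; rewrite -p1 //; case: eqP => // ?; lia.
  + by rewrite leq_add2r.
- move=> e1 IH1 e2 IH2 d vs s /andP[w1 w2] sc bd.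
  have [s1 [t1 [x1 v1 g1 p1 l1]]] := IH1 d vs s w1 sc bd.
  have [s2 [t2 [x2 v2 g2 p2 l2]]] := IH2 d.+1 vs s1 w2 sc (bounded_agree sc g1 bd).
  have [_ _ sc'] := sc.
  exists (set_var s2 (tbase + d) (var s2 (tbase + d) + var s2 (tbase + d.+1))), (t1 + (t2 + 4)).
  split.
  + apply: ExecSeq x1 (ExecSeq x2 _).
    exact: (ExecAssign s2 (tbase + d) (Add (Var (tbase + d)) (Var (tbase + d.+1)))).
  + by rewrite /= eqxx v2 p2 // v1 (ev_agree w2 sc g1).
  + case: g1 g2 => g1 h1 [g2 h2]; split=> [x xv|a i] /=; last by rewrite h1 h2.
    by rewrite g1 // g2 //; case: eqP => // ?; have := sc' _ xv; lia.
  + by move=> j jd /=; rewrite -p1 // -p2 ?ltnS ?(ltnW jd) //; case: eqP => // ?; lia.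
  + by lia.
- move=> e1 IH1 e2 IH2 d vs s /andP[w1 w2] sc bd.
  have [s1 [t1 [x1 v1 g1 p1 l1]]] := IH1 d vs s w1 sc bd.
  have [s2 [t2 [x2 v2 g2 p2 l2]]] := IH2 d.+1 vs s1 w2 sc (bounded_agree sc g1 bd).
  have [_ _ sc'] := sc.
  exists (set_var s2 (tbase + d) (var s2 (tbase + d) - var s2 (tbase + d.+1))), (t1 + (t2 + 4)).
  split.
  + apply: ExecSeq x1 (ExecSeq x2 _).
    exact: (ExecAssign s2 (tbase + d) (Sub (Var (tbase + d)) (Var (tbase + d.+1)))).
  + by rewrite /= eqxx v2 p2 // v1 (ev_agree w2 sc g1).
  + case: g1 g2 => g1 h1 [g2 h2]; split=> [x xv|a i] /=; last by rewrite h1 h2.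
    by rewrite g1 // g2 //; case: eqP => // ?; have := sc' _ xv; lia.
  + by move=> j jd /=; rewrite -p1 // -p2 ?ltnS ?(ltnW jd) //; case: eqP => // ?; lia.
  + by lia.
- move=> e0 IH0 e1 IH1 e2 IH2 d vs s /and3P[w0 w1 w2] sc bd.
  have [s1 [t1 [x1 v1 g1 p1 l1]]] := IH0 d vs s w0 sc bd.
  have trans s2 : agree vs s1 s2 -> agree vs s s2.
    case: g1 => g1 h1 [g2 h2]; split=> [x xv|a i]; first by rewrite g1 // g2.
    by rewrite h1 h2.
  case: ifP => c.
    have [s2 [t2 [x2 v2 g2 p2 l2]]] := IH1 d vs s1 w1 sc (bounded_agree sc g1 bd).
    exists s2, (t1 + (2 + t2)); split.
    + by apply: ExecSeq x1 (ExecIfTrue _ _ x2); rewrite /= v1.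
    + by rewrite v2 (ev_agree w1 sc g1).
    + exact: trans.
    + by move=> j jd; rewrite p2 // p1.
    + by lia.
  have [s2 [t2 [x2 v2 g2 p2 l2]]] := IH2 d vs s1 w2 sc (bounded_agree sc g1 bd).
  exists s2, (t1 + (2 + t2)); split.
  + by apply: ExecSeq x1 (ExecIfFalse _ _ x2); rewrite /= v1; apply/eqP; rewrite -[_ == _]negbK c.
  + by rewrite v2 (ev_agree w2 sc g1).
  + exact: trans.
  + by move=> j jd; rewrite p2 // p1.
  + by lia.
- move=> w x l IHl e IHe d vs s /and4P[wl xv xt we] sc bd.
  have [s1 [t1 [x1 v1 g1 p1 l1]]] := IHl d vs s wl sc bd.
  have [_ _ sc'] := sc.
  set n := minn _ _.
  pose s2 := set_var s1 (tbase + d.+1) n; pose s3 := set_var s2 (tbase + d) 0.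
  have c1 : exec (clamp w d d.+1) s1 s2 6.
    have -> : s2 = set_var s1 (tbase + d.+1) (eval s1 (Sub (Var (tbase + d))
        (Sub (Var (tbase + d)) (Var (bvar w))))).
      rewrite /s2 /n /= v1; case: g1 => g1 _; rewrite -g1 ?scope_bvar //.
      by congr set_var; rewrite /minn; case: ltnP => ?; lia.
    exact: ExecAssign.
  have c2 : exec (Assign (tbase + d) (Cst 0)) s2 s3 2.
    exact: (ExecAssign s2 (tbase + d) (Cst 0)).
  pose I i s' := [/\ agree vs s s', var s' (tbase + d.+1) = n,
    var s' (tbase + d) = \sum_(k < i) ev (set_var s x k) e &
    forall j, j < d -> var s' (tbase + j) = var s (tbase + j)].
  have [||i s0|||s' [t [x2 [g2 _ v2 p2] l2]]] :=
    @exec_loop x d.+1 (Seq (compe e d.+2) (Assign (tbase + d)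
      (Add (Var (tbase + d)) (Var (tbase + d.+2))))) n (timee e m + 4) I s3.
  + exact: xt.
  + move=> i s0 s0' [[g h] vn vi p] g' h'; have tx j : tbase + j \in predC1 x.
      by rewrite inE; lia.
    split.
    * split=> [y yv|a j]; last by rewrite h h'.
      by rewrite g // g' // inE; apply: contraNneq xv => <-.
    * by rewrite -g' ?tx.
    * by rewrite -g' ?tx.
    * by move=> j jd; rewrite -g' ?tx // p.
  + by case.
  + move=> i s0 lt_in [g vn vi p] xi.
    have g' : agree (x :: vs) (set_var s x i) s0.
      case: g => g h; split=> [y|//]; rewrite inE /=; case: eqP => [-> _|_ /= yv]; last exact: g.
      by rewrite xi.
    have [s4 [t4 [x4 v4 g4 p4 l4]]] := IHe d.+2 (x :: vs) s0 we (scope_cons sc xt)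
      (bounded_agree sc g bd).
    exists (set_var s4 (tbase + d) (var s4 (tbase + d) + var s4 (tbase + d.+2))), (t4 + 4).
    split.
    * apply: ExecSeq x4 _.
      exact: (ExecAssign s4 (tbase + d) (Add (Var (tbase + d)) (Var (tbase + d.+2)))).
    * case: g g4 => g h [g4 h4]; split.
      - split=> [y yv|a j] /=; last by rewrite h h4.
        rewrite g // g4 ?inE ?yv ?orbT //; case: eqP => // ?.
        by have := sc' _ yv; lia.
      - by rewrite /=; case: eqP => [?|_]; [lia|by rewrite p4 //; lia].
      - rewrite /= eqxx v4 p4; last by lia.
        by rewrite vi big_ord_recr /= (ev_agree we (scope_cons sc xt) g').
      - by move=> j jd /=; case: eqP => [?|_]; [lia|by rewrite p4 ?p //; lia].
    * rewrite /=; case: eqP => [?|_]; first by lia.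
      by case: g4 => <- //; rewrite inE eqxx.
    * by lia.
  + split=> /=.
    * case: g1 => g1 h1; split=> [y yv|//] /=; rewrite g1 //.
      have ne k : (y == tbase + k) = false by have := sc' _ yv; lia.
      by rewrite !ne.
    * by case: eqP => [?|_]; [lia|rewrite eqxx].
    * by rewrite eqxx big_ord0.
    * move=> j jd; rewrite -p1 // !eqn_add2l.
      by rewrite !ifN //; lia.
  exists s', (t1 + (6 + (2 + t))); split=> //.
  + by apply: ExecSeq x1 (ExecSeq c1 (ExecSeq c2 x2)).
  + have : n * (timee e m + 4 + 8) <= m ^ w.+1 * (timee e m + 12).
      rewrite -addnA leq_mul2r (leq_trans (geq_minr _ _) (bd w)) ?orbT //.
    by lia.
Qed.

Lemma agree_trans vs s1 s2 s3 : agree vs s1 s2 -> agree vs s2 s3 -> agree vs s1 s3.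
Proof.
case=> g1 h1 [g2 h2]; split=> [x xv|a i]; first by rewrite g1 // g2.
by rewrite h1 h2.
Qed.

Lemma clamp_ok w d d' s n vs m : scope vs -> bounded m s ->
  var s (tbase + d) = n ->
  exec (clamp w d d') s (set_var s (tbase + d') (minn n (var s (bvar w)))) 6.
Proof.
move=> sc bd v.
have -> : minn n (var s (bvar w)) = eval s (Sub (Var (tbase + d))
    (Sub (Var (tbase + d)) (Var (bvar w)))).
  by rewrite /= v /minn; case: ltnP => ?; lia.
exact: ExecAssign.
Qed.

Lemma den_scope gs vs c s x : wfc gs vs c -> x \in vs -> x \notin gs ->
  var (den c s) x = var s x.
Proof.
move=> + + xg; elim: c vs s => //=.
- by move=> y e vs s /andP[yg _] _; case: eqP xg => // ->; rewrite yg.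
- by move=> c1 IH1 c2 IH2 vs s /andP[w1 w2] xv; rewrite (IH2 vs) // (IH1 vs).
- by move=> e c1 IH1 c2 IH2 vs s /and3P[_ w1 w2] xv; case: ifP => _; [apply: (IH1 vs)|apply: (IH2 vs)].
- move=> b y l c IH vs s /and4P[_ yv yt wc] xv.
  move: (iota _ _) => r; elim: r s => //= i r IHr s; rewrite IHr (IH (y :: vs)) ?inE ?xv ?orbT //=.
  by case: eqP xv yv => // -> ->.
Qed.

(** The abstract store [s0] and the concrete store [s] are separate because they may differ outside
    the scope. Variables 2 and 3 are not assignable, which keeps the loop bounds valid
    throughout. *)
Lemma compc_ok gs c d vs s s0 m : wfc gs vs c -> scope vs ->
  {subset gs <= vs} -> 2 \notin gs -> 3 \notin gs ->
  bounded m s -> agree vs s0 s ->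
  exists s' t, [/\ exec (compc c d) s s' t, agree vs (den c s0) s',
    forall j, j < d -> var s' (tbase + j) = var s (tbase + j)
    & t <= timec c m].
Proof.
move=> + + + g2 g3; have bg w : bvar w \notin gs by case: w; rewrite /bvar.
elim: c d vs s s0 => /=.
- by move=> d vs s s0 _ _ _ _ ag; exists s, 1; split=> //; apply: ExecSkip.
- move=> x e d vs s s0 /andP[xg we] sc sub bd ag.
  have [s1 [t1 [x1 v1 a1 p1 l1]]] := compe_ok d we sc bd.
  exists (set_var s1 x (var s1 (tbase + d))), (t1 + 2); split.
  + exact: ExecSeq x1 (ExecAssign s1 x (Var (tbase + d))).
  + have [g h] := agree_trans ag a1; split=> [y yv|//] /=; rewrite v1 g //.
    by rewrite (ev_agree we sc ag).
  + move=> j jd /=; case: eqP => [e1|_]; last exact: p1.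
    by case: sc => _ _ /(_ _ (sub _ xg)); lia.
  + by rewrite leq_add2r.
- move=> a e1 e2 d vs s s0 /andP[w1 w2] sc sub bd ag.
  have [s1 [t1 [x1 v1 a1 p1 l1]]] := compe_ok d w1 sc bd.
  have [s2 [t2 [x2 v2 a2 p2 l2]]] := compe_ok d.+1 w2 sc (bounded_agree sc a1 bd).
  exists (set_arr s2 a (var s2 (tbase + d)) (var s2 (tbase + d.+1))), (t1 + (t2 + 3)); split.
  + apply: ExecSeq x1 (ExecSeq x2 _).
    exact: (ExecPut s2 a (Var (tbase + d)) (Var (tbase + d.+1))).
  + have [g h] := agree_trans ag (agree_trans a1 a2); split=> [y yv|b j] /=; first by rewrite g.
    rewrite v2 p2 // v1 h (ev_agree w1 sc ag) (ev_agree w2 sc ag).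
    by rewrite (ev_agree w2 sc a1).
  + by move=> j jd; rewrite /= p2 ?p1 //; lia.
  + by lia.
- move=> w a x l e d vs s s0 /and5P[wl xv xt we ar] sc sub bd ag.
  have [s1 [t1 [x1 v1 a1 p1 l1]]] := compe_ok d wl sc bd.
  have [_ _ sc'] := sc.
  have c1 := clamp_ok w d sc (bounded_agree sc a1 bd) v1.
  have -> : minn (ev s0 l) (var s0 (bvar w)) = minn (ev s l) (var s1 (bvar w)).
    by rewrite (ev_agree wl sc ag); case: (agree_trans ag a1) => -> //; apply: scope_bvar.
  set n := minn _ _ in c1 *; set s2 := set_var _ _ _ in c1.
  pose I i s' := [/\ agree vs (fill s0 a i (fun i => ev (set_var s0 x i) e)) s',
    var s' (tbase + d) = n &
    forall j, j < d -> var s' (tbase + j) = var s (tbase + j)].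
  have [||i s5|||s' [t [x2 [g2' _ p2] l2]]] :=
    @exec_loop x d (Seq (compe e d.+1) (Put a (Var x) (Var (tbase + d.+1)))) n (timee e m + 3) I s2.
  + exact: xt.
  + move=> i s3 s3' [[g h] vn p] g' h'; have tx j : tbase + j \in predC1 x.
      by rewrite inE; lia.
    split.
    * split=> [y yv|b j]; last by rewrite h h'.
      by rewrite g // g' // inE; apply: contraNneq xv => <-.
    * by rewrite -g' ?tx.
    * by move=> j jd; rewrite -g' ?tx // p.
  + by case.
  + move=> i s3 lt_in [g vn p] xi.
    have bd3 : bounded m s3.
      move=> w'; case: g => g _; rewrite -g ?scope_bvar //=.
      by case: ag => /(_ _ (scope_bvar w' sc)) -> _; apply: bd.
    have [s4 [t4 [x4 v4 a4 p4 l4]]] := compe_ok d.+1 we (scope_cons sc xt) bd3.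
    exists (set_arr s4 a (var s4 x) (var s4 (tbase + d.+1))), (t4 + 3).
    have x4i : var s4 x = i by case: a4 => <- //; rewrite inE eqxx.
    split.
    * apply: ExecSeq x4 _; exact: (ExecPut s4 a (Var x) (Var (tbase + d.+1))).
    * have -> : var s4 (tbase + d.+1) = ev (set_var s0 x i) e.
        rewrite v4; apply: ev_agree_reads we (scope_cons sc xt) _ _.
          move=> y; rewrite inE /=; case: eqP => [-> _|_ /= yv]; first exact: xi.
          by case: g => <-.
        move=> b be j; case: g => _ <- /=.
        by case: eqP be ar => // -> ->.
      case: g a4 => g h [g4 h4]; split.
      - split=> [y yv|b j] /=; first by rewrite g // -g4 ?inE ?yv ?orbT.
        rewrite x4i -h4 -h /=; case: eqP => //= -> .
        by rewrite ltnS leq_eqVlt; case: eqP => [->|].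
      - by rewrite /= p4 // .
      - by move=> j jd /=; rewrite p4 ?p //; lia.
    * by [].
    * by lia.
  + split=> /=.
    * have [g h] := agree_trans ag a1; split=> [y yv|b j] /=; last first.
        by rewrite ltn0 andbF h.
      by rewrite g //; have := sc' _ yv; case: eqP => [?|_]; lia.
    * by rewrite eqxx.
    * by move=> j jd; rewrite -p1 //; case: eqP => [?|_]; lia.
  exists s', (t1 + (6 + t)); split=> //.
  + by apply: ExecSeq x1 (ExecSeq c1 x2).
  + have : n * (timee e m + 3 + 8) <= m ^ w.+1 * (timee e m + 11).
      rewrite -addnA leq_mul2r (leq_trans (geq_minr _ _)) ?orbT //.
      exact: (bounded_agree sc a1 bd).
    by lia.
- move=> c1 IH1 c2 IH2 d vs s s0 /andP[w1 w2] sc sub bd ag.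
  have [s1 [t1 [x1 a1 p1 l1]]] := IH1 d vs s s0 w1 sc sub bd ag.
  have bd1 : bounded m s1.
    apply: (bounded_agree sc a1) => w; rewrite (den_scope _ w1) ?bg ?scope_bvar //.
    by case: ag => /(_ _ (scope_bvar w sc)) -> _; apply: bd.
  have [s2 [t2 [x2 a2 p2 l2]]] := IH2 d vs s1 _ w2 sc sub bd1 a1.
  exists s2, (t1 + t2); split=> //.
  + exact: ExecSeq x1 x2.
  + by move=> j jd; rewrite p2 // p1.
  + exact: leq_add.
- move=> e c1 IH1 c2 IH2 d vs s s0 /and3P[we w1 w2] sc sub bd ag.
  have [s1 [t1 [x1 v1 a1 p1 l1]]] := compe_ok d we sc bd.
  have bd1 := bounded_agree sc a1 bd.
  rewrite (ev_agree we sc ag) -v1.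
  case: ifP => c.
    have [s2 [t2 [x2 a2 p2 l2]]] := IH1 d vs s1 s0 w1 sc sub bd1 (agree_trans ag a1).
    exists s2, (t1 + (2 + t2)); split=> //.
    + by apply: ExecSeq x1 (ExecIfTrue _ _ x2).
    + by move=> j jd; rewrite p2 // p1.
    + by lia.
  have [s2 [t2 [x2 a2 p2 l2]]] := IH2 d vs s1 s0 w2 sc sub bd1 (agree_trans ag a1).
  exists s2, (t1 + (2 + t2)); split=> //.
  + by apply: ExecSeq x1 (ExecIfFalse _ _ x2); apply/eqP; rewrite -[_ == _]negbK; rewrite /= in c *; rewrite c.
  + by move=> j jd; rewrite p2 // p1.
  + by lia.
- move=> w x l c IH d vs s s0 /and4P[wl xv xt wc] sc sub bd ag.
  have [s1 [t1 [x1 v1 a1 p1 l1]]] := compe_ok d wl sc bd.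
  have [_ _ sc'] := sc.
  have c1 := clamp_ok w d sc (bounded_agree sc a1 bd) v1.
  have -> : minn (ev s0 l) (var s0 (bvar w)) = minn (ev s l) (var s1 (bvar w)).
    by rewrite (ev_agree wl sc ag); case: (agree_trans ag a1) => -> //; apply: scope_bvar.
  set n := minn _ _ in c1 *; set s2 := set_var _ _ _ in c1.
  pose sem i := foldl (fun s' i => den c (set_var s' x i)) s0 (iota 0 i).
  have semS i : sem i.+1 = den c (set_var (sem i) x i).
    by rewrite /sem -addn1 iotaD foldl_cat.
  have bsem i w' : var (sem i) (bvar w') = var s0 (bvar w').
    elim: i => // i IHi; rewrite semS (den_scope _ wc) ?bg ?inE ?scope_bvar ?orbT //=.
    by rewrite IHi; case: eqP => // e1; move: xv; rewrite -e1 scope_bvar.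
  pose I i s' := [/\ agree vs (sem i) s', var s' (tbase + d) = n &
    forall j, j < d -> var s' (tbase + j) = var s (tbase + j)].
  have [||i s5|||s' [t [x2 [g2' _ p2] l2]]] :=
    @exec_loop x d (compc c d.+1) n (timec c m) I s2.
  + exact: xt.
  + move=> i s3 s3' [[g h] vn p] g' h'; have tx j : tbase + j \in predC1 x.
      by rewrite inE; lia.
    split.
    * split=> [y yv|b j]; last by rewrite h h'.
      by rewrite g // g' // inE; apply: contraNneq xv => <-.
    * by rewrite -g' ?tx.
    * by move=> j jd; rewrite -g' ?tx // p.
  + by case.
  + move=> i s3 lt_in [g vn p] xi.
    have bd3 : bounded m s3.
      move=> w'; case: g => g _; rewrite -g ?scope_bvar // bsem.
      by case: ag => /(_ _ (scope_bvar w' sc)) -> _; apply: bd.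
    have ag3 : agree (x :: vs) (set_var (sem i) x i) s3.
      case: g => g h; split=> [y|b j] /=; last exact: h.
      rewrite inE; case: eqP => [-> _|_ /= yv]; last exact: g.
      by rewrite xi.
    have [y yv|s4 [t4 [x4 a4 p4 l4]]] := IH d.+1 (x :: vs) s3 _ wc (scope_cons sc xt) _ bd3 ag3.
      by rewrite inE (sub y yv) orbT.
    exists s4, t4; split=> //.
    * split; rewrite ?semS.
      - by case: a4 => g4 h4; split=> // y yv; apply: g4; rewrite inE yv orbT.
      - by rewrite p4 // .
      - by move=> j jd; rewrite p4 ?p //; lia.
    * case: a4 => <-; last by rewrite inE eqxx.
      rewrite (den_scope _ wc) ?inE ?eqxx /= ?eqxx //.
      by apply: contra xv => /sub.
  + split=> /=.
    * have [g h] := agree_trans ag a1; split=> [y yv|b j] /=; last by rewrite h.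
      by rewrite g //; have := sc' _ yv; case: eqP => [?|_]; lia.
    * by rewrite eqxx.
    * by move=> j jd; rewrite -p1 //; case: eqP => [?|_]; lia.
  exists s', (t1 + (6 + t)); split=> //.
  + by apply: ExecSeq x1 (ExecSeq c1 x2).
  + have : n * (timec c m + 8) <= m ^ w.+1 * (timec c m + 8).
      rewrite leq_mul2r (leq_trans (geq_minr _ _)) ?orbT //.
      exact: (bounded_agree sc a1 bd).
    by lia.
Qed.

(** * Frame and loop rules for commands *)

Fixpoint wvars (c : cmd) : seq nat :=
  match c with
  | CSkip | CPut _ _ _ | CFill _ _ _ _ _ => [::]
  | CSet x _ => [:: x]
  | CSeq c1 c2 | CIf _ c1 c2 => wvars c1 ++ wvars c2
  | CFor _ x _ c1 => x :: wvars c1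
  end.

Fixpoint warrs (c : cmd) : seq nat :=
  match c with
  | CSkip | CSet _ _ => [::]
  | CPut a _ _ | CFill _ a _ _ _ => [:: a]
  | CSeq c1 c2 | CIf _ c1 c2 => warrs c1 ++ warrs c2
  | CFor _ _ _ c1 => warrs c1
  end.

Lemma frame_var c s x : x \notin wvars c -> var (den c s) x = var s x.
Proof.
elim: c s => //= [y e|c1 IH1 c2 IH2|e c1 IH1 c2 IH2|w y l c IH] s.
- by rewrite inE => /negPf->.
- by rewrite mem_cat => /norP[x1 x2]; rewrite IH2 // IH1.
- by rewrite mem_cat => /norP[x1 x2]; case: ifP => _; [apply: IH1|apply: IH2].
- rewrite inE => /norP[/negPf xy xc]; move: (iota _ _) => r.
  by elim: r s => //= i r IHr s; rewrite IHr IH //= xy.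
Qed.

Lemma frame_arr c s a i : a \notin warrs c -> arr (den c s) a i = arr s a i.
Proof.
elim: c s => //= [b e1 e2|w b y l e|c1 IH1 c2 IH2|e c1 IH1 c2 IH2|w y l c IH] s.
- by rewrite inE => /negPf->.
- by rewrite inE => /negPf->.
- by rewrite mem_cat => /norP[x1 x2]; rewrite IH2 // IH1.
- by rewrite mem_cat => /norP[x1 x2]; case: ifP => _; [apply: IH1|apply: IH2].
- by move=> ac; move: (iota _ _) => r; elim: r s => //= j r IHr s; rewrite IHr IH.
Qed.

Lemma den_for (I : nat -> store -> Prop) w x l c s n :
  minn (ev s l) (var s (bvar w)) = n -> I 0 s ->
  (forall i s', i < n -> I i s' -> I i.+1 (den c (set_var s' x i))) ->
  I n (den (CFor w x l c) s).
Proof.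
move=> /= -> I0 step.
suff H k : k <= n -> I k (foldl (fun s' i => den c (set_var s' x i)) s (iota 0 k)).
  exact: H.
elim: k => [//|k IH] kn; rewrite -addn1 iotaD foldl_cat add0n /= addn1.
by apply: step => //; apply: IH; apply: ltnW.
Qed.

Definition ENot e := EIf e (ECst 0) (ECst 1).
Definition EAnd e1 e2 := EIf e1 (EIf e2 (ECst 1) (ECst 0)) (ECst 0).
Definition EOr e1 e2 := EIf e1 (ECst 1) (EIf e2 (ECst 1) (ECst 0)).
Definition ELt e1 e2 := EIf (ESub e2 e1) (ECst 1) (ECst 0).
Definition EEq e1 e2 := ENot (EAdd (ESub e1 e2) (ESub e2 e1)).

Lemma ev_not s e : ev s (ENot e) = (ev s e == 0) :> nat.
Proof. by rewrite /=; case: (ev s e). Qed.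

Lemma ev_and s e1 e2 : ev s (EAnd e1 e2) = (ev s e1 != 0) && (ev s e2 != 0) :> nat.
Proof. by rewrite /=; case: (ev s e1 == 0); case: (ev s e2 == 0). Qed.

Lemma ev_or s e1 e2 : ev s (EOr e1 e2) = (ev s e1 != 0) || (ev s e2 != 0) :> nat.
Proof. by rewrite /=; case: (ev s e1 == 0); case: (ev s e2 == 0). Qed.

Lemma ev_lt s e1 e2 : ev s (ELt e1 e2) = (ev s e1 < ev s e2) :> nat.
Proof. by rewrite /= subn_eq0 -ltnNge; case: ltnP. Qed.

Lemma ev_eq s e1 e2 : ev s (EEq e1 e2) = (ev s e1 == ev s e2) :> nat.
Proof. by rewrite /EEq ev_not /= addn_eq0 !subn_eq0 -eqn_leq. Qed.

Lemma ev_sum s w x l e : ev s (ESum w x l e) =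
  \sum_(i < minn (ev s l) (var s (bvar w))) ev (set_var s x i) e.
Proof. by []. Qed.

Lemma ev_if s e0 e1 e2 :
  ev s (EIf e0 e1 e2) = if ev s e0 != 0 then ev s e1 else ev s e2.
Proof. by []. Qed.

Lemma ev_var s x : ev s (EVar x) = var s x. Proof. by []. Qed.
Lemma ev_cst s n : ev s (ECst n) = n. Proof. by []. Qed.
Lemma ev_get s a e : ev s (EGet a e) = arr s a (ev s e). Proof. by []. Qed.
Lemma ev_add s e1 e2 : ev s (EAdd e1 e2) = ev s e1 + ev s e2. Proof. by []. Qed.
Lemma ev_sub s e1 e2 : ev s (ESub e1 e2) = ev s e1 - ev s e2. Proof. by []. Qed.

Lemma var_set s x v y : var (set_var s x v) y = if y == x then v else var s y.
Proof. by []. Qed.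

Lemma arr_set s x v a i : arr (set_var s x v) a i = arr s a i.
Proof. by []. Qed.

Lemma b2n_neq0 (b : bool) : (b != 0 :> nat) = b.
Proof. by case: b. Qed.

Lemma fill_in s w a x l i e : i < ev s l -> i < var s (bvar w) ->
  arr (den (CFill w a x l e) s) a i = ev (set_var s x i) e.
Proof. by move=> il iw; rewrite /= eqxx leq_min il iw. Qed.

Lemma fill_out s w a x l e b i : b != a ->
  arr (den (CFill w a x l e) s) b i = arr s b i.
Proof. by move=> /negPf /= ->. Qed.

Lemma fill_var s w a x l e : var (den (CFill w a x l e) s) = var s.
Proof. by []. Qed.

Lemma den_seq c1 c2 s : den (CSeq c1 c2) s = den c2 (den c1 s).
Proof. by []. Qed.

Lemma den_set x e s : den (CSet x e) s = set_var s x (ev s e).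
Proof. by []. Qed.

Lemma den_put a e1 e2 s : den (CPut a e1 e2) s = set_arr s a (ev s e1) (ev s e2).
Proof. by []. Qed.

Lemma den_if e c1 c2 s :
  den (CIf e c1 c2) s = if ev s e != 0 then den c1 s else den c2 s.
Proof. by []. Qed.

Lemma arr_put s a i v b j :
  arr (set_arr s a i v) b j = if (b == a) && (j == i) then v else arr s b j.
Proof. by []. Qed.

Definition evE := (ev_not, ev_and, ev_or, ev_lt, ev_eq, ev_if, ev_var, ev_cst,
  ev_get, ev_add, ev_sub, arr_set, b2n_neq0).

(** * Numberings of the states of a system *)

(** The condition of [is_table], with the numbering made explicit and the table given as a function
    such as an array. *)
Definition rep (Y : fdds) (e : Y -> nat) (n : nat) (f : nat -> nat) : Prop :=
  [/\ injective e, forall y, e y < n, #|Y| = n & forall y, f (e y) = e (next y)].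

Section Rep.
Variables (Y : fdds) (e : Y -> nat) (n : nat) (f : nat -> nat).
Hypothesis r : rep e n f.

Lemma rep_inj : injective e. Proof. by case: r. Qed.
Lemma rep_lt y : e y < n. Proof. by case: r. Qed.
Lemma rep_card : #|Y| = n. Proof. by case: r. Qed.
Lemma rep_next y : f (e y) = e (next y). Proof. by case: r. Qed.

Lemma rep_onto i : i < n -> exists y, e y = i.
Proof.
move=> lt; pose h y : 'I_n := Ordinal (rep_lt y).
have hi : injective h by move=> y z /(congr1 val)/rep_inj.
have /codomP[y ey] : Ordinal lt \in codom h.
  by rewrite inj_card_onto // card_ord rep_card.
by exists y; have := congr1 val ey.
Qed.

Lemma rep_sum (g : nat -> nat) : \sum_(i < n) g i = \sum_y g (e y).
Proof.
pose h y : 'I_n := Ordinal (rep_lt y).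
have hi : injective h by move=> y z /(congr1 val)/rep_inj.
rewrite (reindex h) //; apply: onW_bij.
by apply: inj_card_bij => //; rewrite card_ord rep_card.
Qed.

Lemma rep_eq y z : (e y == e z) = (y == z).
Proof. exact: (inj_eq rep_inj). Qed.

End Rep.

Lemma sum_if (T : finType) (P Q : pred T) (F : T -> nat) :
  \sum_(x | P x) (if Q x then F x else 0) = \sum_(x | P x && Q x) F x.
Proof. by rewrite big_mkcondr. Qed.

(** * The algorithm *)

(* Memory layout.  Variables: 0 |A|, 1 |B|, 2 and 3 the loop bounds, 5 the size
   of the system being ranked, 9 the verdict on the current candidate, 10 and 11
   the success flag and the size of the answer, 12 and 13 the size and the root
   of the candidate, 14 the size of its product with A; loop variables start
   at 20, with 30 the guess for w and 31 the guess for p - 1.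
   Arrays: 0 and 1 the tables of A and B, 2 and 3 the table and the classes of
   the ranked system, 17 the table of the candidate, 18 the keys, 19 the greedy
   choices, 22 and 23 the orbits in A and B, 24 the depths, 26 and 27 the
   numbering of the candidate and its inverse, 28 the answer. *)

(** Powers by repeated addition: a multiple is a sum of equal terms. The last entry of array 7 is
    [Wmax]. *)
Definition p_pow : cmd :=
  CSeq (CSet 7 (ECst 1))
  (CFor true 20 (EAdd (EVar 5) (ECst 2))
    (CSeq (CPut 7 (EVar 20) (EVar 7))
          (CSet 7 (ESum true 21 (EAdd (EVar 5) (ECst 1)) (EVar 7))))).

Definition e_lex : pexpr :=
  EIf (ELt (EGet 4 (EVar 22)) (EGet 4 (EVar 21))) (ECst 1)
      (EAnd (EEq (EGet 4 (EVar 22)) (EGet 4 (EVar 21)))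
            (ELt (EGet 5 (EVar 22)) (EGet 5 (EVar 21)))).

Lemma e_lexE s : ev s e_lex = lexlt (arr s 4 (var s 22)) (arr s 5 (var s 22))
  (arr s 4 (var s 21)) (arr s 5 (var s 21)) :> nat.
Proof.
rewrite /e_lex ev_if ev_and ev_eq !ev_lt !b2n_neq0 !ev_get !ev_var /lexlt.
by case: ltnP.
Qed.

(** Classes are updated from the old weights before these are replaced; variable 6 holds the offset
    of the level, a multiple of [Wmax]. Array 6 is a buffer, since a fill must not read its own
    target. *)
Definition p_level : cmd :=
  CSeq (CFill true 6 21 (EVar 5)
    (EIf (EGet 4 (EVar 21)) (EAdd (EVar 6) (EGet 4 (EVar 21))) (EGet 3 (EVar 21))))
  (CSeq (CFill true 3 21 (EVar 5) (EGet 6 (EVar 21)))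
  (CSeq (CSet 6 (EAdd (EVar 6) (EGet 7 (EAdd (EVar 5) (ECst 1)))))
  (CSeq (CFill true 5 21 (EVar 5)
    (ESum true 22 (EVar 5)
      (EIf (EEq (EGet 2 (EVar 22)) (EVar 21)) (EGet 4 (EVar 22)) (ECst 0))))
  (CSeq (CFill true 6 21 (EVar 5)
    (EIf (EGet 5 (EVar 21)) (EGet 7 (ESum true 22 (EVar 5) e_lex)) (ECst 0)))
  (CFill true 4 21 (EVar 5) (EGet 6 (EVar 21))))))).

Definition p_cls : cmd :=
  CSeq p_pow
  (CSeq (CFill true 4 20 (EVar 5) (ECst 1))
  (CSeq (CFill true 3 20 (EVar 5) (ECst 0))
  (CSeq (CSet 6 (ECst 0))
  (CFor true 20 (EAdd (EVar 5) (ECst 1)) p_level)))).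

Lemma p_pow_ok s : var s 5 + 2 <= var s 3 ->
  forall i, i <= (var s 5).+1 -> arr (den p_pow s) 7 i = (var s 5).+1 ^ i.
Proof.
move=> le i il; pose l := var s 5.
pose I k s' := [/\ var s' 5 = l, var s' 3 = var s 3, var s' 7 = l.+1 ^ k &
  forall i, i < k -> arr s' 7 i = l.+1 ^ i].
have [] // : I l.+2 (den p_pow s); last by move=> _ _ _ /(_ i); apply.
rewrite /p_pow den_seq; apply: den_for.
- by rewrite !evE /= addn2; apply/minn_idPl; rewrite -addn2.
- by split.
- move=> k s' kl [h5 h3 h7 h]; split=> //.
    rewrite den_seq den_set [ev _ (ESum _ _ _ _)]/= /= h5 h3 h7 addn1.
    rewrite (minn_idPl _); last by move: le; rewrite -/l; lia.
    by rewrite sum_nat_const card_ord expnS.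
  move=> j; rewrite ltnS leq_eqVlt /= => /predU1P[->|jk]; first by rewrite !eqxx h7.
  by rewrite (ltn_eqF jk) h.
Qed.

Section Cls.
Variables (Y : fdds) (e : Y -> nat).

Definition level_inv (s0 : store) (k : nat) (s : store) : Prop :=
  [/\ var s 5 = #|Y|, var s 3 = var s0 3, var s 6 = k * Wmax Y,
      forall i, arr s 2 i = arr s0 2 i &
  [/\ forall i, i <= #|Y|.+1 -> arr s 7 i = #|Y|.+1 ^ i,
      forall y, arr s 4 (e y) = W k y & forall y, arr s 3 (e y) = cls_upto k y]].

Lemma p_level_ok s0 k s : rep e #|Y| (arr s0 2) -> #|Y| <= var s0 3 ->
  level_inv s0 k s -> level_inv s0 k.+1 (den p_level s).
Proof.
move=> r le [h5 h3 h6 h2 [h7 h4 hc]].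
have lt := rep_lt r.
have mn : minn #|Y| (var s0 3) = #|Y| by apply/minn_idPl.
have lv s' y : var s' 5 = #|Y| -> e y < ev s' (EVar 5) by rewrite /= => ->.
have lk s' y : var s' 3 = var s0 3 -> e y < var s' (bvar true).
  by move=> e3; apply: leq_trans (lt y) _; rewrite /bvar e3.
rewrite /p_level !den_seq.
set s1 := den (CFill _ 6 _ _ _) s.
have s1E y : arr s1 6 (e y) = cls_upto k.+1 y.
  rewrite /s1 (fill_in _ _ _ (lv _ _ h5) (lk _ _ h3)) /= h4 hc h6.
  by case: eqP.
have s1a b i : b != 6 -> arr s1 b i = arr s b i by apply: fill_out.
have s1v : var s1 = var s by []; clearbody s1.
set s2 := den (CFill _ 3 _ _ _) s1.
have s2E y : arr s2 3 (e y) = cls_upto k.+1 y.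
  by rewrite /s2 (fill_in _ _ _ (lv s1 _ _) (lk s1 _ _)) ?s1v //= s1E.
have s2a b i : b != 3 -> arr s2 b i = arr s1 b i by apply: fill_out.
have s2v : var s2 = var s by []; clearbody s2.
set s3 := den (CSet _ _) s2.
have s3v x : var s3 x = if x == 6 then k.+1 * Wmax Y else var s x.
  rewrite /s3 den_set var_set; case: eqP => _; last by rewrite s2v.
  rewrite ev_add ev_get ev_add !ev_var s2a // s1a // s2v h6 h5.
  by rewrite addn1 h7 // mulSn addnC.
have s3a b i : b != 6 -> b != 3 -> arr s3 b i = arr s b i.
  by move=> b6 b3; rewrite /s3 den_set arr_set s2a // s1a.
have s3c y : arr s3 3 (e y) = cls_upto k.+1 y by rewrite /s3 den_set arr_set s2E.
clearbody s3.
have v5 : var s3 5 = #|Y| by rewrite s3v.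
have v3 : var s3 3 = var s0 3 by rewrite s3v.
set s4 := den (CFill _ 5 _ _ _) s3.
have s4E y : arr s4 5 (e y) = predsum (W k) y.
  rewrite /s4 (fill_in _ _ _ (lv _ _ v5) (lk _ _ v3)).
  rewrite ev_sum [ev _ _]v5 [var _ (bvar _)]v3 mn.
  under eq_bigr => i _.
    rewrite ev_if ev_eq b2n_neq0 /= !s3a // h2.
    over.
  rewrite (rep_sum r (fun i => if arr s0 2 i == e y then arr s 4 i else 0)) sum_if.
  by apply: eq_big => u; rewrite (rep_next r) ?(rep_eq r) // h4.
have s4a b i : b != 5 -> arr s4 b i = arr s3 b i by apply: fill_out.
have s4v : var s4 = var s3 by []; clearbody s4.
set s5 := den (CFill _ 6 _ _ _) s4.
have s5E y : arr s5 6 (e y) = W k.+1 y.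
  rewrite /s5 (fill_in _ _ _ (lv s4 _ _) (lk s4 _ _)) ?s4v //.
  rewrite ev_if ev_get ev_var var_set eqxx arr_set s4E W_S /wstep.
  case: eqP => //= _; rewrite -/e_lex s4a // s3a // s4v v5 [X in minn _ X]v3 mn h7; last first.
    rewrite (rep_sum r (fun i => ev (set_var (set_var s4 21 (e y)) 22 i) e_lex)).
    apply: leq_trans (_ : \sum_(z : Y) 1 <= _); last by rewrite sum1_card.
    by apply: leq_sum => z _; rewrite e_lexE; case: lexlt.
  rewrite (rep_sum r (fun i => ev (set_var (set_var s4 21 (e y)) 22 i) e_lex)).
  congr (_ ^ _); apply: eq_bigr => z _; rewrite e_lexE /=.
  by rewrite !s4E !s4a // !s3a // !h4.
have s5a b i : b != 6 -> arr s5 b i = arr s4 b i by apply: fill_out.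
have s5v : var s5 = var s3 by rewrite -s4v.
clearbody s5.
set s6 := den (CFill _ 4 _ _ _) s5.
have s6E y : arr s6 4 (e y) = W k.+1 y.
  by rewrite /s6 (fill_in _ _ _ (lv s5 _ _) (lk s5 _ _)) ?s5v //= s5E.
have s6a b i : b != 4 -> arr s6 b i = arr s5 b i by apply: fill_out.
have s6v : var s6 = var s3 by rewrite -s5v.
clearbody s6.
split.
- by rewrite s6v.
- by rewrite s6v.
- by rewrite s6v s3v.
- by move=> i; rewrite s6a // s5a // s4a // s3a.
split=> [i il|y|y].
- by rewrite s6a // s5a // s4a // s3a // h7.
- exact: s6E.
- by rewrite s6a // s5a // s4a // s3c.
Qed.

Lemma p_cls_ok s : var s 5 = #|Y| -> rep e #|Y| (arr s 2) -> #|Y| + 2 <= var s 3 ->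
  forall y, arr (den p_cls s) 3 (e y) = cls y.
Proof.
move=> v5 r le.
have lt y : e y < #|Y| by apply: rep_lt r y.
suff [_ _ _ _ [_ _ //]] : level_inv s #|Y|.+1 (den p_cls s).
rewrite /p_cls !den_seq.
set s1 := den p_pow s.
have s1P i : i <= #|Y|.+1 -> arr s1 7 i = #|Y|.+1 ^ i.
  by move=> il; rewrite /s1 p_pow_ok ?v5.
have s1v x : x \notin [:: 7; 20] -> var s1 x = var s x.
  by move=> xn; rewrite /s1 frame_var //; apply: contra xn; rewrite !inE => /or3P[]->; rewrite ?orbT.
have s1a a i : a != 7 -> arr s1 a i = arr s a i.
  by move=> an; rewrite /s1 frame_arr //= inE.
have mn : minn #|Y| (var s 3) = #|Y| by apply/minn_idPl; lia.
apply: den_for.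
- rewrite ev_add ev_cst ev_var addn1 [var _ 5]s1v // v5 [var _ (bvar _)]s1v //.
  by apply/minn_idPl; rewrite /bvar; lia.
- have lv s' y : var s' 5 = #|Y| -> e y < ev s' (EVar 5) by rewrite /= => ->.
  have lk s' y : var s' 3 = var s 3 -> e y < var s' (bvar true).
    by move=> e3; rewrite /bvar e3; have := lt y; lia.
  have v5' := s1v 5 isT; rewrite v5 in v5'; have v3' := s1v 3 isT.
  split=> //.
  + by move=> i; rewrite den_set arr_set !fill_out // s1a.
  split.
  + by move=> i il; rewrite den_set arr_set !fill_out // s1P.
  + by move=> y; rewrite den_set arr_set fill_out // (fill_in _ _ _ (lv s1 _ v5') (lk s1 _ v3')).
  + move=> y; rewrite den_set arr_set.
    set s2 := den (CFill _ 4 _ _ _) s1.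
    by rewrite (fill_in _ _ _ (lv s2 _ v5') (lk s2 _ v3')).
- by move=> k s' _ H; apply: p_level_ok => //; lia.
Qed.

End Cls.

(** * Table and classes of the sum of A X and B *)

(** The pair [(a, x)] gets the number [a * #|X| + x], and the states of [B] come after all pairs.
    Arrays 8 and 9 decode a number into quotient and remainder by [#|X|]. *)
Definition p_sys : cmd :=
  CSeq (CSet 14 (ESum false 20 (EVar 0) (EVar 12)))
  (CSeq (CSet 5 (EAdd (EVar 14) (EVar 1)))
  (CSeq (CFill true 8 20 (EVar 14)
    (ESum false 21 (EVar 0)
      (ELt (ESum false 22 (EVar 21) (EVar 12))
           (ESub (EAdd (EVar 20) (ECst 1)) (EVar 12)))))
  (CSeq (CFill true 9 20 (EVar 14)
    (ESub (EVar 20) (ESum false 21 (EGet 8 (EVar 20)) (EVar 12))))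
  (CSeq (CFill true 2 20 (EVar 5)
    (EIf (ELt (EVar 20) (EVar 14))
      (EAdd (ESum false 21 (EGet 0 (EGet 8 (EVar 20))) (EVar 12))
            (EGet 17 (EGet 9 (EVar 20))))
      (EAdd (EVar 14) (EGet 1 (ESub (EVar 20) (EVar 14))))))
  p_cls)))).

(* The sizes and bounds that the main program never changes. *)
Definition sized (na nb : nat) (s : store) : Prop :=
  [/\ var s 0 = na, var s 1 = nb, var s 2 = na + nb + 2
    & var s 3 = (na + nb + 2) * (na + nb + 2)].

Lemma ev_mul s x e1 e2 : x != e2 -> ev s (ESum false x e1 (EVar e2)) = minn (ev s e1) (var s 2) * var s e2.
Proof.
move=> /negPf xe; rewrite ev_sum.
under eq_bigr => i _ do rewrite ev_var var_set eq_sym xe.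
by rewrite sum_nat_const card_ord.
Qed.

(** Division by counting multiples: [k * q < i.+1 - q] says that [k.+1 * q <= i], also when the
    subtraction is truncated. *)
Lemma sum_divn i n q : i < n * q -> \sum_(k < n) (k * q < i.+1 - q) = i %/ q.
Proof.
move=> lt; have q0 : 0 < q by case: q lt => //; rewrite muln0.
have E (k : nat) : (k * q < i.+1 - q) = (k < i %/ q).
  by rewrite ltn_subRL addnC -mulSnr ltnS leq_divRL.
under eq_bigr => k _ do rewrite E.
have d : i %/ q <= n by apply: ltnW; rewrite ltn_divLR.
rewrite -[RHS]card_ord -[RHS]sum1_card (big_ord_widen _ (fun=> 1) d) [RHS]big_mkcond.
by apply: eq_bigr => k _; case: ltnP.
Qed.

Section Sys.
Variables (A B X : fdds) (eA : A -> nat) (eB : B -> nat) (eX : X -> nat).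

Definition esum (w : fdds_add (fdds_mul A X) B) : nat :=
  match w with
  | inl (a, x) => eA a * #|X| + eX x
  | inr b => #|A| * #|X| + eB b
  end.

Lemma pair_lt i j n q : i < n -> j < q -> i * q + j < n * q.
Proof. by move=> lin ljq; have := leq_mul2r q i.+1 n; rewrite lin orbT mulSn; lia. Qed.

Lemma pair_div i j q : j < q -> (i * q + j) %/ q = i.
Proof. by move=> jq; rewrite divnMDl ?(leq_trans _ jq) // divn_small // addn0. Qed.

Lemma p_sys_ok s : sized #|A| #|B| s -> var s 12 = #|X| ->
  rep eA #|A| (arr s 0) -> rep eB #|B| (arr s 1) -> rep eX #|X| (arr s 17) ->
  #|X| <= #|B| ->
  let s' := den p_sys s in
  [/\ rep esum (#|A| * #|X| + #|B|) (arr s' 2), var s' 5 = #|A| * #|X| + #|B|,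
      var s' 14 = #|A| * #|X| & forall w, arr s' 3 (esum w) = cls w].
Proof.
move=> [h0 h1 h2 h3] h12 rA rB rX XB s'; rewrite {}/s'.
have ltA := rep_lt rA; have ltB := rep_lt rB; have ltX := rep_lt rX.
rewrite /p_sys 5!den_seq.
have mA : minn #|A| (#|A| + #|B| + 2) = #|A| by apply/minn_idPl; lia.
set s1 := den (CSet 14 _) s.
have s1v x : var s1 x = if x == 14 then #|A| * #|X| else var s x.
  by rewrite /s1 den_set var_set ev_mul // h12 h2 ev_var h0 mA.
have s1a a i : arr s1 a i = arr s a i by [].
clearbody s1.
set s2 := den (CSet 5 _) s1.
have s2v x : var s2 x = if x == 5 then #|A| * #|X| + #|B| else var s1 x.
  by rewrite /s2 den_set var_set ev_add !ev_var !s1v /= h1.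
have s2a a i : arr s2 a i = arr s a i by apply: s1a.
clearbody s2.
have v14 : var s2 14 = #|A| * #|X| by rewrite s2v s1v.
have v5 : var s2 5 = #|A| * #|X| + #|B| by rewrite s2v s1v.
have v12 : var s2 12 = #|X| by rewrite s2v s1v.
have v0 : var s2 0 = #|A| by rewrite s2v s1v.
have v2 : var s2 2 = #|A| + #|B| + 2 by rewrite s2v s1v.
have v3 : var s2 3 = (#|A| + #|B| + 2) * (#|A| + #|B| + 2) by rewrite s2v s1v.
have leK : #|A| * #|X| + #|B| + 2 <= var s2 3.
  have := leq_mul (leqnn #|A|) XB; rewrite v3; move: (#|A| * #|X|) => ax; nia.
set s3 := den (CFill _ 8 _ _ _) s2.
have s3E i : i < #|A| * #|X| -> arr s3 8 i = i %/ #|X|.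
  move=> il; rewrite /s3 fill_in ?ev_var ?v14 //; last by rewrite /bvar; lia.
  rewrite ev_sum [ev _ (EVar 0)]v0 [var _ (bvar _)]v2 mA.
  rewrite -(sum_divn il); apply: eq_bigr => k _.
  rewrite ev_lt ev_mul // ev_sub ev_add !ev_var !var_set /= v12 v2 addn1.
  by rewrite (minn_idPl _) // -addnA (leq_trans (ltnW (ltn_ord k))) ?leq_addr.
have s3v : var s3 = var s2 by [].
have s3a a i : a != 8 -> arr s3 a i = arr s a i by move=> a8; rewrite fill_out.
clearbody s3.
set s4 := den (CFill _ 9 _ _ _) s3.
have s4E i : i < #|A| * #|X| -> arr s4 9 i = i %% #|X|.
  move=> il; rewrite /s4 fill_in ?ev_var ?s3v ?v14 //; last by rewrite /bvar; lia.
  rewrite ev_sub ev_mul // !ev_get !ev_var !var_set !arr_set eqxx /= s3v v12 v2 s3E //.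
  have X0 : 0 < #|X| by case: #|X| il => //; rewrite muln0.
  have := divn_eq i #|X|; have : i %/ #|X| < #|A| by rewrite ltn_divLR.
  move: (i %/ _) (i %% _) => d m dA; rewrite (minn_idPl _); lia.
have s4v : var s4 = var s2 by rewrite -s3v.
have s4D i : i < #|A| * #|X| -> arr s4 8 i = i %/ #|X| by move=> il; rewrite fill_out // s3E.
have s4a a i : a \notin [:: 8; 9] -> arr s4 a i = arr s a i.
  by rewrite !inE => /norP[a8 a9]; rewrite fill_out // s3a.
clearbody s4.
set s5 := den (CFill _ 2 _ _ _) s4.
have esum_lt w : esum w < #|A| * #|X| + #|B|.
  case: w => [[a x]|b] /=; last by rewrite ltn_add2l.
  by apply: leq_trans (leq_addr _ _); apply: pair_lt.
have s5E w : arr s5 2 (esum w) = esum (next w).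
  have lw := esum_lt w.
  rewrite /s5 fill_in ?ev_var ?s4v ?v5 //; last by rewrite /bvar; lia.
  rewrite ev_if ev_lt b2n_neq0 !ev_add !ev_mul // !ev_get ev_sub !ev_var !var_set !arr_set /=.
  rewrite s4v v14 v12 v2; case: w lw => [[a x]|b] /= lw.
    have lp := pair_lt (ltA a) (ltX x); rewrite lp s4D // s4E // !s4a //.
    rewrite pair_div // modnMDl modn_small // (rep_next rA) (rep_next rX).
    by rewrite (minn_idPl _) // -addnA (leq_trans (ltnW (ltA _))) ?leq_addr.
  by rewrite ltnNge leq_addr /= addKn s4a // (rep_next rB).
have s5v : var s5 = var s2 by rewrite -s4v.
clearbody s5.
have einj : injective esum.
  move=> [[a x]|b] [[a' x']|b'] /=.
  - move=> e; have ea : eA a = eA a' by rewrite -(pair_div (eA a) (ltX x)) e pair_div.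
    move: e; rewrite ea => /addnI/(rep_inj rX) ->.
    by rewrite (rep_inj rA ea).
  - by move=> e; have := pair_lt (ltA a) (ltX x); rewrite e ltnNge leq_addr.
  - by move=> e; have := pair_lt (ltA a') (ltX x'); rewrite -e ltnNge leq_addr.
  - by move=> /addnI/(rep_inj rB) ->.
have cardE : #|fdds_add (fdds_mul A X) B| = #|A| * #|X| + #|B|.
  by rewrite /= card_sum card_prod.
have r5 : rep esum #|fdds_add (fdds_mul A X) B| (arr s5 2).
  by split=> //; rewrite ?cardE.
have v5' : var s5 5 = #|fdds_add (fdds_mul A X) B| by rewrite s5v v5 cardE.
split.
- by split=> [|||y]; [exact: einj|exact: esum_lt|exact: cardE|rewrite frame_arr // s5E].
- by rewrite frame_var // s5v v5.
- by rewrite frame_var // s5v v14.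
- by move=> w; apply: (p_cls_ok v5' r5); rewrite cardE s5v; lia.
Qed.

End Sys.

(** * Programs for keys and greedy choices *)

(** [B] plays the candidate: its table is copied to array 17 and [p_sys] ranks the product of [A]
    and [B]. *)
Definition p_keys : cmd :=
  CSeq (CSet 12 (EVar 1))
  (CSeq (CFill false 17 20 (EVar 1) (EGet 1 (EVar 20)))
  (CSeq p_sys
  (CFill true 18 20 (EVar 14) (EGet 3 (EVar 20))))).

Definition e_idx (x y : pexpr) : pexpr := EAdd (ESum false 29 x (EVar 1)) y.

Definition e_rank : pexpr :=
  ESum false 23 (EVar 1)
    (EOr (ELt (EGet 18 (e_idx (EVar 20) (EVar 22))) (EGet 18 (e_idx (EVar 20) (EVar 23))))
         (EAnd (EEq (EGet 18 (e_idx (EVar 20) (EVar 23))) (EGet 18 (e_idx (EVar 20) (EVar 22))))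
               (ELt (EVar 23) (EVar 22)))).

(** Selection replaces sorting: the state with a given number of states before it is found as the
    only term of a sum that can be nonzero. *)
Definition e_kth : pexpr :=
  ESum false 22 (EVar 1) (EIf (EEq e_rank (EVar 21)) (EVar 22) (ECst 0)).

Definition e_have : pexpr :=
  ESum false 23 (EVar 1)
    (EIf (EEq (EGet 1 (EVar 23)) (EGet 1 (EVar 8)))
      (EEq (EGet 18 (e_idx (EVar 20) (EVar 23))) (EGet 18 (EVar 22))) (ECst 0)).

Definition e_need : pexpr :=
  ESum false 24 (EVar 0)
    (EIf (EEq (EGet 0 (EVar 24)) (EGet 0 (EVar 20)))
      (ESum false 23 (EVar 1)
        (EIf (EAnd (EEq (EGet 1 (EVar 23)) (EGet 1 (EVar 8)))
                   (EGet 19 (e_idx (EVar 20) (EVar 23))))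
          (EEq (EGet 18 (e_idx (EVar 24) (EVar 23))) (EGet 18 (EVar 22))) (ECst 0)))
      (ECst 0)).

Definition e_bad : pexpr :=
  ESum true 22 (ESum false 23 (EVar 0) (EVar 1)) (ELt e_have e_need).

(** The state is entered before the test, which concerns the enlarged set, and withdrawn if the test
    fails. *)
Definition p_try : cmd :=
  CSeq (CSet 8 e_kth)
  (CSeq (CPut 19 (e_idx (EVar 20) (EVar 8)) (ECst 1))
  (CIf e_bad (CPut 19 (e_idx (EVar 20) (EVar 8)) (ECst 0)) CSkip)).

Definition p_greedy : cmd :=
  CSeq (CFill true 19 20 (ESum false 21 (EVar 0) (EVar 1)) (ECst 0))
  (CFor false 20 (EVar 0) (CFor false 21 (EVar 1) p_try)).

Section Greedy.
Variables (A B : fdds) (eA : A -> nat) (eB : B -> nat).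
Let na := #|A|.
Let nb := #|B|.

Definition base (s : store) : Prop :=
  [/\ sized na nb s, rep eA na (arr s 0) & rep eB nb (arr s 1)].

Definition idx (a : A) (b : B) : nat := eA a * nb + eB b.

Definition keyed (s : store) : Prop :=
  base s /\ forall a b, arr s 18 (idx a b) = key a b.

Lemma base_frame s s' : base s ->
  (forall x, x <= 3 -> var s' x = var s x) ->
  (forall a i, a <= 1 -> arr s' a i = arr s a i) -> base s'.
Proof.
move=> [[h0 h1 h2 h3] [i1 l1 c1 n1] [i2 l2 c2 n2]] v a.
by split; split; rewrite ?v // => y; rewrite a.
Qed.

Lemma base_den c s : base s -> all (leq 4) (wvars c) -> all (leq 2) (warrs c) ->
  base (den c s).
Proof.
move=> b /allP v /allP a; apply: base_frame b _ _ => [x xl|x i xl].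
  by rewrite frame_var //; apply/negP => /v; lia.
by rewrite frame_arr //; apply/negP => /a; lia.
Qed.

Lemma p_keys_ok s : base s -> keyed (den p_keys s).
Proof.
move=> bs; split; first exact: base_den.
rewrite /p_keys 3!den_seq.
set s1 := den (CSet 12 _) s; have b1 : base s1 by apply: base_den.
have [[h0 h1 h2 h3] rA rB] := b1.
have ltA := rep_lt rA; have ltB := rep_lt rB.
have v12 : var s1 12 = nb by rewrite /s1 den_set var_set eqxx; case: bs => [[]].
clearbody s1.
set s2 := den (CFill false 17 _ _ _) s1; have b2 : base s2 by apply: base_den.
have a17 i : i < nb -> arr s2 17 i = arr s1 1 i.
  by move=> il; rewrite /s2 fill_in ?ev_var ?h1 //= /bvar h2; lia.
have v12' : var s2 12 = nb by [].
clearbody s2; have [sz2 rA2 rB2] := b2.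
have r17 : rep eB nb (arr s2 17).
  by case: rB => i l c n; split=> // y; rewrite a17 // n.
have [r3 v5 v14 h] := p_sys_ok sz2 v12' rA2 rB2 r17 (leqnn _).
have b3 : base (den p_sys s2) by apply: base_den.
move: (den p_sys s2) b3 r3 v5 v14 h => s3 [[g0 g1 g2 g3] _ _] _ _ v14 h a b.
have lp := pair_lt (ltA a) (ltB b).
rewrite fill_in ?ev_var ?v14 //; first exact: (h (inl (a, b))).
rewrite /bvar g3; apply: leq_trans lp _; rewrite -/na -/nb.
apply: leq_mul; rewrite -addnA ?leq_addr // addnCA leq_addr //.
Qed.

(** Decreasing keys with ties broken by number: a strict total order, so that the ranks enumerate
    [B]. *)
Definition before (a : A) (c d : B) : bool :=
  (key a d < key a c) || ((key a c == key a d) && (eB c < eB d)).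

Definition rk (a : A) (c : B) : nat := \sum_d before a d c.

Definition ordered (l : A -> seq B) : Prop := forall a, map (rk a) (l a) = iota 0 nb.

Hypothesis eBi : injective eB.

Lemma rk_lt a c d : (rk a c < rk a d) = before a c d.
Proof.
rewrite /rk (@rank_lt _ (before a)) // => [x|x y z|x y z]; rewrite /before; lia.
Qed.

Lemma rk_inj a : injective (rk a).
Proof.
move=> c d e; have := rk_lt a c d; have := rk_lt a d c; rewrite e ltnn /before.
by case: ltngtP => // _ /=; case: ltngtP => // /eBi.
Qed.

Lemma rk_bound a c : rk a c < nb.
Proof.
have bcc : before a c c = false by rewrite /before !ltnn andbF.
rewrite /rk (bigD1 c) //= bcc add0n /nb -sum1_card [ltnRHS](bigD1 c) //= add1n ltnS.
by apply: leq_sum => d _; case: before.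
Qed.

Lemma ordered_exists : exists l, ordered l.
Proof.
apply: (@fin_all_exists A (fun=> seq B) (fun a l => map (rk a) l = iota 0 nb)) => a.
have onto t : t < nb -> exists c, rk a c = t.
  move=> tl; pose h c : 'I_nb := Ordinal (rk_bound a c).
  have hi : injective h by move=> y z /(congr1 val)/rk_inj.
  have /codomP[y ey] : Ordinal tl \in codom h by rewrite inj_card_onto // card_ord.
  by exists y; have := congr1 val ey.
suff H n : n <= nb -> exists l, map (rk a) l = iota 0 n by apply: H.
elim: n => [|n IH] ln; first by exists [::].
have [l el] := IH (ltnW ln); have [c ec] := onto n ln.
by exists (rcons l c); rewrite map_rcons el ec -addn1 iotaD add0n cats1.
Qed.

Section Ordered.
Variable l : A -> seq B.
Hypothesis lo : ordered l.

Lemma ordered_uniq a : uniq (l a).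
Proof. by apply: (@map_uniq _ _ (rk a)); rewrite lo iota_uniq. Qed.

Lemma ordered_size a : size (l a) = nb.
Proof. by rewrite -(size_map (rk a)) lo size_iota. Qed.

Lemma ordered_all a u : u \in l a.
Proof.
have /subset_cardP : #|l a| = #|B|.
  by rewrite (card_uniqP (ordered_uniq a)) ordered_size.
by move=> /(_ (subset_predT _)) ->.
Qed.

Lemma ordered_sorted a : pairwise (fun u v => key a v <= key a u) (l a).
Proof.
have : pairwise ltn (map (rk a) (l a)).
  by rewrite lo -sorted_pairwise ?iota_ltn_sorted //; apply: ltn_trans.
rewrite pairwise_map; apply: sub_pairwise => u v /=; rewrite rk_lt /before.
by case: ltngtP.
Qed.

Lemma idxE s x y a b : base s -> ev s x = eA a -> ev s y = eB b ->
  ev s (e_idx x y) = idx a b.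
Proof.
move=> [[h0 h1 h2 h3] rA rB] ex ey; rewrite /e_idx ev_add ev_mul // h1 ex ey h2.
by rewrite (minn_idPl _) // -addnA (leq_trans (ltnW (rep_lt rA a))) ?leq_addr.
Qed.

Lemma keyE_get s x y a b : keyed s -> ev s x = eA a -> ev s y = eB b ->
  ev s (EGet 18 (e_idx x y)) = key a b.
Proof. by move=> [bs ks] ex ey; rewrite ev_get (idxE bs ex ey) ks. Qed.

Lemma sumA s x e : base s ->
  ev s (ESum false x (EVar 0) e) = \sum_(a : A) ev (set_var s x (eA a)) e.
Proof.
move=> [[h0 h1 h2 h3] rA rB]; rewrite ev_sum ev_var h0 (minn_idPl _).
  exact: (rep_sum rA (fun i => ev (set_var s x i) e)).
by rewrite /bvar h2 -addnA leq_addr.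
Qed.

Lemma sumB s x e : base s ->
  ev s (ESum false x (EVar 1) e) = \sum_(b : B) ev (set_var s x (eB b)) e.
Proof.
move=> [[h0 h1 h2 h3] rA rB]; rewrite ev_sum ev_var h1 (minn_idPl _).
  exact: (rep_sum rB (fun i => ev (set_var s x i) e)).
by rewrite /bvar h2 -addnA addnCA leq_addr.
Qed.

Lemma ev_area s x : base s -> x != 1 ->
  ev s (ESum false x (EVar 0) (EVar 1)) = na * nb /\ na * nb <= var s (bvar true).
Proof.
move=> [[h0 h1 h2 h3] _ _] x1; rewrite ev_mul // ev_var h0 h1 h2 /bvar h3; split.
  by rewrite (minn_idPl _) // -addnA leq_addr.
apply: leq_mul; first by rewrite -addnA leq_addr.
by rewrite -addnA addnCA leq_addr.
Qed.

Lemma e_rankE s a c : keyed s -> var s 20 = eA a -> var s 22 = eB c ->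
  ev s e_rank = rk a c.
Proof.
move=> ks v20 v22; rewrite /e_rank sumB; last by case: ks.
apply: eq_bigr => d _; rewrite ev_or ev_and ev_eq !ev_lt !b2n_neq0.
have ks' : keyed (set_var s 23 (eB d)) := ks.
rewrite (@keyE_get _ (EVar 20) (EVar 22) a c ks' v20 v22).
rewrite (@keyE_get _ (EVar 20) (EVar 23) a d ks' v20 erefl).
by rewrite !ev_var !var_set /= v22.
Qed.

Lemma e_kthE s a c : keyed s -> var s 20 = eA a -> var s 21 = rk a c ->
  ev s e_kth = eB c.
Proof.
move=> ks v20 v21; rewrite /e_kth sumB; last by case: ks.
have E d : ev (set_var s 22 (eB d)) (EIf (EEq e_rank (EVar 21)) (EVar 22) (ECst 0)) =
    if d == c then eB d else 0.
  rewrite ev_if ev_eq b2n_neq0 (e_rankE (a := a) (c := d)) //.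
  by rewrite ev_var var_set /= v21 (inj_eq (@rk_inj a)).
under eq_bigr => d _ do rewrite E.
by rewrite -big_mkcond big_pred1_eq.
Qed.

Definition filled (s : store) (D : A -> {set B}) : Prop :=
  forall a b, arr s 19 (idx a b) = (b \in D a).

Lemma e_haveE s a z y : keyed s -> var s 20 = eA a -> var s 8 = eB z ->
  var s 22 = idx y.1 y.2 ->
  ev s e_have = \sum_(c | next c == next z) (key a c == key y.1 y.2).
Proof.
move=> ks v20 v8 v22; have [[_ rA rB] kk] := ks.
rewrite /e_have (sumB _ _ ks.1) [RHS]big_mkcond; apply: eq_bigr => c _.
set s' := set_var _ 23 _; have ks' : keyed s' := ks.
have K : ev s' (EGet 18 (e_idx (EVar 20) (EVar 23))) = key a c by apply: keyE_get.
rewrite ev_if !ev_eq b2n_neq0 K.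
by rewrite !ev_get !ev_var /= v8 v22 kk !(rep_next rB) (rep_eq rB); case: ifP.
Qed.

Lemma e_needE s a z y D : keyed s -> filled s D -> var s 20 = eA a -> var s 8 = eB z ->
  var s 22 = idx y.1 y.2 ->
  ev s e_need = \sum_(a2 | next a2 == next a)
    \sum_(c | (next c == next z) && (c \in D a)) (key a2 c == key y.1 y.2).
Proof.
move=> ks fs v20 v8 v22; have [[_ rA rB] kk] := ks.
rewrite /e_need (sumA _ _ ks.1) [RHS]big_mkcond; apply: eq_bigr => a2 _.
have c0 : (ev (set_var s 24 (eA a2)) (EEq (EGet 0 (EVar 24)) (EGet 0 (EVar 20))) != 0) =
    (next a2 == next a).
  by rewrite ev_eq b2n_neq0 /= v20 !(rep_next rA) (rep_eq rA).
rewrite ev_if c0; case: ifP => // _; rewrite (sumB _ _ (ks.1 : base (set_var s 24 (eA a2)))) [RHS]big_mkcond; apply: eq_bigr => c _.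
set s' := set_var _ 23 _; have ks' : keyed s' := ks.
have K : ev s' (EGet 18 (e_idx (EVar 24) (EVar 23))) = key a2 c by apply: keyE_get.
have N : ev s' (EGet 19 (e_idx (EVar 20) (EVar 23))) = (c \in D a).
  by rewrite ev_get (@idxE s' (EVar 20) (EVar 23) a c ks'.1 v20 erefl); apply: fs.
rewrite ev_if ev_and !ev_eq !b2n_neq0 K N b2n_neq0 !ev_get !ev_var /=.
by rewrite v8 v22 kk !(rep_next rB) (rep_eq rB); case: ifP.
Qed.

Lemma e_badE s a z D : keyed s -> filled s D -> var s 20 = eA a -> var s 8 = eB z ->
  (ev s e_bad != 0) = ~~ fits a (D a) (next z).
Proof.
move=> ks fs v20 v8; have [[[h0 h1 h2 h3] rA rB] kk] := ks.
have lim : minn (ev s (ESum false 23 (EVar 0) (EVar 1))) (var s (bvar true)) = na * nb.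
  have [-> le] := @ev_area s 23 ks.1 isT.
  exact/minn_idPl.
rewrite /e_bad ev_sum lim -lt0n; apply/sum_gt0P/forallPn.
  case=> i _; rewrite ev_lt lt0b => lt.
  have nb0 : 0 < nb by case: (posnP nb) i lt => // ->; rewrite muln0 => -[].
  have [a1 ea] : exists a1, eA a1 = i %/ nb by apply: (rep_onto rA); rewrite ltn_divLR.
  have [b1 eb] : exists b1, eB b1 = i %% nb by apply: (rep_onto rB); rewrite ltn_mod.
  have ei : i = idx a1 b1 :> nat by rewrite /idx ea eb -divn_eq.
  exists (a1, b1); rewrite -ltnNge; move: lt; rewrite ei.
  by rewrite (@e_haveE (set_var s 22 (idx a1 b1)) a z (a1, b1) ks v20 v8 erefl) (@e_needE (set_var s 22 (idx a1 b1)) a z (a1, b1) D ks fs v20 v8 erefl).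
case=> y; rewrite -ltnNge => lt.
have lp : idx y.1 y.2 < na * nb by apply: pair_lt; [apply: rep_lt rA _|apply: rep_lt rB _].
exists (Ordinal lp) => //; rewrite ev_lt lt0b.
by rewrite (@e_haveE (set_var s 22 (idx y.1 y.2)) a z y ks v20 v8 erefl) (@e_needE (set_var s 22 (idx y.1 y.2)) a z y D ks fs v20 v8 erefl).
Qed.

Definition upd (D : A -> {set B}) (a : A) (S : {set B}) (a' : A) : {set B} :=
  if a' == a then S else D a'.

Lemma p_try_ok s a z D : keyed s -> filled s D -> z \notin D a -> var s 20 = eA a -> var s 21 = rk a z ->
  keyed (den p_try s) /\ filled (den p_try s) (upd D a (gstep a (D a) z)).
Proof.
move=> ks fs zD v20 v21.
have kframe c s' : keyed s' -> all (leq 4) (wvars c) -> all (leq 2) (warrs c) ->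
    18 \notin warrs c -> keyed (den c s').
  move=> [b k] w1 w2 w3; split; first exact: base_den.
  by move=> a' b'; rewrite frame_arr.
split; first exact: kframe.
rewrite /p_try 2!den_seq.
have [bs _] := ks; have [_ rA rB] := bs; have ltB := rep_lt rB.
set s1 := den (CSet 8 _) s; have k1 : keyed s1 by apply: kframe.
have v8 : var s1 8 = eB z by rewrite /s1 den_set var_set eqxx (e_kthE (a := a) (c := z)).
have v20' : var s1 20 = eA a by [].
have f1 : filled s1 D by [].
clearbody s1.
have inj a' b' c' : (idx a' b' == idx a c') = (a' == a) && (b' == c').
  rewrite /idx; apply/eqP/andP => [e|[/eqP -> /eqP -> //]].
  have ea : eA a' = eA a by rewrite -(pair_div (eA a') (ltB b')) e pair_div.
  by move: e; rewrite ea => /addnI/(rep_inj rB) ->; rewrite (rep_inj rA ea) !eqxx.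
set s2 := den (CPut 19 _ _) s1; have k2 : keyed s2 by apply: kframe.
have i1 : ev s1 (e_idx (EVar 20) (EVar 8)) = idx a z by apply: idxE => //; case: k1.
have f2 : filled s2 (upd D a (z |: D a)).
  move=> a' b'; rewrite /s2 den_put i1 ev_cst arr_put inj f1 /upd.
  by case: (a' =P a) => [->|] //=; rewrite in_setU1; case: (b' == z).
have v8' : var s2 8 = eB z by [].
have v20'' : var s2 20 = eA a by [].
clearbody s2.
have i2 : ev s2 (e_idx (EVar 20) (EVar 8)) = idx a z by apply: idxE => //; case: k2.
rewrite den_if den_put ev_cst [den CSkip _]/=.
rewrite (e_badE k2 f2 v20'' v8') i2 {1}/upd eqxx /gstep.
case: ifP => [bad|/negbFE ok a' b']; last by rewrite f2 /upd ok.
(* Withdrawing [z] restores [D a] because [z] was not in it. *)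
move=> a' b'; rewrite arr_put inj f2 /upd (negPf bad).
case: (a' == a) => //=; rewrite in_setU1.
by case: (b' =P z) => [->|_] //=; rewrite (negPf zD).
Qed.

Lemma p_greedy_ok s : keyed s ->
  keyed (den p_greedy s) /\ filled (den p_greedy s) (fun a => greedy a (l a)).
Proof.
move=> ks; have kframe c s' : keyed s' -> all (leq 4) (wvars c) -> all (leq 2) (warrs c) ->
    18 \notin warrs c -> keyed (den c s').
  move=> [b k] w1 w2 w3; split; first exact: base_den.
  by move=> a' b'; rewrite frame_arr.
split; first exact: kframe.
rewrite /p_greedy den_seq.
set s1 := den (CFill _ 19 _ _ _) s; have k1 : keyed s1 by apply: kframe.
have [[[h0 h1 h2 h3] rA rB] _] := ks.
have f1 : filled s1 (fun=> set0).
  move=> a b; have lp := pair_lt (rep_lt rA a) (rep_lt rB b).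
  have [ar le] := @ev_area s 21 ks.1 isT.
  rewrite /s1 fill_in ?inE // ?ar //.
  exact: leq_trans lp le.
clearbody s1.
pose I i s' := keyed s' /\ filled s' (fun a => if eA a < i then greedy a (l a) else set0).
have [[g0 g1 g2 g3] rA1 rB1] := k1.1.
suff [_ h] : I na (den (CFor false 20 (EVar 0) (CFor false 21 (EVar 1) p_try)) s1).
  by move=> a b; rewrite h (rep_lt rA).
apply: den_for => [|//|i s2 lin [k2 f2]].
  by rewrite ev_var g0 /bvar g2; apply/minn_idPl; rewrite -addnA leq_addr.
have [a ea] := rep_onto rA lin; subst i.
pose J t s' := [/\ keyed s', var s' 20 = eA a & filled s'
  (upd (fun a' => if eA a' < eA a then greedy a' (l a') else set0) a
       (greedy a (take t (l a))))].
suff [k3 _ f3] : J nb (den (CFor false 21 (EVar 1) p_try) (set_var s2 20 (eA a))).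
  split=> // a' b; rewrite f3 /upd take_oversize ?ordered_size //.
  case: (a' =P a) => [->|/eqP ne]; first by rewrite leqnn.
  by rewrite ltnS (leq_eqVlt (eA a')) (rep_eq rA) (negPf ne).
have [[e0 e1 e2 e3] _ _] := k2.1.
apply: den_for => [||t s3 ltn [k3 v20 f3]].
- by rewrite ev_var var_set /= e1 /bvar e2; apply/minn_idPl; rewrite -addnA addnCA leq_addr.
- split=> // a' b; rewrite [LHS]f2 /upd take0; case: (a' =P a) => [->|//].
  by rewrite ltnn.
have [b0 _] : exists b0 : B, true by have [b0] := rep_onto rB ltn; exists b0.
pose z := nth b0 (l a) t.
have tl : t < size (l a) by rewrite ordered_size.
have rz : rk a z = t by rewrite -(nth_map b0 0) // lo nth_iota.
have zD : z \notin greedy a (take t (l a)).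
  apply/negP => /mem_greedy; have := ordered_uniq a.
  by rewrite -{1}(cat_take_drop t (l a)) (drop_nth b0 tl) cat_uniq /= => /and3P[_ /norP[/negP]].
have [] := @p_try_ok (set_var s3 21 t) a z _ k3 f3 _ v20 _.
- by rewrite /upd eqxx.
- by rewrite var_set eqxx rz.
move=> k4 f4; split=> //; first by rewrite frame_var.
move=> a' b; rewrite f4 /upd eqxx; case: (a' == a) => //.
by rewrite (take_nth b0 tl) /greedy foldl_rcons.
Qed.

Lemma greedy_InE (X : fdds) (phi : A * X -> B) :
  (forall p, eqv (phi p) (p : fdds_mul A X)) ->
  forall a b x c, cyclic a -> eqv b ((next a, x) : fdds_mul A X) ->
  \sum_(u | next u == b) ((u \in greedy a (l a)) && (key a u == c)) =
  \sum_(x' | next x' == x) (key a (phi (a, x')) == c).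
Proof.
move=> phiE a b x c ca bx; apply: greedy_spec => //.
- exact: ordered_uniq.
- exact: ordered_all.
- exact: ordered_sorted.
Qed.

End Ordered.
End Greedy.

(** * Programs that handle one guess *)

(** Orbits are computed for twice the bound [M], so that an entry at a level up to [M] is at least
    [M] steps along and the orbit has entered its cycle; reading at [e_top] minus the level runs
    backwards. *)
Definition e_top : pexpr := EAdd (EVar 2) (EVar 2).
Definition e_al (h : pexpr) : pexpr := EGet 22 (ESub e_top h).
Definition e_v (h : pexpr) : pexpr := EGet 23 (ESub e_top h).
Definition e_p : pexpr := EAdd (EVar 31) (ECst 1).

Definition p_orbit (t o : nat) (e : pexpr) : cmd :=
  CSeq (CPut o (ECst 0) e)
  (CFor true 20 e_top (CPut o (EAdd (EVar 20) (ECst 1)) (EGet t (EGet o (EVar 20))))).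

Definition e_dstep : pexpr :=
  EIf (EEq (EVar 20) (e_v (ECst 0))) (ECst 1)
  (EIf (EAnd (EGet 24 (EGet 1 (EVar 20)))
       (EAnd (EGet 19 (e_idx (e_al (EGet 24 (EGet 1 (EVar 20)))) (EVar 20)))
             (ENot (EAnd (EEq (EGet 24 (EGet 1 (EVar 20))) e_p)
                         (EEq (EVar 20) (e_v e_p))))))
    (EAdd (EGet 24 (EGet 1 (EVar 20))) (ECst 1)) (ECst 0)).

Definition p_depth : cmd :=
  CSeq (CFill false 24 20 (EVar 1) (ECst 0))
  (CFor false 21 (EVar 2)
    (CSeq (CFill false 25 20 (EVar 1) e_dstep)
          (CFill false 24 20 (EVar 1) (EGet 25 (EVar 20))))).

Definition e_in (x : nat) : pexpr := EIf (EGet 24 (EVar x)) (ECst 1) (ECst 0).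

(** The verdict in variable 9 asks that the root and the table entries be in range and that labels
    decrease until the root is met. This is what makes the table of an arbitrary guess a connected
    system. *)
Definition p_cand : cmd :=
  CSeq (CSet 12 (ESum false 20 (EVar 1) (e_in 20)))
  (CSeq (CFill false 26 20 (EVar 1)
    (ESum false 21 (EVar 1) (EAnd (ELt (EVar 21) (EVar 20)) (e_in 21))))
  (CSeq (CFill false 27 20 (EVar 12)
    (ESum false 21 (EVar 1)
      (EIf (EAnd (e_in 21) (EEq (EGet 26 (EVar 21)) (EVar 20))) (EVar 21) (ECst 0))))
  (CSeq (CFill false 17 20 (EVar 12)
    (EIf (EEq (EGet 27 (EVar 20)) (e_v (ECst 0)))
      (EGet 26 (e_v (EVar 31))) (EGet 26 (EGet 1 (EGet 27 (EVar 20))))))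
  (CSeq (CSet 13 (EGet 26 (e_v (ECst 0))))
  (CSet 9 (EAnd (ELt (EVar 13) (EVar 12))
    (ENot (ESum false 20 (EVar 12)
      (ENot (EAnd (ELt (EGet 17 (EVar 20)) (EVar 12))
        (EOr (EEq (EVar 20) (EVar 13))
             (ELt (EGet 24 (EGet 27 (EGet 17 (EVar 20)))) (EGet 24 (EGet 27 (EVar 20))))))))))))))).

(** Numbers below variable 14 belong to the product with [A], the others to [B]. *)
Definition e_count (l : bool) : pexpr :=
  ESum true 23 (EVar 5)
    (EAnd (EAnd (if l then ELt (EVar 23) (EVar 14) else ENot (ELt (EVar 23) (EVar 14)))
                (EEq (EGet 29 (EVar 23)) (EVar 23)))
          (EEq (EGet 3 (EVar 23)) (EGet 3 (EVar 22)))).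

(** Array 29 holds the current iterate, beginning with the transition table itself. Exponents up to
    the number of states of both systems suffice by [iso_of_counts]. *)
Definition p_iso : cmd :=
  CSeq (CFill true 29 20 (EVar 5) (EGet 2 (EVar 20)))
  (CFor true 21 (EVar 5)
    (CSeq (CSet 9 (EAnd (EVar 9)
       (ENot (ESum true 22 (EVar 5) (ENot (EEq (e_count true) (e_count false)))))))
    (CSeq (CFill true 30 20 (EVar 5) (EGet 2 (EGet 29 (EVar 20))))
          (CFill true 29 20 (EVar 5) (EGet 30 (EVar 20)))))).

Section Guess.
Variables (A B : fdds) (eA : A -> nat) (eB : B -> nat).
Let na := #|A|.
Let nb := #|B|.
Let M := na + nb + 2.
Let T := M + M.
Variable In : A -> {set B}.
Hypothesis eBi : injective eB.

Lemma p_orbit_ok (Y : fdds) (e : Y -> nat) n t o x s y : base eA eB s -> t != o ->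
  rep e n (arr s t) -> ev s x = e y ->
  forall i, i <= T -> arr (den (p_orbit t o x) s) o i = e (iter i next y).
Proof.
move=> bs to rY xy i il; have [[h0 h1 h2 h3] _ _] := bs.
pose I k s' := (forall i, i < n -> arr s' t i = arr s t i) /\
  forall i, i <= k -> arr s' o i = e (iter i next y).
suff [_ h] : I T (den (p_orbit t o x) s) by apply: h.
have toF : (t == o) = false by apply: negbTE.
rewrite /p_orbit den_seq; apply: den_for.
(* The [2 * M] steps fit under the loop bound [M * M] since [M >= 2]. *)
- rewrite ev_add !ev_var den_put /bvar /= h2 h3 -/M -/T; apply/minn_idPl.
  by rewrite /T addnn -mul2n leq_mul2r /M addn2 orbT.
- split=> [j _|[|//] _]; rewrite den_put arr_put ?toF //.
  by rewrite ev_cst !eqxx xy.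
move=> k s' kT [h h']; split=> [j jn|j].
  by rewrite den_put arr_put toF /=; apply: h.
rewrite den_put arr_put eqxx ev_add ev_var ev_cst var_set eqxx addn1 !ev_get ev_var var_set eqxx !arr_set.
case: eqP => [-> _|/eqP jk jk']; last by apply: h'; rewrite -ltnS ltn_neqAle jk.
by rewrite h' // h ?(rep_lt rY) // (rep_next rY).
Qed.

Definition alpha (a0 : A) (h : nat) : A := iter (T - h) next a0.
Definition veta (w : B) (h : nat) : B := iter (T - h) next w.

(* The facts on which one guess relies: the keys are no longer needed. *)
Definition ready (a0 : A) (w : B) (s : store) : Prop :=
  [/\ base eA eB s, filled eA eB s In,
      forall h, arr s 22 (T - h) = eA (alpha a0 h)
    & forall h, arr s 23 (T - h) = eB (veta w h)].

Lemma ready_den a0 w c s : ready a0 w s -> all (leq 4) (wvars c) ->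
  all (fun a => (1 < a) && (a \notin [:: 19; 22; 23])) (warrs c) ->
  ready a0 w (den c s).
Proof.
move=> [b f h1 h2] v a; have /allP aP := a.
have fr x i : x \in [:: 19; 22; 23] -> arr (den c s) x i = arr s x i.
  by move=> xi; rewrite frame_arr //; apply/negP => /aP; rewrite xi andbF.
split=> [|a1 b1|h|h]; rewrite ?fr //.
by apply: base_den => //; apply: sub_all a => x /andP[].
Qed.

Lemma e_alE a0 w s h : ready a0 w s -> ev s (e_al h) = eA (alpha a0 (ev s h)).
Proof.
move=> [[[_ _ h2 _] _ _] _ ha _].
by rewrite ev_get ev_sub ev_add !ev_var h2 -/M -/T ha.
Qed.

Lemma e_vE a0 w s h : ready a0 w s -> ev s (e_v h) = eB (veta w (ev s h)).
Proof.
move=> [[[_ _ h2 _] _ _] _ _ hv].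
by rewrite ev_get ev_sub ev_add !ev_var h2 -/M -/T hv.
Qed.

Lemma fillB s a x e b : base eA eB s ->
  arr (den (CFill false a x (EVar 1) e) s) a (eB b) = ev (set_var s x (eB b)) e.
Proof.
move=> [[_ h1 h2 _] _ rB]; have lt := rep_lt rB b.
rewrite fill_in // ?ev_var ?h1 // /bvar h2 -addnA addnCA.
by apply: leq_trans lt (leq_addr _ _).
Qed.

Lemma p_depth_ok a0 w p s : ready a0 w s -> var s 31 = p.-1 -> 0 < p ->
  forall b, arr (den p_depth s) 24 (eB b) = depth (alpha a0) (veta w) In p M b.
Proof.
move=> rs v31 p0.
pose I k s' := [/\ ready a0 w s', var s' 31 = p.-1 &
  forall b, arr s' 24 (eB b) = depth (alpha a0) (veta w) In p k b].
suff [] : I M (den p_depth s) by [].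
have [[[h0 h1 h2 h3] _ _] _ _ _] := rs.
rewrite /p_depth den_seq; apply: den_for.
- by rewrite ev_var /bvar fill_var h2 minnn.
- split; [exact: ready_den|exact: v31|].
  by move=> b; rewrite fillB //; case: rs.
move=> k s' kM [rs' v31' hd]; rewrite den_seq.
set s1 := den (CFill false 25 _ _ _) _.
have r1 : ready a0 w s1 by apply: ready_den.
have h25 b : arr s1 25 (eB b) = depth (alpha a0) (veta w) In p k.+1 b.
  have [bs' fs' _ _] := rs'; rewrite /s1 fillB //.
  set s2 := set_var _ 20 _; have rs2 : ready a0 w s2 := rs'.
  have dE : ev s2 (EGet 24 (EGet 1 (EVar 20))) = depth (alpha a0) (veta w) In p k (next b).
    rewrite !ev_get ev_var /= -hd; congr (arr s' 24 _).
    by case: bs' => _ _ rB; apply: rep_next rB b.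
  have pE : ev s2 e_p = p by rewrite ev_add ev_cst ev_var /= v31' addn1 prednK.
  rewrite depthS /dstep /e_dstep.
  have IE : ev s2 (EGet 19 (e_idx (e_al (EGet 24 (EGet 1 (EVar 20)))) (EVar 20))) =
      (b \in In (alpha a0 (depth (alpha a0) (veta w) In p k (next b)))).
    have aE : ev s2 (e_al (EGet 24 (EGet 1 (EVar 20)))) =
        eA (alpha a0 (depth (alpha a0) (veta w) In p k (next b))) by rewrite (e_alE _ rs2) dE.
    by rewrite ev_get (@idxE A B eA eB s2 _ (EVar 20) _ b bs' aE erefl); apply: fs'.
  rewrite ev_if ev_eq (e_vE _ rs2) ev_var ev_cst b2n_neq0 ev_if !ev_and ev_not ev_and !ev_eq.
  rewrite IE dE pE (e_vE _ rs2) pE ev_add dE !ev_cst ev_var !b2n_neq0 addn1 lt0n.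
  have v20 : var s2 20 = eB b by [].
  by rewrite v20 !(inj_eq eBi) eqb0.
have h1' b : arr (den (CFill false 24 20 (EVar 1) (EGet 25 (EVar 20))) s1) 24 (eB b) =
    depth (alpha a0) (veta w) In p k.+1 b.
  by rewrite fillB ?ev_get ?arr_set ?ev_var ?var_set ?eqxx ?h25 //; case: r1.
by split=> //; apply: ready_den.
Qed.

End Guess.

(** * Consecutive numbering of the candidate *)

Section Index.
Variables (B : finType) (eB : B -> nat) (d : B -> nat).
Hypothesis eBi : injective eB.

Definition ixn : nat := \sum_b (d b != 0).
(** The position of [b] among the labelled states; it removes the gaps, so that the candidate has a
    table. *)
Definition ix (b : B) : nat := \sum_c ((eB c < eB b) && (d c != 0)).

Lemma ix_lt b : d b != 0 -> ix b < ixn.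
Proof.
move=> db; rewrite /ix /ixn (bigD1 b) //= [ltnRHS](bigD1 b) //= ltnn db add0n add1n ltnS.
by apply: leq_sum => c _; case: (_ < _).
Qed.

Lemma ix_mono b c : d c != 0 -> eB c < eB b -> ix c < ix b.
Proof.
move=> dc cb; rewrite /ix (bigD1 c) //= [ltnRHS](bigD1 c) //= ltnn dc cb add0n add1n ltnS.
apply: leq_sum => z _; case: (d z != 0); rewrite ?andbF ?andbT //.
by case: ltnP => // zc; rewrite (ltn_trans zc cb).
Qed.

Lemma ix_inj b c : d b != 0 -> d c != 0 -> ix b = ix c -> b = c.
Proof.
move=> db dc e; apply: eBi.
case: (ltngtP (eB b) (eB c)) => // [/(ix_mono db)|/(ix_mono dc)]; rewrite e ltnn //.
Qed.

Lemma ix_onto j : j < ixn -> exists2 b, d b != 0 & ix b = j.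
Proof.
move=> jq; pose h (u : {b : B | d b != 0}) : 'I_ixn := Ordinal (ix_lt (valP u)).
have hi : injective h by move=> u v /(congr1 val)/(ix_inj (valP u) (valP v))/val_inj.
have /codomP[u eu] : Ordinal jq \in codom h.
  rewrite inj_card_onto // card_ord card_sig /ixn -sum1_card [leqRHS]big_mkcond.
  by apply: leq_sum => b _; rewrite inE; case: (d b != 0).
by exists (val u); [exact: (valP u)|have := congr1 val eu].
Qed.

Lemma ixn_le : ixn <= #|B|.
Proof. by rewrite /ixn -sum1_card leq_sum // => b _; case: (d b != 0). Qed.

End Index.

Section Cand.
Variables (A B : fdds) (eA : A -> nat) (eB : B -> nat).
Let na := #|A|.
Let nb := #|B|.
Variable In : A -> {set B}.
Hypothesis eBi : injective eB.

Definition cand_ok (s : store) : Prop :=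
  var s 13 < var s 12 /\ forall j, j < var s 12 -> arr s 17 j < var s 12 /\
    (j = var s 13 \/ arr s 24 (arr s 27 (arr s 17 j)) < arr s 24 (arr s 27 j)).

Lemma p_cand_ok a0 w p s (d : B -> nat) : ready eA eB In a0 w s -> var s 31 = p.-1 ->
  (forall b, arr s 24 (eB b) = d b) ->
  let s' := den p_cand s in
  let v := veta A w in
  [/\ var s' 12 = ixn d, var s' 13 = ix eB d (v 0), (var s' 9 != 0) <-> cand_ok s',
      forall b, d b != 0 -> arr s' 27 (ix eB d b) = eB b
    & forall b, d b != 0 -> arr s' 17 (ix eB d b) =
        ix eB d (if b == v 0 then v p.-1 else next b)].
Proof.
move=> rs v31 h24 s' v.
have [bs _ _ _] := rs; have [[h0 h1 h2 h3] _ rB] := bs.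
have inE s0 x b : (forall b, arr s0 24 (eB b) = d b) -> var s0 x = eB b ->
    ev s0 (e_in x) = (d b != 0).
  by move=> hd xb; rewrite /e_in ev_if ev_get ev_var xb hd; case: (d b != 0).
rewrite {}/s' /p_cand 5!den_seq.
set s1 := den (CSet 12 _) s.
have r1 : ready eA eB In a0 w s1 by apply: ready_den.
have q1 : var s1 12 = ixn d.
  rewrite /s1 den_set var_set eqxx (sumB _ _ bs); apply: eq_bigr => b _.
  by rewrite (inE (set_var s 20 (eB b)) 20 b h24 erefl).
have d1 b : arr s1 24 (eB b) = d b by apply: h24.
have p1 : var s1 31 = p.-1 by [].
clearbody s1.
set s2 := den (CFill _ 26 _ _ _) s1.
have r2 : ready eA eB In a0 w s2 by apply: ready_den.
have i2 b : arr s2 26 (eB b) = ix eB d b.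
  have [b1 _ _ _] := r1.
  rewrite /s2 (@fillB A B eA eB s1 26 20 _ b b1).
  rewrite (@sumB A B eA eB (set_var s1 20 (eB b)) 21 _ b1); apply: eq_bigr => c _.
  by rewrite ev_and ev_lt b2n_neq0 (inE (set_var (set_var s1 20 (eB b)) 21 (eB c)) 21 c d1 erefl) b2n_neq0.
have q2 : var s2 12 = ixn d by [].
have d2 b : arr s2 24 (eB b) = d b by rewrite fill_out.
have p2 : var s2 31 = p.-1 by [].
clearbody s2.
have qM s0 : ready eA eB In a0 w s0 -> ixn d <= var s0 (bvar false).
  case=> [[[_ _ g2 _] _ _] _ _ _]; rewrite /bvar g2.
  by apply: leq_trans (ixn_le d) _; rewrite -addnA addnCA leq_addr.
set s3 := den (CFill _ 27 _ _ _) s2.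
have r3 : ready eA eB In a0 w s3 by apply: ready_den.
have v3 b : d b != 0 -> arr s3 27 (ix eB d b) = eB b.
  move=> db; have lt := ix_lt eB db; have [b2 _ _ _] := r2.
  rewrite /s3 fill_in ?ev_var ?q2 //; last exact: leq_trans lt (qM _ r2).
  rewrite (@sumB A B eA eB (set_var s2 20 (ix eB d b)) 21 _ b2).
  have E c : ev (set_var (set_var s2 20 (ix eB d b)) 21 (eB c))
      (EIf (EAnd (e_in 21) (EEq (EGet 26 (EVar 21)) (EVar 20))) (EVar 21) (ECst 0)) =
      if c == b then eB c else 0.
    rewrite ev_if ev_and ev_eq !b2n_neq0 ev_get !ev_var /= d2 i2.
    case: (c =P b) => [->|cb]; first by rewrite db eqxx.
    case: ifP => // /andP[dc /eqP e]; by case: cb; apply: ix_inj e.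
  under eq_bigr => c _ do rewrite E.
  by rewrite -big_mkcond big_pred1_eq.
have q3 : var s3 12 = ixn d by [].
have i3 b : arr s3 26 (eB b) = ix eB d b by rewrite fill_out.
have d3 b : arr s3 24 (eB b) = d b by rewrite fill_out.
have p3 : var s3 31 = p.-1 by [].
clearbody s3.
set s4 := den (CFill _ 17 _ _ _) s3.
have r4 : ready eA eB In a0 w s4 by apply: ready_den.
have x4 b : d b != 0 -> arr s4 17 (ix eB d b) =
    ix eB d (if b == v 0 then v p.-1 else next b).
  move=> db; have lt := ix_lt eB db; have [[_ _ rB3] _ _ _] := r3.
  rewrite /s4 fill_in ?ev_var ?q3 //; last exact: leq_trans lt (qM _ r3).
  have rs3 : ready eA eB In a0 w (set_var s3 20 (ix eB d b)) := r3.
  have e27 : ev (set_var s3 20 (ix eB d b)) (EGet 27 (EVar 20)) = eB b by rewrite /= v3.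
  rewrite ev_if ev_eq (e_vE _ rs3) e27 b2n_neq0 ev_cst (inj_eq eBi) /v.
  case: eqP => _; rewrite ev_get ?(e_vE _ rs3) ?ev_var ?p3 ?i3 //.
    by rewrite var_set /= p3.
  by rewrite ev_get e27 !arr_set (rep_next rB3) i3.
have q4 : var s4 12 = ixn d by [].
have i4 b : arr s4 26 (eB b) = ix eB d b by rewrite fill_out.
have v4 b : d b != 0 -> arr s4 27 (ix eB d b) = eB b by move=> db; rewrite fill_out // v3.
clearbody s4.
set s5 := den (CSet 13 _) s4.
have r5 : ready eA eB In a0 w s5 by apply: ready_den.
have o5 : var s5 13 = ix eB d (v 0).
  by rewrite /s5 den_set var_set eqxx ev_get (e_vE _ r4) i4.
have q5 : var s5 12 = ixn d by [].
have v5 b : d b != 0 -> arr s5 27 (ix eB d b) = eB b by apply: v4.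
have x5 b : d b != 0 -> arr s5 17 (ix eB d b) =
  ix eB d (if b == v 0 then v p.-1 else next b) by apply: x4.
clearbody s5.
split=> //; rewrite den_set var_set eqxx ev_and ev_lt ev_not b2n_neq0 !ev_var b2n_neq0.
rewrite ev_sum ev_var (minn_idPl _) ?q5 ?(qM _ r5) // b2n_neq0 sum_nat_eq0.
pose Q j := (arr s5 17 j < ixn d) &&
  ((j == var s5 13) || (arr s5 24 (arr s5 27 (arr s5 17 j)) < arr s5 24 (arr s5 27 j))).
have E (j : 'I_(ixn d)) : (ev (set_var s5 20 j) (ENot (EAnd (ELt (EGet 17 (EVar 20)) (EVar 12))
        (EOr (EEq (EVar 20) (EVar 13))
             (ELt (EGet 24 (EGet 27 (EGet 17 (EVar 20)))) (EGet 24 (EGet 27 (EVar 20))))))) == 0)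
    = Q j.
  rewrite ev_not eqb0 ev_and ev_or ev_eq !ev_lt !b2n_neq0 !ev_get !ev_var /= q5.
  by [].
rewrite (eq_forallb (P2 := fun j : 'I_(ixn d) => Q j)) //.
rewrite /cand_ok !var_set /= q5; split=> [/andP[-> /forallP h]|[-> h]]; last first.
  by apply/forallP => j; have [] := h _ (ltn_ord j); rewrite /Q => -> [->|->]; rewrite ?eqxx ?orbT.
split=> // j jq; have /= /andP[-> /orP[/eqP ?|->]] := h (Ordinal jq); split=> //.
  by left.
by right.
Qed.

End Cand.

(** * Systems given by tables, and connectivity *)

(** By the default of [insubd], a state whose entry is out of range is a fixed point, so every array
    defines a system. *)
Definition table (q : nat) (f : nat -> nat) : fdds :=
  @FDDS 'I_q (fun j => insubd j (f j)).

Lemma table_rep q f : (forall j, j < q -> f j < q) ->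
  rep (fun j : table q f => val j) q f.
Proof.
move=> fq; split=> [|j|| j]; [exact: val_inj|exact: ltn_ord|exact: card_ord|].
by rewrite /= val_insubd fq.
Qed.

Lemma reach_connected (X : fdds) (r : X) :
  (forall x, exists k, iter k next x = r) -> fdds_connected X.
Proof.
move=> h; split; first by apply/card_gt0P; exists r.
set e := [rel u v | _]; have sym : connect_sym e.
  by apply: sym_connect_sym => u v; rewrite /= orbC.
have toroot x : connect e x r.
  have [k <-] := h x; elim: k => [|k IH]; first exact: connect0.
  apply: connect_trans IH _; apply: connect1.
  by rewrite /= /fdds_arc /= eqxx.
by move=> x y; apply: connect_trans (toroot x) _; rewrite sym.
Qed.

(** Weakly connected states have iterates that meet, and a meeting point on the orbit of the cyclic
    state [r] leads back to [r]. *)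
Lemma connected_reach (X : fdds) (r : X) : fdds_connected X -> cyclic r ->
  forall x, exists k, iter k next x = r.
Proof.
move=> [_ conn] cr x; have [k er] := cr.
have meet : forall y, connect [rel u v | fdds_arc u v || fdds_arc v u] r y ->
    exists i j, iter i next y = iter j next r.
  move=> y /connectP[s ps ->]; elim/last_ind: s ps => [|s z IH] /=.
    by move=> _; exists 0, 0.
  rewrite rcons_path last_rcons => /andP[/IH[i [j e]]] /orP[/eqP nz|/eqP nz].
    by exists i, j.+1; rewrite -nz -iterSr iterS e.
  by exists i.+1, j; rewrite iterSr nz.
have [i [j e]] := meet x (conn r x).
(* After the [j] steps from [r] to the meeting point, [j * k.+1 - j] more complete [j] turns of the
   cycle. *)
exists (j * k.+1 - j + i); rewrite iterD e -iterD subnK; first exact: iter_mul.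
by rewrite leq_pmulr.
Qed.

(** Labels decrease along the table until the root is met, so every state reaches it. *)
Lemma cand_ok_connected s : cand_ok s -> fdds_connected (table (var s 12) (arr s 17)).
Proof.
move=> [rq h]; pose r : table (var s 12) (arr s 17) := Ordinal rq.
apply: (@reach_connected _ r) => x.
have [n] := ubnP (arr s 24 (arr s 27 (val x))); elim: n x => // n IH x lt.
have [lx [xr|lab]] := h (val x) (ltn_ord x).
  by exists 0; apply: val_inj; rewrite /= xr.
have [|k e] := IH (next x).
  by rewrite /= val_insubd lx; apply: leq_trans lab _.
by exists k.+1; rewrite iterSr.
Qed.

(** * The isomorphism test *)

Section Iso.
Variables (Y Z : fdds).

Definition same_counts (l : nat) : Prop := forall w : fdds_add Y Z,
  \sum_(y : Y | iter l next y == y) (clsl Z y == cls w) =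
  \sum_(z : Z | iter l next z == z) (clsr Y z == cls w).

(** Counts per class determine the sums of all functions compatible with equivalence, by
    [sum_key]. *)
Lemma same_counts_iso :
  (forall l, 0 < l -> l <= #|Y| + #|Z| -> same_counts l) -> fdds_iso Y Z.
Proof.
move=> h; apply: iso_of_counts => l f f' l0 lb ff.
apply: (sum_key (k := @clsl Y Z) (k' := @clsr Y Z)) => [c|u v _ _ /clslr/ff //].
case: (pickP (fun w : fdds_add Y Z => cls w == c)) => [w /eqP <-|no]; first exact: h.
rewrite !big1 // => u _; first by have := no (inr u) => /= ->.
by have := no (inl u) => /= ->.
Qed.

Variables (e : fdds_add Y Z -> nat) (n1 : nat).
Let N := #|Y| + #|Z|.
Hypothesis el : forall y, e (inl y) < n1.
Hypothesis er : forall z, n1 <= e (inr z).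

Lemma iter_inl l (y : Y) :
  iter l (@next (fdds_add Y Z)) (inl y) = inl (iter l next y).
Proof. by elim: l => //= l ->. Qed.

Lemma iter_inr l (z : Z) :
  iter l (@next (fdds_add Y Z)) (inr z) = inr (iter l next z).
Proof. by elim: l => //= l ->. Qed.

Lemma e_countE s l (w : fdds_add Y Z) (b : bool) : var s 5 = N -> N <= var s 3 -> var s 14 = n1 ->
  rep e N (arr s 2) ->
  (forall w : fdds_add Y Z, arr s 3 (e w) = cls w) ->
  (forall w : fdds_add Y Z, arr s 29 (e w) = e (iter l next w)) ->
  var s 22 = e w ->
  ev s (e_count b) = if b then \sum_(y : Y | iter l next y == y) (clsl Z y == cls w)
    else \sum_(z : Z | iter l next z == z) (clsr Y z == cls w).
Proof.
move=> v5 le v14 r hc hi v22; rewrite /e_count ev_sum ev_var v5 (minn_idPl _) //.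
rewrite (rep_sum r (fun i => ev (set_var s 23 i) _)).
have E (u : fdds_add Y Z) : ev (set_var s 23 (e u))
    (EAnd (EAnd (if b then ELt (EVar 23) (EVar 14) else ENot (ELt (EVar 23) (EVar 14)))
                (EEq (EGet 29 (EVar 23)) (EVar 23)))
          (EEq (EGet 3 (EVar 23)) (EGet 3 (EVar 22)))) =
    [&& (e u < n1) == b, iter l next u == u & cls u == cls w].
  rewrite !ev_and !ev_eq !b2n_neq0 !ev_get !ev_var !arr_set !var_set /= v22 hi !hc.
  rewrite (rep_eq r) -andbA; congr (nat_of_bool (_ && _)).
  by case: b; rewrite ?ev_not ev_lt ?b2n_neq0 ?eqb0 !ev_var /= v14; case: (_ < _).
rewrite (eq_bigr _ (fun u _ => E u)) big_sumType /=.
have e1 y : (e (inl y) < n1) = true by apply: el.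
have e2 z : (e (inr z) < n1) = false by rewrite ltnNge er.
case: b {E}.
  rewrite [X in _ + X]big1 ?addn0 => [|z _]; last by rewrite e2.
  rewrite [RHS]big_mkcond; apply: eq_bigr => y _; rewrite e1 iter_inl /clsl.
  by rewrite (inj_eq (@inl_inj Y Z)) eqxx /=; case: (iter l next y == y).
rewrite [X in X + _]big1 ?add0n => [|y _]; last by rewrite e1.
rewrite [RHS]big_mkcond; apply: eq_bigr => z _; rewrite e2 iter_inr /clsr.
by rewrite (inj_eq (@inr_inj Y Z)) eqxx /=; case: (iter l next z == z).
Qed.

Lemma p_iso_ok s : var s 5 = N -> N <= var s 3 -> var s 14 = n1 ->
  rep e N (arr s 2) -> (forall w : fdds_add Y Z, arr s 3 (e w) = cls w) ->
  (var (den p_iso s) 9 != 0) <->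
  (var s 9 != 0 /\ forall l, 0 < l -> l <= N -> same_counts l).
Proof.
move=> v5 le v14 r hc.
pose I k s' := [/\ var s' 5 = N, var s' 3 = var s 3, var s' 14 = n1 &
  [/\ forall i, arr s' 2 i = arr s 2 i, forall i, arr s' 3 i = arr s 3 i,
      forall w, arr s' 29 (e w) = e (iter k.+1 next w) &
      (var s' 9 != 0) <-> (var s 9 != 0 /\ forall l, 0 < l -> l <= k -> same_counts l)]].
suff [_ _ _ [_ _ _ //]] : I N (den p_iso s).
have lv s' w : var s' 5 = N -> e w < ev s' (EVar 5) by rewrite /= => ->; apply: rep_lt r _.
have lk s' w : var s' 3 = var s 3 -> e w < var s' (bvar true).
  by rewrite /bvar => ->; apply: leq_trans (rep_lt r w) le.
rewrite /p_iso den_seq; apply: den_for.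
- by rewrite ev_var [var _ 5]v5; apply/minn_idPl.
- split=> //; split.
  + by move=> i; rewrite fill_out.
  + by move=> i; rewrite fill_out.
  + by move=> w; rewrite (fill_in _ _ _ (lv s w v5) (lk s w erefl)) ev_get ev_var var_set eqxx arr_set (rep_next r).
  + by split=> [h|[]//]; split=> // l l0; rewrite leqn0 => /eqP l00; rewrite l00 in l0.
move=> k s' kN [h5 h3 h14 [h2 hc' h29 h9]].
rewrite 2!den_seq.
set s1 := den (CSet 9 _) (set_var s' 21 k).
have v1 x : x != 9 -> x != 21 -> var s1 x = var s' x.
  by move=> /negPf x9 /negPf x21; rewrite /s1 den_set !var_set x9 x21.
have a1 a i : arr s1 a i = arr s' a i by [].
have ok1 : (var s1 9 != 0) = (var s' 9 != 0) && [forall w : fdds_add Y Z,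
    \sum_(y : Y | iter k.+1 next y == y) (clsl Z y == cls w) ==
    \sum_(z : Z | iter k.+1 next z == z) (clsr Y z == cls w)].
  rewrite /s1 den_set var_set eqxx ev_and b2n_neq0 ev_not b2n_neq0 ev_var; congr (_ && _).
  rewrite ev_sum ev_var [var _ 5]h5 (minn_idPl _); last by rewrite /bvar /= h3.
  rewrite (rep_sum r (fun i => ev (set_var (set_var s' 21 k) 22 i) _)) sum_nat_eq0.
  apply: eq_forallb => w; rewrite implyTb ev_not eqb0 ev_eq b2n_neq0.
  have r' : rep e N (arr s' 2) by case: r => ei elt ec en; split=> // u; rewrite h2.
  have hcc (u : fdds_add Y Z) : arr s' 3 (e u) = cls u by rewrite hc'.
  have le' : N <= var s' 3 by rewrite h3.
  have S b := @e_countE (set_var (set_var s' 21 k) 22 (e w)) k.+1 w b h5 le' h14 r' hcc h29 erefl.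
  by rewrite (S true) (S false).
clearbody s1.
have i5 : var s1 5 = N by rewrite v1.
have i3 : var s1 3 = var s 3 by rewrite v1.
set s2 := den (CFill _ 30 _ _ _) s1.
have f2 w : arr s2 30 (e w) = e (iter k.+2 next w).
  by rewrite /s2 (fill_in _ _ _ (lv s1 w i5) (lk s1 w i3)) /= !a1 h29 h2 (rep_next r).
have w2 : var s2 = var s1 by [].
have a2 a i : a != 30 -> arr s2 a i = arr s1 a i by apply: fill_out.
clearbody s2.
split; rewrite ?fill_var ?w2 //; first by rewrite v1.
split.
- by move=> i; rewrite fill_out // a2 // a1.
- by move=> i; rewrite fill_out // a2 // a1.
- move=> w; have j5 : var s2 5 = N by rewrite w2.
  have j3 : var s2 3 = var s 3 by rewrite w2.
  by rewrite (fill_in _ _ _ (lv s2 w j5) (lk s2 w j3)) ev_get ev_var var_set eqxx arr_set f2.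
- rewrite ok1; split=> [/andP[/h9[h0 hl] /forallP hk]|[h0 hl]].
    split=> // l l0; rewrite leq_eqVlt => /predU1P[->|]; last by apply: hl.
    by move=> w; apply/eqP.
  apply/andP; split; last by apply/forallP => w; apply/eqP/hl.
  by apply/h9; split=> // l l0 lk'; apply: hl => //; apply: leqW.
Qed.

End Iso.

Lemma counts_same (Y Z : fdds) l :
  (forall (f : Y -> nat) (f' : Z -> nat), (forall u w, eqv u w -> f u = f' w) ->
    \sum_(u | iter l next u == u) f u = \sum_(w | iter l next w == w) f' w) ->
  same_counts Y Z l.
Proof. by move=> h w; apply: h => u v /clslr ->. Qed.

(** * Checking candidates and running through the guesses *)

Definition p_record : cmd :=
  CSeq (CSet 10 (ECst 1))
  (CSeq (CSet 11 (EVar 12)) (CFill false 28 20 (EVar 12) (EGet 17 (EVar 20)))).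

Definition p_check : cmd :=
  CIf (EVar 9) (CSeq p_sys (CSeq p_iso (CIf (EVar 9) p_record CSkip))) CSkip.

(** Variable 31 stores the period minus one, so the periods from 1 to [M] are tried. *)
Definition p_guess : cmd :=
  CFor false 30 (EVar 1)
    (CSeq (p_orbit 1 23 (EVar 30))
      (CFor false 31 (EVar 2) (CSeq p_depth (CSeq p_cand p_check)))).

Lemma den_skip s : den CSkip s = s. Proof. by []. Qed.

Lemma card_table q f : #|table q f| = q.
Proof. exact: card_ord. Qed.

Lemma depth_ext (A B : fdds) (al : nat -> A) (v v' : nat -> B) In p n :
  v =1 v' -> depth al v In p n =1 depth al v' In p n.
Proof. by move=> e; elim: n => // n IH b; rewrite !depthS /dstep !e !IH. Qed.

Section Check.
Variables (A B : fdds) (eA : A -> nat) (eB : B -> nat).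

Definition good (s : store) : Prop :=
  let X := table (var s 12) (arr s 17) in
  cand_ok s /\ forall l, 0 < l -> l <= #|fdds_mul A X| + #|B| -> same_counts (fdds_mul A X) B l.

Definition kept (s s' : store) : Prop :=
  [/\ var s' 10 = var s 10, var s' 11 = var s 11 & forall j, arr s' 28 j = arr s 28 j].

Lemma kept_trans s1 s2 s3 : kept s1 s2 -> kept s2 s3 -> kept s1 s3.
Proof.
move=> [a1 a2 a3] [c1 c2 c3].
by split=> [||j]; rewrite ?c1 ?c2 ?c3 ?a1 ?a2 ?a3.
Qed.

Definition recorded (s s' : store) : Prop :=
  [/\ var s' 10 = 1, var s' 11 = var s 12 & forall j, j < var s 12 -> arr s' 28 j = arr s 17 j].

Lemma p_record_ok s : var s 12 <= var s (bvar false) -> recorded s (den p_record s).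
Proof.
move=> le; split=> // j jq; rewrite /p_record 2!den_seq fill_in //.
exact: leq_trans jq le.
Qed.

Lemma p_check_ok s : base eA eB s -> var s 12 <= #|B| -> (var s 9 != 0) <-> cand_ok s ->
  (good s /\ recorded s (den p_check s)) \/ (~ good s /\ kept s (den p_check s)).
Proof.
move=> bs qB ok; rewrite /p_check den_if ev_var.
have [c9|c9] := boolP (var s 9 != 0); last first.
  by right; split=> [[/ok h]|//]; rewrite h in c9.
have co := ok.1 c9.
set X := table (var s 12) (arr s 17).
have rX : rep (fun j : X => val j) #|X| (arr s 17).
  by rewrite card_table; apply: table_rep => j jq; have [_ /(_ j jq)[]] := co.
have cX : var s 12 = #|X| by rewrite card_table.
have [sz rA rB] := bs; have XB : #|X| <= #|B| by rewrite -cX.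
have := p_sys_ok sz cX rA rB rX XB; rewrite 2!den_seq.
set s1 := den p_sys s => -[r5 v5 v14 v3].
have b1 : base eA eB s1 by apply: base_den.
have k1 : kept s s1 by split=> [||j]; rewrite ?frame_var ?frame_arr.
have v12 : var s1 12 = var s 12 by rewrite frame_var.
have v9 : var s1 9 = var s 9 by rewrite frame_var.
have a17 j : arr s1 17 j = arr s 17 j by rewrite frame_arr.
clearbody s1.
have el (y : fdds_mul A X) : esum eA eB (fun j : X => val j) (inl y) < #|A| * #|X|.
  by case: y => a x; apply: pair_lt; [apply: rep_lt rA a|apply: rep_lt rX x].
have er (b : B) : #|A| * #|X| <= esum eA eB (fun j : X => val j) (inr b) by apply: leq_addr.
have cN : #|fdds_mul A X| + #|B| = #|A| * #|X| + #|B| by rewrite card_prod.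
have iso := p_iso_ok el er; rewrite cN in iso.
have leK : #|A| * #|X| + #|B| <= var s1 3.
  have [[_ _ _ ->] _ _] := b1; have := leq_mul (leqnn #|A|) XB.
  by move: (#|A| * #|X|) => ax; nia.
have {}iso := iso s1 v5 leK v14 r5 v3.
set s2 := den p_iso s1 in iso *.
have k2 : kept s1 s2 by split=> [||j]; rewrite ?frame_var ?frame_arr.
have w12 : var s2 12 = var s 12 by rewrite frame_var.
have w17 j : arr s2 17 j = arr s 17 j by rewrite frame_arr.
have M2 : var s 12 <= var s2 (bvar false).
  rewrite /bvar frame_var //; have [[_ _ -> _] _ _] := b1.
  by rewrite (leq_trans qB) // -addnA addnCA leq_addr.
clearbody s2.
rewrite den_if ev_var; have [h9|h9] := boolP (var s2 9 != 0).
  left; split; first by split=> //; rewrite cN; have [] := iso.1 h9.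
  have [r1 r2 r3] : recorded s2 (den p_record s2) by apply: p_record_ok; rewrite w12.
  rewrite w12 in r2 r3.
  by split=> [||j jq]; rewrite ?r1 ?r2 ?r3.
right; split.
  move=> [_]; rewrite cN => h; case/negP: h9; apply/iso.2; split=> //.
  by rewrite v9.
by rewrite den_skip; apply: kept_trans k1 k2.
Qed.

(** The soundness invariant. The bound on the size ensures that the final copy, a loop limited by
    variable 2, transfers the whole table. *)
Definition found (s : store) : Prop := var s 10 != 0 ->
  exists (X : fdds) (e : X -> nat), [/\ rep e (var s 11) (arr s 28), connected_quotient A B X
    & var s 11 <= #|A| + #|B| + 2].

Lemma found_kept s s' : kept s s' -> found s -> found s'.
Proof.
move=> [h10 h11 h28] f; rewrite /found h10 h11 => /f[X [e [[i l c n] q le]]].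
by exists X, e; split=> //; split=> // y; rewrite h28.
Qed.

Lemma found_recorded s s' : var s 12 <= #|B| -> good s -> recorded s s' -> found s'.
Proof.
move=> qB [co h] [h10 h11 h28] _; set X := table (var s 12) (arr s 17) in h.
have [i l c n] : rep (fun j : X => val j) (var s 12) (arr s 17).
  by apply: table_rep => j jq; have [_ /(_ j jq)[]] := co.
exists X, (fun j : X => val j); rewrite h11; split.
- by split=> // y; rewrite h28 ?l // n.
- by split; [apply: cand_ok_connected|apply: same_counts_iso].
- by rewrite (leq_trans qB) // -addnA addnCA leq_addr.
Qed.

Section Complete.
Variables (X : fdds) (phi : A * X -> B).
Hypothesis phi_bij : bijective phi.
Hypothesis phi_next : forall q, phi (next q.1, next q.2) = next (phi q).
Hypothesis X_conn : fdds_connected X.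
Hypothesis eBi : injective eB.
Variable l : A -> seq B.
Hypothesis lo : ordered eB l.
Variables (a0 : A) (x0 : X) (p : nat) (s : store).
Let M := #|A| + #|B| + 2.
Let T := M + M.
Let In a := greedy a (l a).
Let x1 := iter T next x0.
Hypothesis rs : ready eA eB In a0 (phi (a0, x0)) s.
Hypothesis v31 : var s 31 = p.-1.
Hypotheses (p0 : 0 < p) (pM : p <= M) (pper : iter p next x1 = x1).
Hypothesis pmin : forall k, 0 < k -> k < p -> iter k next x1 != x1.

(** For a right guess, the computed table is a system [Y], and [iota] embeds it in [B] with the
    labelled states as image, which is the situation of [candidate_counts]. *)
Lemma candidate_good : good (den p_cand (den p_depth s)).
Proof.
have XB : #|X| <= #|B|.
  rewrite -(bij_eq_card phi_bij) card_prod leq_pmull //.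
  by apply/card_gt0P; exists a0.
have MB : #|B| <= M by rewrite /M -addnA addnCA leq_addr.
have TA : M + #|A| <= T by rewrite leq_add2l /M -addnA leq_addr.
have TX : M + #|X| <= T by rewrite leq_add2l (leq_trans XB).
have InE := greedy_InE lo (phi_eqv phi_bij phi_next).
pose al h : A := iter (T - h) next a0.
pose xx h : X := iter (T - h) next x0.
pose v h : B := phi (al h, xx h).
pose d := depth al v In p M.
have x0E : x1 = xx 0 by rewrite /xx subn0.
have pmin' k : 0 < k -> k < p -> iter k next (xx 0) != xx 0 by rewrite -x0E; apply: pmin.
have pper' : iter p next (xx 0) = xx 0 by rewrite -x0E.
have vE h : veta A (phi (a0, x0)) h = v h by apply: iter_phi.
have h24 := p_depth_ok eBi rs v31 p0.
have r1 : ready eA eB In a0 (phi (a0, x0)) (den p_depth s) by apply: ready_den.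
have w31 : var (den p_depth s) 31 = p.-1 by rewrite frame_var.
set s1 := den p_depth s in h24 r1 w31 *; clearbody s1.
have {}h24 b : arr s1 24 (eB b) = d b by rewrite h24; apply: depth_ext.
have := p_cand_ok eBi r1 w31 h24; cbv zeta.
have a24 i : arr (den p_cand s1) 24 i = arr s1 24 i by rewrite frame_arr.
set s2 := den p_cand s1 in a24 *; clearbody s2.
case; rewrite !vE => q12 q13 ok i27 i17.
have {}i17 b : d b != 0 -> arr s2 17 (ix eB d b) = ix eB d (if b == v 0 then v p.-1 else next b).
  by move=> db; rewrite i17 // !vE.
have dv h : h < p -> d (v h) = h.+1 by apply: (d_v phi_bij phi_next a0 MB TA TX p0 pM pmin' InE).
have dnxt b : d b != 0 -> d (if b == v 0 then v p.-1 else next b) != 0.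
  rewrite -!lt0n; exact: (nxt_d phi_bij phi_next MB TA TX p0 pM pmin' InE).
have dnext b : b != v 0 -> d b != 0 -> d b = (d (next b)).+1.
  by move=> bv; rewrite -lt0n => /(d_next MB bv)[].
have d0 : d (v 0) != 0 by rewrite dv.
have co : cand_ok s2.
  split; first by rewrite q12 q13 ix_lt.
  move=> j; rewrite q12 => /(ix_onto eBi)[b db <-]; rewrite i17 // ix_lt ?dnxt // q13.
  split=> //; have [->|bv] := eqVneq b (v 0); [by left|right].
  have dn := dnxt b db; rewrite (negPf bv) in dn.
  by rewrite !i27 // !a24 !h24 (dnext b).
split=> // k k0 _; apply: counts_same => f f' ff.
set Y := table (var s2 12) (arr s2 17).
have rY : rep (fun j : Y => val j) (var s2 12) (arr s2 17).
  by apply: table_rep => j jq; have [_ /(_ j jq)[]] := co.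
have : forall y : Y, exists b, d b != 0 /\ ix eB d b = val y.
  move=> y; have lt : val y < ixn d by rewrite -q12 ltn_ord.
  by have [b db e] := ix_onto eBi lt; exists b.
move=> /fin_all_exists[iota iotaP].
have rlt : ix eB d (v 0) < var s2 12 by rewrite q12 ix_lt.
have iota_ix b (y : Y) : d b != 0 -> val y = ix eB d b -> iota y = b.
  by move=> db e; have [dy ey] := iotaP y; apply: (ix_inj eBi dy db); rewrite ey.
have X_reach (x : X) : exists k, iter k next x = xx 0.
  apply: (connected_reach X_conn); rewrite /xx subn0; exists p.-1.
  by rewrite prednK.
have iota_inj : injective iota.
  by move=> y z e; apply: val_inj; have [_ <-] := iotaP y; have [_ <-] := iotaP z; rewrite e.
have iota_im b : 0 < d b <-> exists y, iota y = b.
  split=> [|[y <-]]; rewrite lt0n; last by have [] := iotaP y.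
  move=> db; have lt : ix eB d b < var s2 12 by rewrite q12 ix_lt.
  by exists (Ordinal lt); apply: iota_ix.
have iota_next (y : Y) : iota (next y) = if iota y == v 0 then v p.-1 else next (iota y).
  have [dy ey] := iotaP y; apply: iota_ix; first exact: dnxt.
  by rewrite -(rep_next rY) -ey i17.
have iota_r : iota (Ordinal rlt) = v 0 by apply: iota_ix.
exact: (candidate_counts phi_bij phi_next MB TA TX p0 pM pper' pmin' InE
  iota_inj iota_im iota_next iota_r X_reach k0 ff).
Qed.

End Complete.
Section Guesses.
Hypothesis eBi : injective eB.
Variables (In : A -> {set B}) (a0 : A).
Let M := #|A| + #|B| + 2.
Let T := M + M.

(** Quantifying over all prepared stores makes a hit independent of what earlier guesses left in the
    working arrays. *)
Definition hits (w : B) (p : nat) : Prop := [/\ 0 < p, p <= M & forall s,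
  ready eA eB In a0 w s -> var s 31 = p.-1 -> good (den p_cand (den p_depth s))].

Lemma p_try_guess w p s : ready eA eB In a0 w s -> var s 31 = p.-1 -> 0 < p -> found s ->
  let s' := den (CSeq p_depth (CSeq p_cand p_check)) s in
  [/\ ready eA eB In a0 w s', found s', var s 10 != 0 -> var s' 10 != 0
    & hits w p -> var s' 10 != 0].
Proof.
move=> rs v31 p0 fs s'; split; first exact: ready_den.
all: have r1 : ready eA eB In a0 w (den p_depth s) by apply: ready_den.
all: have w31 : var (den p_depth s) 31 = p.-1 by rewrite frame_var.
all: have [q12 _ ok _ _] := p_cand_ok eBi r1 w31 (p_depth_ok eBi rs v31 p0).
all: have k2 : kept s (den p_cand (den p_depth s)) by split=> [||j]; rewrite ?frame_var ?frame_arr.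
all: have b2 : base eA eB (den p_cand (den p_depth s)) by apply: base_den; [case: r1|..].
all: have qB : var (den p_cand (den p_depth s)) 12 <= #|B| by rewrite q12 ixn_le.
all: have ck := p_check_ok b2 qB ok; rewrite /s' !den_seq.
- case: ck => [[gd rec]|[_ kp]]; first exact: found_recorded gd rec.
  exact: found_kept (kept_trans k2 kp) fs.
- case: ck => [[_ [-> _ _]]|[_ kp]] //.
  by have [-> _ _] := kept_trans k2 kp.
- by case=> _ _ /(_ s rs v31) gd; case: ck => [[_ [-> _ _]]|[]].
Qed.

Definition primed (s : store) : Prop := [/\ base eA eB s, filled eA eB s In
  & forall h, arr s 22 (T - h) = eA (alpha B a0 h)].

Lemma p_guess_ok s : primed s -> found s ->
  let s' := den p_guess s in
  found s' /\ ((exists w p, hits w p) -> var s' 10 != 0).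
Proof.
move=> ps fs; cbv zeta.
pose I k s' := [/\ primed s', found s' & forall w p, eB w < k -> hits w p -> var s' 10 != 0].
have [[[_ h1 h2 _] _ rB] _ _] := ps.
suff [_ ? h] : I #|B| (den p_guess s).
  by split=> // -[w [p]]; apply: h; apply: rep_lt rB w.
apply: den_for => [||k s1 kB [ps1 fs1 hs1]].
- by rewrite ev_var h1 /bvar h2 -addnA addnCA; apply/minn_idPl/leq_addr.
- by split.
have [w wk] := rep_onto rB kB; rewrite den_seq.
set s2 := set_var s1 30 k; have [b2 f2 al2] : primed s2 := ps1.
have rs3 : ready eA eB In a0 w (den (p_orbit 1 23 (EVar 30)) s2).
  split=> [|a b|h|h].
  - exact: base_den.
  - by rewrite frame_arr ?f2.
  - by rewrite frame_arr ?al2.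
  - have [_ _ rB2] := b2; apply: (p_orbit_ok b2 _ rB2); rewrite ?leq_subr //.
have fs3 : found (den (p_orbit 1 23 (EVar 30)) s2).
  by apply: found_kept fs1; split=> [||j]; rewrite ?frame_var ?frame_arr.
have v10 : var (den (p_orbit 1 23 (EVar 30)) s2) 10 = var s1 10 by rewrite frame_var.
move: (den _ s2) rs3 fs3 v10 => s3 rs3 fs3 v10.
pose J i s' := [/\ ready eA eB In a0 w s', found s', var s3 10 != 0 -> var s' 10 != 0
  & forall p, p <= i -> hits w p -> var s' 10 != 0].
suff [[? ? ? _] ? h h'] : J M (den (CFor false 31 (EVar 2) (CSeq p_depth (CSeq p_cand p_check))) s3).
  split=> // u p; rewrite ltnS leq_eqVlt => /predU1P[uk|uk] hit; last first.
    by apply: h; rewrite v10; apply: hs1 hit.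
  have uw : u = w by apply: eBi; rewrite wk.
  by apply: (h' p); [case: hit|rewrite -uw].
apply: den_for => [||i s4 iM [rs4 fs4 h4 h4']].
- by rewrite ev_var /bvar minnn; case: rs3 => [[[_ _ ? _] _ _] _ _ _].
- by split=> // p; rewrite leqn0 => /eqP -> [].
have rs5 : ready eA eB In a0 w (set_var s4 31 i) := rs4.
have fs5 : found (set_var s4 31 i) := fs4.
have [rs6 fs6 m6 h6] := @p_try_guess w i.+1 _ rs5 erefl isT fs5.
split=> // [v3|p]; first by apply/m6/h4.
rewrite leq_eqVlt => /predU1P[->|pi] hit; first exact: h6.
by apply: m6; apply: h4' hit.
Qed.

End Guesses.

(** Any state [x0] of the quotient will do: the guess is the image of [(a0, x0)] with the least
    period of the cyclic state that [x0] reaches after [M + M] steps. A single [a0] is enough, so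
    only [w] and [p] are guessed. *)
Lemma quotient_hits l a0 : injective eB -> ordered eB l ->
  (exists X, connected_quotient A B X) -> exists w p, hits (fun a => greedy a (l a)) a0 w p.
Proof.
move=> eBi lo [X [X_conn [phi [phi_bij phi_next]]]].
have /card_gt0P[x0 _] : 0 < #|X| by case: X_conn.
pose M := #|A| + #|B| + 2; pose x1 := iter (M + M) next x0.
have XB : #|X| <= #|B|.
  rewrite -(bij_eq_card phi_bij) card_prod leq_pmull //.
  by apply/card_gt0P; exists a0.
have XM : #|X| <= M + M.
  by apply: leq_trans XB _; rewrite /M -!addnA addnCA leq_addr.
have [k kX ek] := iter_period x0 XM.
have ex : exists i, (0 < i) && (iter i next x1 == x1) by exists k.+1; rewrite /x1 ek eqxx.
case: (ex_minnP ex) => p /andP[p0 /eqP pper] pmin.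
have pM : p <= M.
  apply: leq_trans (pmin k.+1 _) _; first by rewrite /x1 ek eqxx.
  by rewrite (leq_trans kX) // (leq_trans XB) // /M -addnA addnCA leq_addr.
exists (phi (a0, x0)), p; split=> // s rs v31.
apply: (candidate_good phi_bij phi_next X_conn eBi lo rs v31 p0 pM pper) => i i0 ip.
apply/negP => ii; have := pmin i; rewrite i0 ii => /(_ isT).
by rewrite leqNgt ip.
Qed.

End Check.

(** * Empty inputs and the complete program *)

Lemma iso_empty (Y Z : fdds) : #|Y| = 0 -> #|Z| = 0 -> fdds_iso Y Z.
Proof.
move=> /card0_eq y0 /card0_eq z0.
have noY (y : Y) : False by have := y0 y.
have noZ (z : Z) : False by have := z0 z.
exists (fun y => False_rect Z (noY y)); split=> [|y]; last by case: (noY y).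
by exists (fun z => False_rect Y (noZ z)) => x; [case: (noY x)|case: (noZ x)].
Qed.

Lemma connected_one : fdds_connected (table 1 (fun=> 0)).
Proof.
by apply: (@reach_connected (table 1 (fun=> 0)) ord0) => x; exists 0; apply: val_inj; rewrite /= (ord1 x).
Qed.

Section Main.
Variables (A B : fdds) (eA : A -> nat) (eB : B -> nat).

(** With [A] empty there is no state to start an orbit from. A quotient then exists exactly when [B]
    is empty, and a single fixed point is the answer. *)
Definition p_solve : cmd :=
  CIf (EVar 0)
    (CSeq p_keys (CSeq p_greedy (CSeq (p_orbit 0 22 (ECst 0)) p_guess)))
    (CIf (EVar 1) CSkip
      (CSeq (CSet 10 (ECst 1)) (CSeq (CSet 11 (ECst 1)) (CPut 28 (ECst 0) (ECst 0))))).

Lemma p_solve_ok s : base eA eB s -> var s 10 = 0 ->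
  let s' := den p_solve s in
  found A B s' /\ ((exists X, connected_quotient A B X) -> var s' 10 != 0).
Proof.
move=> bs v10; cbv zeta; rewrite /p_solve den_if ev_var.
have [[v0 v1 _ _] rA rB] := bs.
case: ifP => [A0|/negbFE A0].
  have [a0 ea0] : exists a, eA a = 0 by apply: (rep_onto rA); rewrite lt0n -v0.
  have eBi := rep_inj rB; have [l lo] := ordered_exists A eBi.
  have k1 := p_keys_ok bs.
  have [k2 f2] := p_greedy_ok eBi lo k1.
  rewrite 3!den_seq.
  have w10 : var (den p_greedy (den p_keys s)) 10 = 0 by rewrite !frame_var.
  move: (den p_greedy _) k2 f2 w10 => s2 [b2 _] f2 w10.
  have ps : primed eA eB (fun a => greedy a (l a)) a0 (den (p_orbit 0 22 (ECst 0)) s2).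
    split=> [|a b|h].
    - exact: base_den.
    - by rewrite frame_arr ?f2.
    - by have [_ rA2 _] := b2; apply: (p_orbit_ok b2 _ rA2); rewrite ?leq_subr.
  have fs : found A B (den (p_orbit 0 22 (ECst 0)) s2) by rewrite /found frame_var ?w10.
  have [f h] := p_guess_ok eBi ps fs; split=> // q.
  by apply: h; apply: quotient_hits lo q.
have cA : #|A| = 0 by rewrite -v0; apply/eqP.
rewrite den_if ev_var v1; case: ifP => [B0|/negbFE/eqP cB].
  rewrite den_skip; split; first by rewrite /found v10.
  case=> X [_ [h [hb _]]]; have := bij_eq_card hb.
  by rewrite card_prod cA mul0n => e; rewrite -e in B0.
split=> // _; exists (table 1 (fun=> 0)), (fun j : table 1 (fun=> 0) => val j).
have [i l c n] : rep (fun j : table 1 (fun=> 0) => val j) 1 (fun=> 0).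
  exact: table_rep.
split=> //; last by rewrite cA cB.
  split=> // y; rewrite -n 2!den_seq; have -> : val y = 0 by rewrite (ord1 y).
  by [].
split; first exact: connected_one.
by apply: iso_empty => //; rewrite card_prod cA.
Qed.

(** The answer is kept in variables 10 and 11 and array 28 until the end, because variables 0 and 1
    and array 0 hold the input. *)
Definition p_main : cmd :=
  CSeq (CSet 10 (ECst 0)) (CSeq p_solve
  (CSeq (CSet 0 (EVar 10)) (CSeq (CSet 1 (EVar 11))
    (CFill false 0 20 (EVar 11) (EGet 28 (EVar 20)))))).

Lemma p_main_ok s : base eA eB s -> correct_answer A B (output (den p_main s)).
Proof.
move=> bs; rewrite /p_main 4!den_seq.
set s1 := den (CSet 10 _) s.
have b1 : base eA eB s1 by apply: base_den.
have [f h] := p_solve_ok b1 erefl.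
have b2 : base eA eB (den p_solve s1) by apply: base_den.
move: (den p_solve s1) f h b2 => s2 f h [[_ _ v2 _] _ _].
rewrite /output fill_var [var _ 0]/= [var _ 1]/=.
have [z|nz] := eqVneq (var s2 10) 0; first by move=> q; have := h q; rewrite z.
have [X [e [[i lt c n] q le]]] := f nz; exists X => //.
split; first by rewrite size_mkseq c.
exists e; split=> [//|x|x]; first by rewrite c.
rewrite nth_mkseq // fill_in; [exact: n|exact: lt|].
by apply: leq_trans (lt x) _; rewrite /bvar /= v2.
Qed.

End Main.

Definition p_square : cmd := CSet 4 (ESum false 20 (EVar 2) (EVar 2)).

(** Compiled commands may not assign the loop bounds, so variables 2 and 3 are set outside of them;
    the square goes through variable 4, by a loop under the bound [m] alone. *)
Definition p_all : prog :=
  Seq (Assign 2 (Add (Add (Var 0) (Var 1)) (Cst 2)))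
  (Seq (compc p_square 0)
  (Seq (Assign 3 (Var 4)) (compc p_main 0))).

(** [m.+2] is the loop bound, and 8 pays for the two direct assignments, 6 and 2. *)
Definition time_all (m : nat) : nat :=
  timec p_square m.+2 + timec p_main m.+2 + 8.

(** The degrees are computed. Ranking and comparison of counts each nest three loops of degree 2,
    and the guesses of [w] and [p] add one degree each, which stays within 9. The factor [3 ^ 9]
    comes from [m.+2 <= 3 * m]. *)
Lemma time_all_bigO : bigO time_all (fun m => m ^ 9).
Proof.
pose t1 := timec p_square 1; pose t2 := timec p_main 1.
exists ((t1 + t2 + 8) * 3 ^ 9), 1 => m m1.
have m0 : 0 < m.+2 by [].
have le c : degc c <= 9 -> timec c m.+2 <= timec c 1 * m.+2 ^ 9.
  by move=> dc; apply: leq_trans (timec_deg c m0) (leq_monomial _ m0 dc).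
have := le p_square isT; have := le p_main isT; rewrite /time_all -/t1 -/t2.
have : m.+2 ^ 9 <= 3 ^ 9 * m ^ 9 by rewrite -expnMn leq_exp2r //; lia.
have : 0 < m.+2 ^ 9 by rewrite expn_gt0.
move: (timec p_main _) (timec p_square _) (m.+2 ^ 9) t1 t2 => u2 u1 x t1 t2 x0 xy l2 l1.
rewrite -mulnA; apply: leq_trans (_ : (t1 + t2 + 8) * x <= _); last by rewrite leq_mul2l xy orbT.
by rewrite !mulnDl !leq_add // leq_pmulr.
Qed.

Theorem theorem2 :
  exists (P : prog) (T : nat -> nat),
    bigO T (fun m : nat => m ^ 9) /\
    forall (A B : fdds) (ta tb : seq nat),
      is_table ta A -> is_table tb B ->
      exists (s : store) (t : nat),
        [/\ exec P (input ta tb) s t,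
            correct_answer A B (output s)
          & t <= T (#|A| + #|B|)].
Proof.
exists p_all, time_all; split=> [|A B ta tb]; first exact: time_all_bigO.
move=> [sa [eA [ia la na]]] [sb [eB [ib lb nb]]].
pose M := #|A| + #|B| + 2; pose gs := [:: 0; 1; 4; 5; 6; 7; 8; 9; 10; 11; 12; 13; 14].
pose vs := [:: 2, 3 & gs].
have sc : scope vs.
  by have /allP lt : all (fun x => x < tbase) vs by []; split=> // x /lt.
have sub : {subset gs <= vs} by move=> x xg; rewrite /vs 2!in_cons xg !orbT.
pose s1 := set_var (input ta tb) 2 M.
(* Variable 3 is still 0 in the input, so its bound holds before the square is computed. *)
have bd1 : bounded M s1 by move=> [|]; rewrite /bvar /= ?expn1 ?leqnn.
have [s2 [t2 [x2 [g2 h2] _ l2]]] := @compc_ok gs p_square 0 vs s1 s1 M isT sc sub isT isT bd1 (conj (fun _ _ => erefl) (fun _ _ => erefl)).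
set d2 := den p_square s1 in g2 h2.
have d4 : var d2 4 = M * M.
  by rewrite /d2 den_set var_set eqxx ev_mul // ev_var minnn.
have dv x : x != 4 -> var d2 x = var s1 x by move=> /negPf x4; rewrite /d2 den_set var_set x4.
have da : arr d2 = arr s1 by [].
clearbody d2.
pose d3 := set_var d2 3 (M * M); pose s3 := set_var s2 3 (var s2 4).
have ag : agree vs d3 s3.
  rewrite /d3 -d4 /s3 -(g2 4) //.
  have [g h] := agree_set 3 (var d2 4) (conj g2 h2); split=> // x xv; apply: g.
  by rewrite inE xv orbT.
have b3 : base eA eB d3.
  split; first by split; rewrite /d3 var_set //= dv //= ?sa ?sb.
    by rewrite [arr d3 0]/= da; split.
  by rewrite [arr d3 1]/= da; split.
have bd3 : bounded M s3.
  apply: (bounded_agree sc ag) => -[|]; first by rewrite /bvar /d3 var_set /= expnS expn1.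
  by rewrite /bvar /d3 var_set /= dv //= expn1.
have [s4 [t4 [x4 [g4 h4] _ l4]]] := @compc_ok gs p_main 0 vs s3 d3 M isT sc sub isT isT bd3 ag.
exists s4, (6 + (t2 + (2 + t4))); split.
- apply: ExecSeq (ExecSeq x2 (ExecSeq _ x4)); last exact: (ExecAssign s2 3 (Var 4)).
  have := ExecAssign (input ta tb) 2 (Add (Add (Var 0) (Var 1)) (Cst 2)).
  by rewrite /= sa sb.
- have -> : output s4 = output (den p_main d3); last exact: (p_main_ok b3).
  rewrite /output -(g4 0) // -(g4 1) //; case: eqP => // _; congr Some.
  by apply: eq_mkseq => i; rewrite h4.
- rewrite /time_all (_ : (#|A| + #|B|).+2 = M); last by rewrite /M addn2.
  move: (timec p_square M) (timec p_main M) l2 l4 => u v; lia.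
Qed.
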